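(* Let $0<\alpha,\beta<2$ with $\alpha\beta<2$. Let $\mu$ be any complex number, let $\epsilon>0$, and let $\theta$ satisfy $$\frac{\pi\alpha\beta}{2}<\theta\le \min(\pi,\pi\alpha\beta).$$ If $x\in\Omega^{(+)}(\epsilon_\alpha;\theta_\alpha)$ and $y\in\Omega^{(+)}(\epsilon_\beta;\theta_\beta)$, where $\epsilon_\alpha:=\epsilon^{1/\beta}$, $\epsilon_\beta:=\epsilon^{1/\alpha}$, $\theta_\alpha:=\theta/\beta$ and $\theta_\beta:=\theta/\alpha$, then the following integral representation holds: $$E_{\alpha,\beta}(x,y;\mu)=\frac{1}{\alpha}\,\frac{e^{x^{1/\alpha}}\,x^{\frac{1+\beta-\mu}{\alpha}}}{x^{\beta/\alpha}-y}+\frac{1}{\beta}\,\frac{e^{y^{1/\beta}}\,y^{\frac{1+\alpha-\mu}{\beta}}}{y^{\alpha/\beta}-x}+\frac{1}{2\pi i}\,\frac{1}{\alpha\beta}\int_{\gamma(\epsilon;\theta)}\frac{e^{\zeta^{1/(\alpha\beta)}}\,\zeta^{\frac{\alpha+\beta-\mu}{\alpha\beta}-1}}{(\zeta^{1/\alpha}-y)(\zeta^{1/\beta}-x)}\,d\zeta .$$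
   Context: For $\alpha,\beta,\mu\in\mathbb{C}$ with $\Re(\alpha),\Re(\beta)>0$ and $x,y\in\mathbb{C}$, the generalized Mittag-Leffler type function of two variables is the entire function $$E_{\alpha,\beta}(x,y;\mu):=\sum_{n,m\ge 0}\frac{x^n y^m}{\Gamma(n\alpha+m\beta+\mu)}.$$ For $\epsilon>0$ and $0<\theta\le\pi$, the Hankel contour $\gamma(\epsilon;\theta)$, oriented by non-decreasing $\arg\zeta$, consists of the two rays $\{\arg\zeta=\theta,\ |\zeta|\ge\epsilon\}$ and $\{\arg\zeta=-\theta,\ |\zeta|\ge\epsilon\}$ and the circular arc $\{|\zeta|=\epsilon,\ -\theta\le\arg\zeta\le\theta\}$. If $\theta=\pi$, the contour consists of the circle $|\zeta|=\epsilon$ and the ray $-\infty<\zeta\le-\epsilon$ traversed twice. If $0<\theta<\pi$, the contour $\gamma(\epsilon;\theta)$ divides the complex $\zeta$-plane into two unbounded regions: $\Omega^{(-)}(\epsilon;\theta)$, to the left of $\gamma(\epsilon;\theta)$ by orientation, and $\Omega^{(+)}(\epsilon;\theta)$, to the right of it.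
   Formalization: The exponent of ζ is corrected to (1+α+β−μ)/(αβ)−1 (as printed it fails, e.g. α=β=1, μ=2, x=2, y=3); θ/α, θ/β ≤ π is assumed so that the contours and regions are defined, and x^{β/α} ≠ y, y^{α/β} ≠ x so that the fractions are. *)

(* Defs.v *)
From Stdlib Require Import Reals ZArith.
From Coquelicot Require Import Coquelicot.

Open Scope R_scope.

(** * Elementary complex functions *)

Definition cexp (z : C) : C :=
  (exp (Re z) * cos (Im z), exp (Re z) * sin (Im z)).

(** Principal argument, in (-PI, PI] for z <> 0. *)
Definition carg (z : C) : R :=
  if Rle_dec 0 (Im z) then acos (Re z / Cmod z) else - acos (Re z / Cmod z).

(** The power zeta^s of the point zeta with |zeta| = r > 0 and arg zeta = phi,
    on the branch given by phi.  The argument is kept as a separate datum because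
    the contour with opening PI runs along the negative axis twice, once with
    argument -PI and once with argument PI. *)
Definition polar_pow (r phi : R) (s : C) : C :=
  cexp (s * (ln r, phi))%C.

(** Principal power (used for z <> 0 only). *)
Definition cpow (z s : C) : C := polar_pow (Cmod z) (carg z) s.

(** * Gamma function *)

Definition Gamma_integral (s : C) : C :=
  RInt_gen (V := C_R_CompleteNormedModule)
    (fun t : R => (RtoC (exp (- t)) * cpow (RtoC t) (s - 1))%C)
    (at_right 0) (Rbar_locally p_infty).

(** s (s + 1) ... (s + N - 1) *)
Fixpoint rising (s : C) (N : nat) : C :=
  match N with
  | O => RtoC 1
  | S k => (rising s k * (s + RtoC (INR k)))%C
  end.

(** The entire function 1 / Gamma (zero at the poles of Gamma): Euler's integral,
    which converges on Re s > 0, is continued by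
    Gamma s = Gamma (s + N) / (s (s + 1) ... (s + N - 1)).
    The shift below satisfies Re s + N > 0, and is 0 when Re s > 0. *)
Definition Gamma_shift (s : C) : nat := Z.to_nat (up (- Re s)).

Definition inv_Gamma (s : C) : C :=
  (rising s (Gamma_shift s)
     / Gamma_integral (s + RtoC (INR (Gamma_shift s))))%C.

(** * The two-variable Mittag-Leffler type function *)

(** Sum of a convergent complex series. *)
Definition CSeries (a : nat -> C) : C :=
  (Series (fun n => Re (a n)), Series (fun n => Im (a n))).

(** The double series converges absolutely for Re alpha, Re beta > 0, so it
    may be summed iteratively. *)
Definition mittag_leffler2 (alpha beta x y mu : C) : C :=
  CSeries (fun n => CSeries (fun m =>
    (Cpow x n * Cpow y m
       * inv_Gamma (RtoC (INR n) * alpha + RtoC (INR m) * beta + mu))%C)).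

(** * Hankel contour *)

(** Integral over gamma(eps; theta) of a function given in polar form,
    f r phi being its value at the point of modulus r and argument phi:
    the ray arg = -theta inwards, the arc, then the ray arg = theta outwards. *)
Definition hankel_integral (eps theta : R) (f : R -> R -> C) : C :=
  let ray (phi : R) :=
    RInt_gen (V := C_R_CompleteNormedModule)
      (fun r : R => (f r phi * cexp (0, phi))%C)
      (at_point eps) (Rbar_locally p_infty) in
  let arc :=
    RInt (V := C_R_CompleteNormedModule)
      (fun phi : R => (f eps phi * (Ci * RtoC eps * cexp (0, phi)))%C)
      (- theta) theta in
  (- ray (- theta)%R + arc + ray theta)%C.

(** The region to the right of gamma(eps; theta): the contour runs
    counterclockwise around the origin, so its right-hand side is the exterior
    sector around the positive axis.  Meaningful for 0 < theta <= PI. *)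
Definition Omega_plus (eps theta : R) (z : C) : Prop :=
  eps < Cmod z /\ Rabs (carg z) < theta.

(** With u = zeta^(1/(alpha beta)), Hankel's formula
    1/Gamma(s) = 1/(2 pi i) * int e^u u^(-s) du has integrand
    e^(zeta^(1/(alpha beta))) zeta^((1-s)/(alpha beta) - 1) / (alpha beta);
    at s = n alpha + m beta + mu, multiplying by x^n y^m and summing the two
    geometric series gives the kernel below.
    The literature also prints the exponent (alpha+beta-mu)/(alpha beta) - 1,
    without the 1.  That is a misprint: the representation then fails, e.g. by
    1/(x y) for alpha = beta = 1, mu = 2, and the residue of the kernel at
    zeta = x^beta is no longer the x^((1+beta-mu)/alpha) term. *)
Definition mittag_leffler2_kernel (alpha beta : R) (x y mu : C) (r phi : R) : C :=
  (cexp (polar_pow r phi (RtoC (1 / (alpha * beta))))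
     * polar_pow r phi
         ((1 + RtoC alpha + RtoC beta - mu) / RtoC (alpha * beta) - 1)
     / ((polar_pow r phi (RtoC (1 / alpha)) - y)
          * (polar_pow r phi (RtoC (1 / beta)) - x)))%C.

(* Main.v *)
(** With [u = zeta^(1 / (alpha beta))] and [u = e^w] every power becomes an exponential:
    the Hankel contour becomes the boundary of a half-strip
    [Re w >= a, |Im w| <= psi], [psi = theta / (alpha beta)], and the kernel becomes
    [e^(e^w) e^((1 + alpha + beta - mu) w) / ((e^(beta w) - y) (e^(alpha w) - x))].
    For [a] large, expanding both fractions into geometric series and applying Hankel's
    formula termwise gives the double series.  Moving [a] down to its actual value
    crosses one simple pole for [x] and one for [y], whose residues are the two
    explicit terms.

    Hankel's formula [H(s) = 1 / Gamma(s)] is obtained the same way: the sum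
    [L(t)] of [H(s+n+1) t^n] is the Hankel integral of [e^u u^(-s) / (u - t)], it satisfies
    [(t^s e^(-t) L)' = H(s) t^(s-1) e^(-t)], and the pole at [u = t] shows that
    [t^s e^(-t) L(t)] tends to 1 as [t] tends to infinity; integrating from 0 to
    infinity gives [H(s) Gamma(s) = 1]. *)

Require Import Defs.
From Stdlib Require Import Reals.
From Coquelicot Require Import Coquelicot.
From Stdlib Require Import Lra ZArith ClassicalEpsilon.

(** * Complex derivatives and the exponential *)

(** The coordinate [w] makes all powers single-valued: the two copies of the negative axis that
    occur at opening [PI] become two different horizontal lines. It also makes the contour piecewise
    straight, so Cauchy's theorem is needed for rectangles only. The bounds on [theta] give
    [PI / 2 < psi <= PI]; then [cos psi < 0], and [e^(e^w)] decays doubly exponentially along both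
    horizontal sides, faster than any [e^(k w)] grows. One kind of bound, [M e^(-t)], therefore
    serves all improper contour integrals. Sum and integral are interchanged without a convergence
    theorem: after [N] terms a geometric series misses its sum by [- q^N / (1 - q)], and the
    integral of that is at most a constant times [c^N]. The obstacle is [inv_Gamma], which is built
    from Euler's integral on the real axis. Hankel's formula is usually derived by collapsing the
    contour onto the cut and applying the reflection formula. The differential equation for [L]
    replaces both, and also shows on the way that [H(s)] does not vanish and that Euler's integral
    converges for [Re s > 0]. *)

Local Notation is_Cderive := (is_derive (K := C_AbsRing) (V := AbsRing_NormedModule C_AbsRing)).
Local Notation ex_Cderive := (ex_derive (K := C_AbsRing) (V := AbsRing_NormedModule C_AbsRing)).

Lemma exp_le_compat (x y : R) : x <= y -> exp x <= exp y.
Proof. intros [H| ->]; [left; apply exp_increasing, H|right; reflexivity]. Qed.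

Lemma Cmod_le_Rabs (z : C) : Cmod z <= Rabs (Re z) + Rabs (Im z).
Proof.
  destruct z as [a b]; unfold Cmod, Re, Im; simpl.
  apply Rsqr_incr_0_var.
  - rewrite Rsqr_sqrt by nra. unfold Rsqr.
    generalize (Rabs_pos a) (Rabs_pos b) (Rsqr_abs a) (Rsqr_abs b); unfold Rsqr; nra.
  - generalize (Rabs_pos a) (Rabs_pos b); lra.
Qed.

Lemma im_le_Cmod (z : C) : Rabs (Im z) <= Cmod z.
Proof. eapply Rle_trans; [apply Rmax_r | apply Rmax_Cmod]. Qed.

Lemma Cmod_minus_sym (x y : C) : Cmod (x - y) = Cmod (y - x).
Proof. rewrite <- Cmod_opp. f_equal. ring. Qed.

Lemma Cmod_triangle_minus (x y : C) : Cmod (x - y) <= Cmod x + Cmod y.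
Proof. unfold Cminus. rewrite <- (Cmod_opp y). apply Cmod_triangle. Qed.

Lemma Cmod_triangle_inv (x y : C) : Cmod x - Cmod y <= Cmod (x - y).
Proof.
  generalize (Cmod_triangle (x - y) y). replace (x - y + y)%C with x by ring. lra.
Qed.

(** Bridge from the filter formulation of the derivative to inequalities between moduli. *)
Lemma is_Cderive_eps (f : C -> C) (z d : C) :
  is_Cderive f z d <->
  forall eps, 0 < eps -> exists del, 0 < del /\ forall v,
    Cmod (v - z) < del -> Cmod (f v - f z - d * (v - z)) <= eps * Cmod (v - z).
Proof.
  split.
  - intros [_ H] eps Heps.
    destruct (H z (fun P HP => HP) (mkposreal eps Heps)) as [del Hdel].
    exists del. split; [apply cond_pos|]. intros v Hv.
    specialize (Hdel v Hv).
    change (Cmod ((f v - f z) - (v - z) * d)%C <= eps * Cmod (v - z)%C) in Hdel.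
    rewrite (Cmult_comm (v - z) d) in Hdel. exact Hdel.
  - intros H. split.
    + apply is_linear_scal_l.
    + intros x Hx. rewrite <- (is_filter_lim_locally_unique (K := C_AbsRing) (V := AbsRing_NormedModule C_AbsRing) _ _ Hx). clear x Hx.
      intros [eps Heps]. destruct (H eps Heps) as [del [Hd Hdel]].
      exists (mkposreal del Hd). intros v Hv. specialize (Hdel v Hv).
      change (Cmod ((f v - f z) - (v - z) * d)%C <= eps * Cmod (v - z)%C).
      rewrite (Cmult_comm (v - z) d). exact Hdel.
Qed.

Lemma ex_Cderive_const (c z : C) : ex_Cderive (fun _ => c) z.
Proof. eexists. apply (is_derive_const (K := C_AbsRing) (V := AbsRing_NormedModule C_AbsRing)). Qed.

Lemma ex_Cderive_mult (f g : C -> C) (z : C) :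
  ex_Cderive f z -> ex_Cderive g z -> ex_Cderive (fun v => (f v * g v)%C) z.
Proof.
  intros [df Hf] [dg Hg]. eexists.
  apply (is_derive_mult (K := C_AbsRing) f g z df dg Hf Hg). intros; apply Cmult_comm.
Qed.

Lemma ex_Cderive_minus (f g : C -> C) (z : C) :
  ex_Cderive f z -> ex_Cderive g z -> ex_Cderive (fun v => (f v - g v)%C) z.
Proof.
  intros [df Hf] [dg Hg]. eexists.
  apply (is_derive_minus (K := C_AbsRing) (V := AbsRing_NormedModule C_AbsRing) f g z df dg Hf Hg).
Qed.

Lemma Ccontinuous_of_ex_Cderive (f : C -> C) (z : C) : ex_Cderive f z ->
  forall eps, 0 < eps -> exists del, 0 < del /\ forall v,
    Cmod (v - z) < del -> Cmod (f v - f z) < eps.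
Proof.
  intros [d Hd] eps Heps. apply is_Cderive_eps with (eps := 1) in Hd; [|lra].
  destruct Hd as [del [Hdel Hd]].
  assert (HK : 0 < Cmod d + 1) by (generalize (Cmod_ge_0 d); lra).
  exists (Rmin del (eps / (Cmod d + 1))). split.
  { apply Rmin_pos; [lra|]. apply Rdiv_lt_0_compat; lra. }
  intros v Hv. specialize (Hd v (Rlt_le_trans _ _ _ Hv (Rmin_l _ _))).
  assert (Hv2 := Rlt_le_trans _ _ _ Hv (Rmin_r _ _)).
  replace (f v - f z)%C with (f v - f z - d * (v - z) + d * (v - z))%C by ring.
  eapply Rle_lt_trans; [apply Cmod_triangle|]. rewrite Cmod_mult.
  replace eps with ((Cmod d + 1) * (eps / (Cmod d + 1))) by (field; lra).
  apply Rle_lt_trans with ((Cmod d + 1) * Cmod (v - z)); [lra|].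
  apply Rmult_lt_compat_l; lra.
Qed.

Lemma is_Cderive_inv (z : C) : z <> 0%C -> is_Cderive Cinv z (- / (z * z))%C.
Proof.
  intros Hz. apply is_Cderive_eps. intros eps Heps.
  assert (Hm := proj1 (Cmod_gt_0 z) Hz).
  set (m := Cmod z) in *.
  (* The first radius keeps [|v| >= m / 2]. The exact remainder is [(v - z)^2 / (v z^2)], at most
     [2 |v - z|^2 / m^3], which the second radius turns into [eps |v - z|]. *)
  exists (Rmin (m / 2) (eps * (m * m * m) / 2)). split.
  { apply Rmin_pos; [lra|]. assert (0 < m * m * m) by (repeat apply Rmult_lt_0_compat; lra). nra. }
  intros v Hv.
  assert (H1 := Rlt_le_trans _ _ _ Hv (Rmin_l _ _)).
  assert (H2 := Rlt_le_trans _ _ _ Hv (Rmin_r _ _)).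
  assert (Hvm : m / 2 <= Cmod v).
  { generalize (Cmod_triangle_inv z v). rewrite Cmod_minus_sym. fold m. lra. }
  assert (Hv0 : v <> 0%C) by (apply Cmod_gt_0; lra).
  replace (/ v - / z - - / (z * z) * (v - z))%C with ((v - z) * (v - z) / (v * z * z))%C
    by (field; auto).
  rewrite Cmod_div by (repeat apply Cmult_neq_0; auto). rewrite !Cmod_mult. fold m.
  set (h := Cmod (v - z)) in *. assert (0 <= h) by apply Cmod_ge_0.
  assert (0 < m * m * m) by (repeat apply Rmult_lt_0_compat; lra).
  assert (0 < m * m) by (repeat apply Rmult_lt_0_compat; lra).
  apply Rle_div_l. { repeat apply Rmult_lt_0_compat; lra. }
  apply Rle_trans with (h * (eps * (m * m * m) / 2)).
  { apply Rmult_le_compat_l; lra. }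
  replace (eps * h * (Cmod v * m * m)) with (h * (eps * (m * m * Cmod v))) by ring.
  apply Rmult_le_compat_l; [lra|]. unfold Rdiv. rewrite Rmult_assoc.
  apply Rmult_le_compat_l; [lra|].
  replace (m * m * m * / 2) with (m * m * (m / 2)) by field.
  apply Rmult_le_compat_l; lra.
Qed.

Lemma ex_Cderive_div (f g : C -> C) (z : C) :
  ex_Cderive f z -> ex_Cderive g z -> g z <> 0%C -> ex_Cderive (fun v => (f v / g v)%C) z.
Proof.
  intros Hf [dg Hg] Hz. apply ex_Cderive_mult; [exact Hf|].
  eexists. apply (is_derive_comp (K := C_AbsRing) (V := AbsRing_NormedModule C_AbsRing) Cinv g z _ _ (is_Cderive_inv _ Hz) Hg).
Qed.

Lemma cexp_plus (z w : C) : cexp (z + w) = (cexp z * cexp w)%C.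
Proof.
  destruct z as [a b], w as [c d]. unfold cexp, Re, Im, Cplus, Cmult; simpl.
  rewrite exp_plus, cos_plus, sin_plus. f_equal; ring.
Qed.

Lemma cexp_0 : cexp 0 = 1%C.
Proof. unfold cexp; simpl. rewrite exp_0, cos_0, sin_0. unfold RtoC. f_equal; ring. Qed.

Lemma Cmod_cexp (z : C) : Cmod (cexp z) = exp (Re z).
Proof.
  unfold cexp, Cmod; simpl.
  replace (_ + _) with (Rsqr (exp (Re z)) * (Rsqr (cos (Im z)) + Rsqr (sin (Im z))))
    by (unfold Rsqr; ring).
  rewrite Rplus_comm with (r1 := Rsqr (cos _)), sin2_cos2, Rmult_1_r.
  apply sqrt_Rsqr. left; apply exp_pos.
Qed.

Lemma cexp_neq_0 (z : C) : cexp z <> 0%C.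
Proof. apply Cmod_gt_0. rewrite Cmod_cexp. apply exp_pos. Qed.

Lemma cexp_opp (z : C) : cexp (- z) = (/ cexp z)%C.
Proof.
  assert (H := cexp_neq_0 z).
  assert (E : (cexp (- z) * cexp z = 1)%C).
  { rewrite <- cexp_plus. replace (- z + z)%C with (RtoC 0) by ring. apply cexp_0. }
  rewrite <- (Cmult_1_r (cexp (- z))), <- (Cinv_r _ H), Cmult_assoc, E. ring.
Qed.

Lemma cexp_minus (z w : C) : cexp (z - w) = (cexp z / cexp w)%C.
Proof. unfold Cminus. rewrite cexp_plus, cexp_opp. reflexivity. Qed.

Lemma is_derive_at_0_eps (f : R -> R) (d : R) : is_derive f 0 d ->
  forall eps, 0 < eps -> exists del, 0 < del /\ forall v,
    Rabs v < del -> Rabs (f v - f 0 - d * v) <= eps * Rabs v.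
Proof.
  intros [_ H] eps Heps.
  destruct (H 0 (fun P HP => HP) (mkposreal eps Heps)) as [del Hdel].
  exists del. split; [apply cond_pos|]. intros v Hv.
  assert (Hb : ball 0 del v).
  { change (Rabs (v - 0) < del). rewrite Rminus_0_r. exact Hv. }
  specialize (Hdel v Hb). simpl in Hdel.
  change (Rabs (f v - f 0 - (v - 0) * d) <= eps * Rabs (v - 0)) in Hdel.
  rewrite Rminus_0_r in Hdel. rewrite (Rmult_comm d). exact Hdel.
Qed.

(** Only this point is treated by hand, from the real derivatives of [exp], [sin] and [cos]; the
    functional equation carries the result to every other point. *)
Lemma is_Cderive_cexp_0 : is_Cderive cexp (RtoC 0) (RtoC 1).
Proof.
  apply is_Cderive_eps. intros eps0 Heps0.
  (* The real and the imaginary part of the remainder each cost [3 * eps * h], which explains the 6.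
     The bound by 1 gives [exp a <= 2] and [1 + a <= 2]. *)
  set (eps := Rmin 1 (eps0 / 6)).
  assert (Heps : 0 < eps) by (apply Rmin_pos; lra).
  assert (Heps1 : eps <= 1) by apply Rmin_l.
  assert (Heps6 : eps <= eps0 / 6) by apply Rmin_r.
  destruct (is_derive_at_0_eps exp 1) with (eps := eps) as [d1 [Hd1 He]]; trivial.
  { generalize (is_derive_exp 0). rewrite exp_0. trivial. }
  destruct (is_derive_at_0_eps sin 1) with (eps := eps) as [d2 [Hd2 Hs]]; trivial.
  { generalize (is_derive_sin 0). rewrite cos_0. trivial. }
  destruct (is_derive_at_0_eps cos 0) with (eps := eps) as [d3 [Hd3 Hc]]; trivial.
  { generalize (is_derive_cos 0). rewrite sin_0, Ropp_0. trivial. }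
  exists (Rmin (eps / 2) (Rmin d1 (Rmin d2 d3))). split.
  { repeat apply Rmin_pos; lra. }
  intros v Hv. replace (v - 0)%C with v in * by ring.
  assert (V0 := Rlt_le_trans _ _ _ Hv (Rmin_l _ _)).
  assert (W0 := Rlt_le_trans _ _ _ Hv (Rmin_r _ _)).
  assert (V1 := Rlt_le_trans _ _ _ W0 (Rmin_l _ _)).
  assert (W1 := Rlt_le_trans _ _ _ W0 (Rmin_r _ _)).
  assert (V2 := Rlt_le_trans _ _ _ W1 (Rmin_l _ _)).
  assert (V3 := Rlt_le_trans _ _ _ W1 (Rmin_r _ _)).
  assert (Hre := re_le_Cmod v). assert (Him := im_le_Cmod v).
  rewrite cexp_0. unfold cexp. destruct v as [a b]. unfold Re, Im in *; simpl fst in *; simpl snd in *.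
  set (h := Cmod (a, b)) in *.
  specialize (He a ltac:(lra)). specialize (Hs b ltac:(lra)). specialize (Hc b ltac:(lra)).
  rewrite exp_0, Rmult_1_l in He. rewrite sin_0, Rmult_1_l, Rminus_0_r in Hs.
  rewrite cos_0, Rmult_0_l, Rminus_0_r in Hc.
  assert (Hc1 := COS_bound b).
  assert (Ha := Rabs_pos a). assert (Hb := Rabs_pos b).
  eapply Rle_trans; [apply Cmod_le_Rabs|]. unfold Re, Im; simpl.
  replace (exp a * cos b + - (1) + - (1 * a - 0 * b))
    with ((exp a - 1 - a) * cos b + (1 + a) * (cos b - 1)) by ring.
  replace (exp a * sin b + - 0 + - (1 * b + 0 * a))
    with (exp a * (sin b - b) + (exp a - 1) * b) by ring.
  assert (Hea : Rabs (exp a - 1) <= eps).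
  { replace (exp a - 1) with (exp a - 1 - a + a) by ring.
    eapply Rle_trans; [apply Rabs_triang|]. nra. }
  assert (Hea2 : Rabs (exp a) <= 2).
  { apply Rabs_le_between in Hea. apply Rabs_le_between. lra. }
  assert (Ha2 : Rabs (1 + a) <= 2).
  { apply Rabs_le_between. assert (Q : Rabs a <= 1) by lra. apply Rabs_le_between in Q. lra. }
  assert (Hcb : Rabs (cos b) <= 1) by (apply Rabs_le_between; lra).
  assert (T1 : Rabs ((exp a - 1 - a) * cos b + (1 + a) * (cos b - 1)) <= 3 * eps * h).
  { eapply Rle_trans; [apply Rabs_triang|]. rewrite !Rabs_mult.
    assert (Rabs (exp a - 1 - a) * Rabs (cos b) <= eps * Rabs a * 1)
      by (apply Rmult_le_compat; auto; apply Rabs_pos).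
    assert (Rabs (1 + a) * Rabs (cos b - 1) <= 2 * (eps * Rabs b))
      by (apply Rmult_le_compat; auto; apply Rabs_pos).
    nra. }
  assert (T2 : Rabs (exp a * (sin b - b) + (exp a - 1) * b) <= 3 * eps * h).
  { eapply Rle_trans; [apply Rabs_triang|]. rewrite !Rabs_mult.
    assert (Rabs (exp a) * Rabs (sin b - b) <= 2 * (eps * Rabs b))
      by (apply Rmult_le_compat; auto; apply Rabs_pos).
    assert (Rabs (exp a - 1) * Rabs b <= eps * Rabs b)
      by (apply Rmult_le_compat; auto; try apply Rabs_pos; lra).
    nra. }
  assert (0 <= h) by apply Cmod_ge_0. nra.
Qed.

Lemma is_Cderive_cexp (z : C) : is_Cderive cexp z (cexp z).
Proof.
  apply is_Cderive_eps. intros eps Heps.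
  assert (Hm : 0 < Cmod (cexp z)) by (apply Cmod_gt_0, cexp_neq_0).
  destruct (proj1 (is_Cderive_eps _ _ _) is_Cderive_cexp_0 (eps / Cmod (cexp z)))
    as [del [Hdel H]]. { apply Rdiv_lt_0_compat; lra. }
  exists del. split; [lra|]. intros v Hv.
  specialize (H (v - z)%C). replace (v - z - 0)%C with (v - z)%C in H by ring.
  specialize (H Hv). rewrite cexp_0 in H.
  replace v with (z + (v - z))%C at 1 by ring. rewrite cexp_plus.
  replace (cexp z * cexp (v - z) - cexp z - cexp z * (v - z))%C
    with (cexp z * (cexp (v - z) - 1 - 1 * (v - z)))%C by ring.
  rewrite Cmod_mult.
  apply Rle_trans with (Cmod (cexp z) * (eps / Cmod (cexp z) * Cmod (v - z))).
  { apply Rmult_le_compat_l; lra. }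
  right. field. lra.
Qed.

Lemma ex_Cderive_id (z : C) : ex_Cderive (fun v => v) z.
Proof. eexists. apply (is_derive_id (K := C_AbsRing)). Qed.

Lemma is_Cderive_cexp_lin (k z : C) : is_Cderive (fun w => cexp (k * w)%C) z (k * cexp (k * z))%C.
Proof.
  assert (Hk : is_Cderive (fun w => (k * w)%C) z k).
  { apply is_Cderive_eps. intros eps Heps. exists 1; split; [lra|]. intros v _.
    replace (k * v - k * z - k * (v - z))%C with (RtoC 0) by ring. rewrite Cmod_0.
    apply Rmult_le_pos; [lra|apply Cmod_ge_0]. }
  apply (is_derive_comp (K := C_AbsRing) (V := AbsRing_NormedModule C_AbsRing)
     cexp (fun w => (k * w)%C) z _ _ (is_Cderive_cexp _) Hk).
Qed.

Lemma ex_Cderive_cexp_lin (k z : C) : ex_Cderive (fun w => cexp (k * w)%C) z.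
Proof. eexists; apply is_Cderive_cexp_lin. Qed.

Lemma ex_Cderive_cexp_cexp (z : C) : ex_Cderive (fun w => cexp (cexp w)) z.
Proof.
  eexists. apply (is_derive_comp (K := C_AbsRing) (V := AbsRing_NormedModule C_AbsRing)
     cexp cexp z _ _ (is_Cderive_cexp _) (is_Cderive_cexp _)).
Qed.

Lemma is_Cderive_minus_const (f : C -> C) (z d c : C) :
  is_Cderive f z d -> is_Cderive (fun w => f w - c)%C z d.
Proof.
  rewrite !is_Cderive_eps. intros H eps Heps. destruct (H eps Heps) as [del [Hdel Hv]].
  exists del. split; trivial. intros v Hvz.
  replace (f v - c - (f z - c) - d * (v - z))%C with (f v - f z - d * (v - z))%C by ring.
  apply Hv, Hvz.
Qed.

(** * Integrals along rectangles and Goursat's theorem *)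

Local Notation is_CInt := (is_RInt (V := C_R_CompleteNormedModule)).
Local Notation ex_CInt := (ex_RInt (V := C_R_CompleteNormedModule)).
Local Notation CInt := (RInt (V := C_R_CompleteNormedModule)).
Local Notation Ccontinuous :=
  (continuous (T := R_UniformSpace) (U := C_R_CompleteNormedModule)).

Lemma norm_C_R (z : C) : norm (V := C_R_CompleteNormedModule) z = Cmod z.
Proof. symmetry. apply Cmod_norm. Qed.

Lemma Ccontinuous_eps (f : R -> C) (x : R) :
  Ccontinuous f x <->
  forall eps, 0 < eps -> exists del, 0 < del /\ forall t,
    Rabs (t - x) < del -> Cmod (f t - f x) < eps.
Proof.
  split.
  - intros H eps Heps.
    destruct (proj1 (filterlim_locally_ball_norm (U := C_R_CompleteNormedModule) f (f x)) H
      (mkposreal eps Heps)) as [del Hdel].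
    exists del. split; [apply cond_pos|]. intros t Ht. specialize (Hdel t Ht).
    unfold ball_norm in Hdel. rewrite norm_C_R in Hdel. exact Hdel.
  - intros H. apply (filterlim_locally_ball_norm (U := C_R_CompleteNormedModule) f (f x)).
    intros [eps Heps]. destruct (H eps Heps) as [del [Hd Hdel]].
    exists (mkposreal del Hd). intros t Ht. unfold ball_norm. rewrite norm_C_R.
    apply Hdel. exact Ht.
Qed.

Lemma is_CInt_unique (f : R -> C) (a b : R) (l : C) : is_CInt f a b l -> CInt f a b = l.
Proof. apply is_RInt_unique. Qed.

Lemma CInt_correct (f : R -> C) (a b : R) : ex_CInt f a b -> is_CInt f a b (CInt f a b).
Proof. apply (RInt_correct (V := C_R_CompleteNormedModule)). Qed.

Lemma is_CInt_plus (f g : R -> C) (a b : R) (lf lg : C) :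
  is_CInt f a b lf -> is_CInt g a b lg -> is_CInt (fun t => (f t + g t)%C) a b (lf + lg)%C.
Proof. apply (is_RInt_plus (V := C_R_CompleteNormedModule)). Qed.

Lemma is_CInt_minus (f g : R -> C) (a b : R) (lf lg : C) :
  is_CInt f a b lf -> is_CInt g a b lg -> is_CInt (fun t => (f t - g t)%C) a b (lf - lg)%C.
Proof. apply (is_RInt_minus (V := C_R_CompleteNormedModule)). Qed.

Lemma is_CInt_pair (f : R -> C) (a b : R) (l : C) :
  is_RInt (fun t => Re (f t)) a b (Re l) -> is_RInt (fun t => Im (f t)) a b (Im l) ->
  is_CInt f a b l.
Proof.
  intros H1 H2. destruct l as [l1 l2].
  apply (is_RInt_fct_extend_pair (U := R_NormedModule) (V := R_NormedModule) f a b l1 l2 H1 H2).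
Qed.

Lemma is_CInt_Re (f : R -> C) (a b : R) (l : C) :
  is_CInt f a b l -> is_RInt (fun t => Re (f t)) a b (Re l).
Proof. apply (is_RInt_fct_extend_fst (U := R_NormedModule) (V := R_NormedModule)). Qed.

Lemma is_CInt_Im (f : R -> C) (a b : R) (l : C) :
  is_CInt f a b l -> is_RInt (fun t => Im (f t)) a b (Im l).
Proof. apply (is_RInt_fct_extend_snd (U := R_NormedModule) (V := R_NormedModule)). Qed.

Lemma is_CInt_Cmult (c : C) (f : R -> C) (a b : R) (l : C) :
  is_CInt f a b l -> is_CInt (fun t => (c * f t)%C) a b (c * l)%C.
Proof.
  intros H. assert (H1 := is_CInt_Re _ _ _ _ H). assert (H2 := is_CInt_Im _ _ _ _ H).
  apply is_CInt_pair.
  - apply (is_RInt_minus (V := R_NormedModule)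
      (fun t => Re c * Re (f t)) (fun t => Im c * Im (f t)));
    apply (is_RInt_scal (V := R_NormedModule)); assumption.
  - apply (is_RInt_plus (V := R_NormedModule)
      (fun t => Re c * Im (f t)) (fun t => Im c * Re (f t)));
    apply (is_RInt_scal (V := R_NormedModule)); assumption.
Qed.

Lemma Cmod_CInt_le (f : R -> C) (a b M : R) (l : C) : a <= b ->
  (forall t, a <= t <= b -> Cmod (f t) <= M) -> is_CInt f a b l -> Cmod l <= (b - a) * M.
Proof.
  intros Hab HM H. rewrite <- norm_C_R.
  apply (norm_RInt_le_const (V := C_R_CompleteNormedModule) f a b l M Hab); trivial.
  intros t Ht. rewrite norm_C_R. auto.
Qed.

Lemma ex_CInt_cont (f : R -> C) (a b : R) : a <= b ->
  (forall t, a <= t <= b -> Ccontinuous f t) -> ex_CInt f a b.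
Proof.
  intros Hab H. apply (ex_RInt_continuous (V := C_R_CompleteNormedModule)).
  intros t. rewrite Rmin_left, Rmax_right by lra. apply H.
Qed.

Lemma Ccontinuous_horizontal (f : C -> C) (x y : R) :
  ex_Cderive f (x, y) -> Ccontinuous (fun t => f (t, y)) x.
Proof.
  intros H. apply Ccontinuous_eps. intros eps Heps.
  destruct (Ccontinuous_of_ex_Cderive f (x, y) H eps Heps) as [del [Hd Hdel]].
  exists del. split; trivial. intros t Ht. apply Hdel.
  change (Cmod ((t, y) - (x, y))%C < del).
  replace ((t, y) - (x, y))%C with (RtoC (t - x)) by (unfold RtoC, Cminus, Cplus, Copp; simpl; f_equal; ring).
  rewrite Cmod_R. exact Ht.
Qed.

Lemma Ccontinuous_vertical (f : C -> C) (x y : R) :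
  ex_Cderive f (x, y) -> Ccontinuous (fun t => f (x, t)) y.
Proof.
  intros H. apply Ccontinuous_eps. intros eps Heps.
  destruct (Ccontinuous_of_ex_Cderive f (x, y) H eps Heps) as [del [Hd Hdel]].
  exists del. split; trivial. intros t Ht. apply Hdel.
  change (Cmod ((x, t) - (x, y))%C < del).
  replace ((x, t) - (x, y))%C with (Ci * RtoC (t - y))%C
    by (unfold RtoC, Ci, Cminus, Cplus, Copp, Cmult; simpl; f_equal; ring).
  rewrite Cmod_mult, Cmod_Ci, Cmod_R. lra.
Qed.

(** The contour integral over the counterclockwise boundary of a rectangle, with [dz = i dt] on the
    vertical sides. *)
Definition rect_int (f : C -> C) (a b c d : R) : C :=
  (CInt (fun t => f (t, c)) a b - CInt (fun t => f (t, d)) a b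
   + Ci * (CInt (fun t => f (b, t)) c d - CInt (fun t => f (a, t)) c d))%C.

Definition ex_rect_int (f : C -> C) (a b c d : R) : Prop :=
  ex_CInt (fun t => f (t, c)) a b /\ ex_CInt (fun t => f (t, d)) a b /\
  ex_CInt (fun t => f (b, t)) c d /\ ex_CInt (fun t => f (a, t)) c d.

Definition on_frame (P : C -> Prop) (a b c d : R) : Prop :=
  (forall t, a <= t <= b -> P (t, c) /\ P (t, d)) /\
  (forall t, c <= t <= d -> P (a, t) /\ P (b, t)).

Lemma ex_rect_int_holo (f : C -> C) (a b c d : R) : a <= b -> c <= d ->
  on_frame (ex_Cderive f) a b c d -> ex_rect_int f a b c d.
Proof.
  intros Hab Hcd [H1 H2].
  split; [|split; [|split]]; (apply ex_CInt_cont; [assumption|]); intros t Ht.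
  - exact (Ccontinuous_horizontal f t c (proj1 (H1 t Ht))).
  - exact (Ccontinuous_horizontal f t d (proj2 (H1 t Ht))).
  - exact (Ccontinuous_vertical f b t (proj2 (H2 t Ht))).
  - exact (Ccontinuous_vertical f a t (proj1 (H2 t Ht))).
Qed.

Lemma rect_int_split_v (f : C -> C) (a m b c d : R) :
  ex_rect_int f a m c d -> ex_rect_int f m b c d ->
  rect_int f a b c d = (rect_int f a m c d + rect_int f m b c d)%C.
Proof.
  intros (H1 & H2 & _) (H3 & H4 & _). unfold rect_int.
  rewrite <- (RInt_Chasles (V := C_R_CompleteNormedModule) (fun t => f (t, c)) a m b H1 H3),
    <- (RInt_Chasles (V := C_R_CompleteNormedModule) (fun t => f (t, d)) a m b H2 H4).
  change (@plus C_R_CompleteNormedModule) with Cplus. ring.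
Qed.

Lemma rect_int_split_h (f : C -> C) (a b c m d : R) :
  ex_rect_int f a b c m -> ex_rect_int f a b m d ->
  rect_int f a b c d = (rect_int f a b c m + rect_int f a b m d)%C.
Proof.
  intros (_ & _ & H1 & H2) (_ & _ & H3 & H4). unfold rect_int.
  rewrite <- (RInt_Chasles (V := C_R_CompleteNormedModule) (fun t => f (b, t)) c m d H1 H3),
    <- (RInt_Chasles (V := C_R_CompleteNormedModule) (fun t => f (a, t)) c m d H2 H4).
  change (@plus C_R_CompleteNormedModule) with Cplus. ring.
Qed.

Lemma rect_int_minus (f g : C -> C) (a b c d : R) :
  ex_rect_int f a b c d -> ex_rect_int g a b c d ->
  ex_rect_int (fun z => f z - g z)%C a b c d /\
  rect_int (fun z => f z - g z)%C a b c d = (rect_int f a b c d - rect_int g a b c d)%C.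
Proof.
  intros (F1 & F2 & F3 & F4) (G1 & G2 & G3 & G4).
  assert (K : forall u v x y, ex_CInt u x y -> ex_CInt v x y ->
    is_CInt (fun t => u t - v t)%C x y (CInt u x y - CInt v x y)%C).
  { intros u v x y Hu Hv. apply is_CInt_minus; apply CInt_correct; assumption. }
  split.
  - split; [|split; [|split]]; eexists; apply K; assumption.
  - unfold rect_int.
    rewrite (is_CInt_unique _ _ _ _ (K _ _ _ _ F1 G1)), (is_CInt_unique _ _ _ _ (K _ _ _ _ F2 G2)),
      (is_CInt_unique _ _ _ _ (K _ _ _ _ F3 G3)), (is_CInt_unique _ _ _ _ (K _ _ _ _ F4 G4)).
    ring.
Qed.

Lemma Cmod_rect_int_le (f : C -> C) (a b c d M : R) : a <= b -> c <= d ->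
  ex_rect_int f a b c d -> on_frame (fun z => Cmod (f z) <= M) a b c d ->
  Cmod (rect_int f a b c d) <= 2 * ((b - a) + (d - c)) * M.
Proof.
  intros Hab Hcd (F1 & F2 & F3 & F4) [H1 H2].
  apply CInt_correct in F1. apply CInt_correct in F2.
  apply CInt_correct in F3. apply CInt_correct in F4.
  apply (Cmod_CInt_le _ a b M _ Hab) in F1; [|intros; apply H1; trivial].
  apply (Cmod_CInt_le _ a b M _ Hab) in F2; [|intros; apply H1; trivial].
  apply (Cmod_CInt_le _ c d M _ Hcd) in F3; [|intros; apply H2; trivial].
  apply (Cmod_CInt_le _ c d M _ Hcd) in F4; [|intros; apply H2; trivial].
  unfold rect_int. eapply Rle_trans; [apply Cmod_triangle|].
  rewrite Cmod_mult, Cmod_Ci, Rmult_1_l.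
  eapply Rle_trans; [apply Rplus_le_compat; apply Cmod_triangle_minus|]. lra.
Qed.

(** The point [t * k + e] runs along a horizontal side for [k = 1] and along a vertical one for
    [k = Ci], so one formula covers all four sides. *)
Lemma is_CInt_affine (p q k e : C) (a b : R) :
  is_CInt (fun t => p + q * (RtoC t * k + e))%C a b
    (p * RtoC (b - a) + q * (RtoC ((b * b - a * a) / 2) * k + RtoC (b - a) * e))%C.
Proof.
  assert (Hid : is_RInt (fun t => t) a b ((b * b - a * a) / 2)).
  { replace ((b * b - a * a) / 2) with (minus (b * b / 2) (a * a / 2))
      by (unfold minus, plus, opp; simpl; field).
    apply (is_RInt_derive (V := R_CompleteNormedModule) (fun t => t * t / 2)).
    - intros x _. auto_derive; trivial. field.
    - intros x _. apply continuous_id. }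
  assert (HC : forall v : C, is_CInt (fun _ => v) a b (v * RtoC (b - a))%C).
  { intros v. replace (v * RtoC (b - a))%C with (scal (V := C_R_CompleteNormedModule) (b - a) v).
    - apply (is_RInt_const (V := C_R_CompleteNormedModule)).
    - rewrite Cmult_comm. apply (scal_R_Cmult (b - a) v). }
  assert (HT : is_CInt RtoC a b (RtoC ((b * b - a * a) / 2))).
  { apply is_CInt_pair.
    - exact Hid.
    - unfold Im, RtoC; simpl. assert (E := is_RInt_const (V := R_NormedModule) a b 0).
      change (scal (b - a) 0) with ((b - a) * 0) in E. rewrite Rmult_0_r in E. exact E. }
  apply is_CInt_plus; [apply HC|]. apply is_CInt_Cmult.
  rewrite (Cmult_comm _ e). apply is_CInt_plus; [|apply HC].
  rewrite (Cmult_comm _ k).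
  apply (is_RInt_ext (V := C_R_CompleteNormedModule)) with (f := fun t => (k * RtoC t)%C).
  - intros; apply Cmult_comm.
  - apply is_CInt_Cmult, HT.
Qed.

(** This allows the tangent map of a function to be subtracted in Goursat's argument without
    changing the integral. *)
Lemma rect_int_affine (p q : C) (a b c d : R) :
  ex_rect_int (fun z => p + q * z)%C a b c d /\
  rect_int (fun z => p + q * z)%C a b c d = 0%C.
Proof.
  assert (K1 : forall y x x', is_CInt (fun t => p + q * (t, y))%C x x'
    (p * RtoC (x' - x) + q * (RtoC ((x' * x' - x * x) / 2) * 1 + RtoC (x' - x) * (0, y)))%C).
  { intros y x x'.
    eapply (is_RInt_ext (V := C_R_CompleteNormedModule)); [|apply (is_CInt_affine p q 1 (0, y))].
    intros t _. do 2 f_equal. unfold Cplus, Cmult, RtoC; simpl. f_equal; ring. }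
  assert (K2 : forall y x x', is_CInt (fun t => p + q * (y, t))%C x x'
    (p * RtoC (x' - x) + q * (RtoC ((x' * x' - x * x) / 2) * Ci + RtoC (x' - x) * (y, 0)))%C).
  { intros y x x'.
    eapply (is_RInt_ext (V := C_R_CompleteNormedModule)); [|apply (is_CInt_affine p q Ci (y, 0))].
    intros t _. do 2 f_equal. unfold Cplus, Cmult, RtoC, Ci; simpl. f_equal; ring. }
  split.
  - split; [|split; [|split]]; eexists; [apply K1|apply K1|apply K2|apply K2].
  - unfold rect_int. rewrite !(is_CInt_unique _ _ _ _ (K1 _ _ _)), !(is_CInt_unique _ _ _ _ (K2 _ _ _)).
    destruct p as [p1 p2], q as [q1 q2].
    unfold Cplus, Cminus, Copp, Cmult, RtoC, Ci; simpl. f_equal; field.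
Qed.

(** * Goursat's theorem by repeated quartering *)

Lemma nested_intervals (u v : nat -> R) :
  (forall n, u n <= u (S n)) -> (forall n, v (S n) <= v n) -> (forall n, u n <= v n) ->
  exists p, forall n, u n <= p <= v n.
Proof.
  intros Hu Hv Huv.
  assert (Mu : forall n k, u n <= u (n + k)%nat).
  { intros n k; induction k as [|k IH]; [rewrite Nat.add_0_r; lra|].
    rewrite Nat.add_succ_r. eapply Rle_trans; [exact IH|apply Hu]. }
  assert (Mv : forall n k, v (n + k)%nat <= v n).
  { intros n k; induction k as [|k IH]; [rewrite Nat.add_0_r; lra|].
    rewrite Nat.add_succ_r. eapply Rle_trans; [apply Hv|exact IH]. }
  assert (B : forall n m, u n <= v m).
  { intros n m. apply Rle_trans with (u (n + m)%nat); [apply Mu|].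
    apply Rle_trans with (v (n + m)%nat); [apply Huv|]. rewrite Nat.add_comm. apply Mv. }
  destruct (completeness (fun x => exists n, x = u n)) as [p [P1 P2]].
  - exists (v O). intros x [n ->]. apply B.
  - exists (u O), O. reflexivity.
  - exists p. intros n. split.
    + apply P1. exists n. reflexivity.
    + apply P2. intros x [m ->]. apply B.
Qed.

Definition width (I : R * R) : R := snd I - fst I.

Definition is_half (J I : R * R) : Prop :=
  J = (fst I, (fst I + snd I) / 2) \/ J = ((fst I + snd I) / 2, snd I).

Lemma is_half_width (J I : R * R) : is_half J I -> width J = width I / 2.
Proof. unfold width. intros [-> | ->]; simpl; field. Qed.

Lemma is_half_incl (J I : R * R) : is_half J I -> 0 <= width I ->
  fst I <= fst J /\ snd J <= snd I.
Proof. unfold width. intros [-> | ->]; simpl; lra. Qed.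

Definition holo_on (f : C -> C) (I J : R * R) : Prop :=
  forall x y, fst I <= x <= snd I -> fst J <= y <= snd J -> ex_Cderive f (x, y).

(** With the squared half-perimeter on the left, the quarters of a rectangle that
    are not large add up exactly to a rectangle that is not large. *)
Definition large_integral (f : C -> C) (eps : R) (I J : R * R) : Prop :=
  eps * (width I + width J) ^ 2 < Cmod (rect_int f (fst I) (snd I) (fst J) (snd J)).

Lemma large_integral_quarter (f : C -> C) (eps : R) (I J : R * R) :
  0 <= width I -> 0 <= width J -> holo_on f I J -> large_integral f eps I J ->
  exists I' J', is_half I' I /\ is_half J' J /\ large_integral f eps I' J'.
Proof.
  intros N1 N2 Hol HB.
  destruct (excluded_middle_informative
    (exists I' J', is_half I' I /\ is_half J' J /\ large_integral f eps I' J'))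
    as [|Hn]; trivial. exfalso.
  assert (S : forall I' J', is_half I' I -> is_half J' J ->
    Cmod (rect_int f (fst I') (snd I') (fst J') (snd J')) <= eps * (width I + width J) ^ 2 / 4).
  { intros I' J' HI HJ. apply Rnot_lt_le. intros HL. apply Hn. exists I', J'.
    repeat split; trivial. unfold large_integral.
    rewrite (is_half_width _ _ HI), (is_half_width _ _ HJ).
    replace (eps * (width I / 2 + width J / 2) ^ 2) with (eps * (width I + width J) ^ 2 / 4)
      by field. exact HL. }
  clear Hn. destruct I as [a b], J as [c d]. unfold large_integral in HB.
  set (E := eps * (width (a, b) + width (c, d)) ^ 2) in *. clearbody E.
  unfold width in *; simpl in *.
  set (m := (a + b) / 2) in *. set (n := (c + d) / 2) in *.
  assert (S1 := S (a, m) (c, n) (or_introl eq_refl) (or_introl eq_refl)).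
  assert (S2 := S (a, m) (n, d) (or_introl eq_refl) (or_intror eq_refl)).
  assert (S3 := S (m, b) (c, n) (or_intror eq_refl) (or_introl eq_refl)).
  assert (S4 := S (m, b) (n, d) (or_intror eq_refl) (or_intror eq_refl)).
  clear S. simpl in *.
  assert (Hm : a <= m <= b) by (unfold m; lra). assert (Hn : c <= n <= d) by (unfold n; lra).
  assert (EX : forall a' b' c' d', a <= a' -> a' <= b' -> b' <= b -> c <= c' -> c' <= d' -> d' <= d ->
    ex_rect_int f a' b' c' d').
  { intros. apply ex_rect_int_holo; try lra. split; intros; split; apply Hol; simpl; lra. }
  rewrite (rect_int_split_v f a m b c d) in HB by (apply EX; lra).
  rewrite (rect_int_split_h f a m c n d) in HB by (apply EX; lra).
  rewrite (rect_int_split_h f m b c n d) in HB by (apply EX; lra).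
  assert (T := Cmod_triangle (rect_int f a m c n + rect_int f a m n d)
    (rect_int f m b c n + rect_int f m b n d)).
  assert (T1 := Cmod_triangle (rect_int f a m c n) (rect_int f a m n d)).
  assert (T2 := Cmod_triangle (rect_int f m b c n) (rect_int f m b n d)).
  lra.
Qed.

Lemma large_integral_nested (f : C -> C) (eps : R) (I J : R * R) :
  0 <= width I -> 0 <= width J -> holo_on f I J -> large_integral f eps I J ->
  exists p q : R, fst I <= p <= snd I /\ fst J <= q <= snd J /\
    forall del, 0 < del -> exists I' J',
      0 <= width I' /\ 0 <= width J' /\ width I' + width J' < del /\
      holo_on f I' J' /\ large_integral f eps I' J' /\
      fst I' <= p <= snd I' /\ fst J' <= q <= snd J'.
Proof.
  intros N1 N2 Hol HB.
  set (inv := fun Q : (R * R) * (R * R) => 0 <= width (fst Q) /\ 0 <= width (snd Q) /\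
    holo_on f (fst Q) (snd Q) /\ large_integral f eps (fst Q) (snd Q)).
  (* A large quarter is only known to exist, so it is chosen by [epsilon]; [inv] carries along what
     the next choice requires. *)
  set (next := fun Q => epsilon (inhabits Q) (fun Q' => inv Q' /\
    is_half (fst Q') (fst Q) /\ is_half (snd Q') (snd Q))).
  assert (Hnext : forall Q, inv Q ->
    inv (next Q) /\ is_half (fst (next Q)) (fst Q) /\ is_half (snd (next Q)) (snd Q)).
  { intros [K L] (K1 & K2 & K3 & K4); simpl in *. unfold next. apply epsilon_spec.
    destruct (large_integral_quarter f eps K L K1 K2 K3 K4) as (K' & L' & HK & HL & HQ).
    exists (K', L'). unfold inv; simpl.
    rewrite (is_half_width _ _ HK), (is_half_width _ _ HL).
    destruct (is_half_incl _ _ HK K1), (is_half_incl _ _ HL K2).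
    repeat split; trivial; try lra. intros x y Hx Hy. apply K3; lra. }
  clearbody next.
  set (Q := fun n => Nat.iter n next (I, J)).
  assert (Hinv : forall n, inv (Q n)).
  { induction n; simpl; [unfold inv; auto|]. apply Hnext, IHn. }
  assert (Hhalf : forall n, is_half (fst (Q (S n))) (fst (Q n)) /\ is_half (snd (Q (S n))) (snd (Q n))).
  { intros n. apply (Hnext (Q n)), Hinv. }
  assert (Hw : forall n, width (fst (Q n)) + width (snd (Q n)) = (width I + width J) / 2 ^ n).
  { induction n; simpl pow; [simpl; field|].
    destruct (Hhalf n) as [A B]. rewrite (is_half_width _ _ A), (is_half_width _ _ B).
    replace (_ / (2 * 2 ^ n)) with ((width I + width J) / 2 ^ n / 2)
      by (field; apply pow_nonzero; lra). lra. }
  destruct (nested_intervals (fun n => fst (fst (Q n))) (fun n => snd (fst (Q n)))) as [p Hp].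
  { intros n. apply (is_half_incl _ _ (proj1 (Hhalf n))), (Hinv n). }
  { intros n. apply (is_half_incl _ _ (proj1 (Hhalf n))), (Hinv n). }
  { intros n. destruct (Hinv n) as [H _]. unfold width in H. lra. }
  destruct (nested_intervals (fun n => fst (snd (Q n))) (fun n => snd (snd (Q n)))) as [q Hq].
  { intros n. apply (is_half_incl _ _ (proj2 (Hhalf n))), (Hinv n). }
  { intros n. apply (is_half_incl _ _ (proj2 (Hhalf n))), (Hinv n). }
  { intros n. destruct (Hinv n) as [_ [H _]]. unfold width in H. lra. }
  exists p, q. split; [apply (Hp O)|]. split; [apply (Hq O)|].
  intros del Hdel.
  (* The added 1 keeps the denominator positive when both intervals are points. *)
  destruct (pow_lt_1_zero (/ 2)) with (y := del / (width I + width J + 1)) as [n Hn].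
  { rewrite Rabs_pos_eq; lra. }
  { apply Rdiv_lt_0_compat; lra. }
  specialize (Hn n (le_n n)).
  exists (fst (Q n)), (snd (Q n)). destruct (Hinv n) as (J1 & J2 & J3 & J4).
  repeat split; trivial; try apply Hp; try apply Hq.
  rewrite Hw. rewrite Rabs_pos_eq in Hn by (apply pow_le; lra).
  rewrite pow_inv in Hn. apply Rlt_div_r in Hn; [|lra].
  assert (0 < / 2 ^ n) by (apply Rinv_0_lt_compat, pow_lt; lra). unfold Rdiv. nra.
Qed.

Theorem rect_int_holo (f : C -> C) (a b c d : R) : a <= b -> c <= d ->
  (forall x y, a <= x <= b -> c <= y <= d -> ex_Cderive f (x, y)) ->
  rect_int f a b c d = 0%C.
Proof.
  intros Hab Hcd Hol.
  destruct (Req_dec (Cmod (rect_int f a b c d)) 0) as [E|E]; [apply Cmod_eq_0, E|exfalso].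
  assert (Hpos : 0 < Cmod (rect_int f a b c d)) by (generalize (Cmod_ge_0 (rect_int f a b c d)); lra).
  set (m := Cmod (rect_int f a b c d)) in *.
  set (L := b - a + (d - c)).
  assert (HL : 0 <= L) by (unfold L; lra).
  (* This makes the whole rectangle large, since [eps * L ^ 2 < m]; the added 1 covers [L = 0]. *)
  set (eps := m / (L ^ 2 + 1)).
  assert (Heps : 0 < eps) by (apply Rdiv_lt_0_compat; nra).
  destruct (large_integral_nested f eps (a, b) (c, d)) as (p & q & Hp & Hq & Hsmall);
    unfold width; simpl; try lra; [exact Hol| |].
  { unfold large_integral, width; simpl. fold L. fold m.
    apply Rlt_le_trans with (eps * (L ^ 2 + 1)); [nra|].
    right. unfold eps. field. nra. }
  simpl in Hp, Hq. destruct (Hol p q Hp Hq) as [D HD].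
  (* On a nested rectangle with half-perimeter [L'] the tangent map misses [f] by at most
     [eps / 2 * L'], and the perimeter is [2 * L']. The integral is then at most [eps * L' ^ 2],
     which contradicts largeness. *)
  apply is_Cderive_eps with (eps := eps / 2) in HD; [|lra].
  destruct HD as [del [Hdel HD]].
  destruct (Hsmall del Hdel) as ([a' b'] & [c' d'] & W1 & W2 & W3 & Hol' & HB & Hp' & Hq').
  unfold large_integral, width in *; simpl in *.
  set (L' := b' - a' + (d' - c')) in *.
  assert (HF : ex_rect_int f a' b' c' d').
  { apply ex_rect_int_holo; try lra. split; intros; split; apply Hol'; simpl; lra. }
  destruct (rect_int_affine (f (p, q) - D * (p, q))%C D a' b' c' d') as [HA1 HA2].
  destruct (rect_int_minus _ _ _ _ _ _ HF HA1) as [HM1 HM2].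
  rewrite HA2 in HM2. replace (rect_int f a' b' c' d') with (rect_int f a' b' c' d' - 0)%C in HB by ring.
  rewrite <- HM2 in HB.
  assert (HV : forall x y, a' <= x <= b' -> c' <= y <= d' ->
    Cmod (f (x, y) - (f (p, q) - D * (p, q) + D * (x, y))) <= eps / 2 * L').
  { intros x y Hx Hy.
    assert (Hd : Cmod ((x, y) - (p, q)) <= L').
    { eapply Rle_trans; [apply Cmod_le_Rabs|]. unfold Re, Im; simpl. unfold L'.
      apply Rplus_le_compat; apply Rabs_le_between; lra. }
    replace (f (x, y) - (f (p, q) - D * (p, q) + D * (x, y)))%C
      with (f (x, y) - f (p, q) - D * ((x, y) - (p, q)))%C by ring.
    eapply Rle_trans; [apply HD; lra|]. apply Rmult_le_compat_l; lra. }
  assert (HC := Cmod_rect_int_le _ a' b' c' d' (eps / 2 * L') ltac:(lra) ltac:(lra) HM1).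
  fold L' in HC.
  assert (Cmod (rect_int (fun z => f z - (f (p, q) - D * (p, q) + D * z))%C a' b' c' d')
    <= 2 * L' * (eps / 2 * L')).
  { apply HC. split; intros; split; apply HV; lra. }
  nra.
Qed.

(** * Residues at simple poles *)

Lemma is_CInt_RtoC (f : R -> R) (a b l : R) :
  is_RInt f a b l -> is_CInt (fun t => RtoC (f t)) a b (RtoC l).
Proof.
  intros H. apply is_CInt_pair; [exact H|].
  assert (E := is_RInt_const (V := R_NormedModule) a b 0).
  change (scal (b - a) 0) with ((b - a) * 0) in E. rewrite Rmult_0_r in E. exact E.
Qed.

Lemma is_CInt_ext (f g : R -> C) (a b : R) (l : C) :
  (forall t, f t = g t) -> is_CInt f a b l -> is_CInt g a b l.
Proof. intros H. apply (is_RInt_ext (V := C_R_CompleteNormedModule)). intros; apply H. Qed.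

Lemma ex_rect_int_Cmult (k : C) (f : C -> C) (a b c d : R) :
  ex_rect_int f a b c d -> ex_rect_int (fun z => k * f z)%C a b c d.
Proof.
  intros (H1 & H2 & H3 & H4).
  split; [|split; [|split]]; eexists; apply is_CInt_Cmult, CInt_correct; assumption.
Qed.

Lemma rect_int_Cmult (k : C) (f : C -> C) (a b c d : R) :
  ex_rect_int f a b c d ->
  rect_int (fun z => k * f z)%C a b c d = (k * rect_int f a b c d)%C.
Proof.
  intros (H1 & H2 & H3 & H4). unfold rect_int.
  rewrite (is_CInt_unique _ _ _ _ (is_CInt_Cmult k _ _ _ _ (CInt_correct _ _ _ H1))),
    (is_CInt_unique _ _ _ _ (is_CInt_Cmult k _ _ _ _ (CInt_correct _ _ _ H2))),
    (is_CInt_unique _ _ _ _ (is_CInt_Cmult k _ _ _ _ (CInt_correct _ _ _ H3))),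
    (is_CInt_unique _ _ _ _ (is_CInt_Cmult k _ _ _ _ (CInt_correct _ _ _ H4))).
  ring.
Qed.

Lemma sum_sqr_pos (s r : R) : 0 < r -> 0 < s * s + r * r.
Proof. intros Hr. generalize (Rle_0_sqr s) (Rmult_lt_0_compat r r Hr Hr). unfold Rsqr. lra. Qed.

(** Opposite sides of a square about [w] combine in [1 / (z - w)] to this real integrand, up to a
    factor [Ci] for the horizontal pair. With the primitive [2 atan ((t - p) / r)] each pair
    contributes [4 atan 1 = PI]. *)
Lemma is_RInt_square_side (p r : R) : 0 < r ->
  is_RInt (fun t => 2 * r / ((t - p) * (t - p) + r * r)) (p - r) (p + r) PI.
Proof.
  intros Hr.
  assert (H : is_RInt (fun t => 2 * r / ((t - p) * (t - p) + r * r)) (p - r) (p + r)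
    (minus (2 * atan ((p + r - p) / r)) (2 * atan ((p - r - p) / r)))).
  { apply (is_RInt_derive (V := R_CompleteNormedModule) (fun t => 2 * atan ((t - p) / r))).
    - intros t _. assert (N := sum_sqr_pos (t - p) r Hr). auto_derive; trivial. field. repeat split; try lra; nra.
    - intros t _. apply continuity_pt_filterlim. apply derivable_continuous_pt.
      apply ex_derive_Reals_0. auto_derive. assert (N := sum_sqr_pos (t - p) r Hr). lra. }
  replace ((p + r - p) / r) with 1 in H by (field; lra).
  replace ((p - r - p) / r) with (- (1)) in H by (field; lra).
  rewrite atan_opp, atan_1 in H. replace PI with (minus (2 * (PI / 4)) (2 * - (PI / 4))); trivial.
  unfold minus, plus, opp; simpl. field.
Qed.

Lemma ex_Cderive_inv_sub (w z : C) : z <> w -> ex_Cderive (fun v => / (v - w))%C z.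
Proof.
  intros Hz.
  destruct (ex_Cderive_minus _ _ z (ex_Cderive_id z) (ex_Cderive_const w z)) as [d Hd].
  eexists.
  apply (is_derive_comp (K := C_AbsRing) (V := AbsRing_NormedModule C_AbsRing) Cinv
    (fun v => (v - w)%C) z _ _ (is_Cderive_inv _ (Cminus_eq_contra _ _ Hz)) Hd).
Qed.

Lemma ex_rect_int_inv_square (p q r : R) : 0 < r ->
  ex_rect_int (fun z => / (z - (p, q)))%C (p - r) (p + r) (q - r) (q + r).
Proof.
  intros Hr. apply ex_rect_int_holo; try lra.
  split; intros t Ht; split; apply ex_Cderive_inv_sub; intros E; injection E; lra.
Qed.

Lemma rect_int_inv_square (p q r : R) : 0 < r ->
  rect_int (fun z => / (z - (p, q)))%C (p - r) (p + r) (q - r) (q + r) = (2 * RtoC PI * Ci)%C.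
Proof.
  intros Hr. destruct (ex_rect_int_inv_square p q r Hr) as (H1 & H2 & H3 & H4).
  apply CInt_correct in H1. apply CInt_correct in H2.
  apply CInt_correct in H3. apply CInt_correct in H4.
  assert (K1 := is_CInt_minus _ _ _ _ _ _ H1 H2).
  assert (K2 := is_CInt_minus _ _ _ _ _ _ H3 H4).
  assert (N : forall s, 0 < s * s + r * r) by (intros; apply sum_sqr_pos, Hr).
  apply (is_CInt_ext _ (fun t => Ci * RtoC (2 * r / ((t - p) * (t - p) + r * r)))%C) in K1.
  2: { intros t. unfold Cminus, Cplus, Copp, Cinv, Cmult, Ci, RtoC; simpl.
       assert (N1 := N (t - p)). f_equal; field; nra. }
  apply (is_CInt_ext _ (fun t => RtoC (2 * r / ((t - q) * (t - q) + r * r)))%C) in K2.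
  2: { intros t. unfold Cminus, Cplus, Copp, Cinv, Cmult, Ci, RtoC; simpl.
       assert (N1 := N (t - q)). f_equal; field; nra. }
  unfold rect_int.
  rewrite <- (is_CInt_unique _ _ _ _ K1), <- (is_CInt_unique _ _ _ _ K2).
  rewrite (is_CInt_unique _ _ _ _ (is_CInt_Cmult Ci _ _ _ _
    (is_CInt_RtoC _ _ _ _ (is_RInt_square_side p r Hr)))).
  rewrite (is_CInt_unique _ _ _ _ (is_CInt_RtoC _ _ _ _ (is_RInt_square_side q r Hr))).
  ring.
Qed.

(** The limit characterization of the residue at a pole of order at most one. The point [w] is
    excluded because a quotient has only a default value there. *)
Definition is_residue (f : C -> C) (w A : C) : Prop :=
  forall eps, 0 < eps -> exists del, 0 < del /\ forall z,
    0 < Cmod (z - w) < del -> Cmod ((z - w) * f z - A) <= eps.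

Lemma is_residue_ext (f g : C -> C) (w A : C) :
  (forall z, f z = g z) -> is_residue f w A -> is_residue g w A.
Proof.
  intros E H eps Heps. destruct (H eps Heps) as [del [Hdel Hz]].
  exists del. split; trivial. intros z. rewrite <- E. apply Hz.
Qed.

(** Goursat's theorem discards everything outside a small square about the pole. There [A / (z - w)]
    has a known integral, and what remains of [f] is too small to contribute. *)
Theorem rect_int_pole (f : C -> C) (a b c d p q : R) (A : C) :
  a < p < b -> c < q < d ->
  (forall x y, a <= x <= b -> c <= y <= d -> (x, y) <> (p, q) -> ex_Cderive f (x, y)) ->
  is_residue f (p, q) A -> rect_int f a b c d = (2 * RtoC PI * Ci * A)%C.
Proof.
  intros Hp Hq Hol Hres. apply Ceq_minus.
  set (X := (rect_int f a b c d - 2 * RtoC PI * Ci * A)%C).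
  destruct (Req_dec (Cmod X) 0) as [E|E]; [apply Cmod_eq_0, E|exfalso].
  assert (HX : 0 < Cmod X) by (generalize (Cmod_ge_0 X); lra).
  (* On the frame of a square of half-side [r] the remainder is at most [Cmod X / 16 / r]; the
     perimeter [8 * r] turns this into [Cmod X / 2], smaller than [Cmod X]. *)
  destruct (Hres (Cmod X / 16)) as [del [Hdel Hsmall]]; [lra|].
  (* With [r <= del / 4] the frame stays within [2 * r < del] of the pole; the other terms keep the
     square inside the rectangle. *)
  set (r := Rmin (del / 4) (Rmin (Rmin (p - a) (b - p) / 2) (Rmin (q - c) (d - q) / 2))).
  assert (Hr : 0 < r /\ r <= del / 4 /\ r < p - a /\ r < b - p /\ r < q - c /\ r < d - q).
  { unfold r, Rmin. repeat destruct Rle_dec; lra. }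
  clearbody r. destruct Hr as (R0 & R1 & R2 & R3 & R4 & R5).
  assert (EX : forall a' b' c' d', a <= a' <= b' -> b' <= b -> c <= c' <= d' -> d' <= d ->
    a' <> p -> b' <> p -> c' <> q -> d' <> q -> ex_rect_int f a' b' c' d').
  { intros. apply ex_rect_int_holo; try lra.
    split; intros; split; apply Hol; try lra; intros E1; injection E1; lra. }
  assert (ZR : forall a' b' c' d', a <= a' <= b' -> b' <= b -> c <= c' <= d' -> d' <= d ->
    (b' < p \/ p < a' \/ d' < q \/ q < c') -> rect_int f a' b' c' d' = 0%C).
  { intros. apply rect_int_holo; try lra.
    intros; apply Hol; try lra; intros E1; injection E1; lra. }
  assert (S : rect_int f a b c d = rect_int f (p - r) (p + r) (q - r) (q + r)).
  { rewrite (rect_int_split_v f a (p - r) b c d) by (apply EX; lra).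
    rewrite (rect_int_split_v f (p - r) (p + r) b c d) by (apply EX; lra).
    rewrite (rect_int_split_h f (p - r) (p + r) c (q - r) d) by (apply EX; lra).
    rewrite (rect_int_split_h f (p - r) (p + r) (q - r) (q + r) d) by (apply EX; lra).
    rewrite (ZR a) by lra. rewrite (ZR (p + r)) by lra.
    rewrite (ZR _ _ c) by lra. rewrite (ZR _ _ (q + r)) by lra. ring. }
  assert (F1 : ex_rect_int f (p - r) (p + r) (q - r) (q + r)) by (apply EX; lra).
  assert (F2 := ex_rect_int_inv_square p q r R0).
  assert (F3 := ex_rect_int_Cmult A _ _ _ _ _ F2).
  destruct (rect_int_minus _ _ _ _ _ _ F1 F3) as [M1 M2].
  rewrite rect_int_Cmult, rect_int_inv_square in M2 by trivial.
  assert (EqX : X = rect_int (fun z => f z - A * / (z - (p, q)))%C (p - r) (p + r) (q - r) (q + r)).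
  { rewrite M2. unfold X. rewrite S. ring. }
  assert (B : Cmod X <= 2 * (p + r - (p - r) + (q + r - (q - r))) * (Cmod X / 16 / r)).
  { rewrite EqX at 1. apply Cmod_rect_int_le; try lra; trivial.
    assert (G : forall z, r <= Cmod (z - (p, q)) < del ->
      Cmod (f z - A * / (z - (p, q))) <= Cmod X / 16 / r).
    { intros z Hz. assert (Z0 : (z - (p, q) <> 0)%C) by (apply Cmod_gt_0; lra).
      replace (f z - A * / (z - (p, q)))%C with (((z - (p, q)) * f z - A) / (z - (p, q)))%C
        by (field; trivial).
      rewrite Cmod_div by trivial. specialize (Hsmall z ltac:(lra)).
      apply Rle_trans with (Cmod X / 16 / Cmod (z - (p, q))).
      - apply Rmult_le_compat_r; [|lra]. left; apply Rinv_0_lt_compat; lra.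
      - apply Rmult_le_compat_l; [lra|]. apply Rinv_le_contravar; lra. }
    assert (D : forall x y, Rabs (x - p) <= r -> Rabs (y - q) <= r ->
      r = Rabs (x - p) \/ r = Rabs (y - q) -> r <= Cmod ((x, y) - (p, q)) < del).
    { intros x y Hx Hy Hxy. split.
      - assert (K1 := re_le_Cmod ((x, y) - (p, q))%C). assert (K2 := im_le_Cmod ((x, y) - (p, q))%C).
        unfold Re, Im in K1, K2; simpl in K1, K2. unfold Rminus in *. lra.
      - eapply Rle_lt_trans; [apply Cmod_le_Rabs|]. unfold Re, Im; simpl. unfold Rminus in *. lra. }
    split; intros t Ht; split; apply G, D; try (apply Rabs_le_between; lra).
    - right. rewrite Rabs_left; lra.
    - right. rewrite Rabs_pos_eq; lra.
    - left. rewrite Rabs_left; lra.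
    - left. rewrite Rabs_pos_eq; lra. }
  replace (2 * (p + r - (p - r) + (q + r - (q - r))) * (Cmod X / 16 / r)) with (Cmod X / 2) in B
    by (field; lra).
  lra.
Qed.

(** A cut halfway between the poles, vertical or horizontal according to which coordinate separates
    them, leaves one pole on each side. *)
Lemma rect_int_two_poles_ordered (f : C -> C) (a b c d p1 q1 p2 q2 : R) (A1 A2 : C) :
  a < p1 < b -> c < q1 < d -> a < p2 < b -> c < q2 < d -> (p1 < p2 \/ q1 < q2) ->
  (forall x y, a <= x <= b -> c <= y <= d -> (x, y) <> (p1, q1) -> (x, y) <> (p2, q2) ->
    ex_Cderive f (x, y)) ->
  is_residue f (p1, q1) A1 -> is_residue f (p2, q2) A2 ->
  rect_int f a b c d = (2 * RtoC PI * Ci * (A1 + A2))%C.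
Proof.
  intros Hp1 Hq1 Hp2 Hq2 Hne Hol HA1 HA2.
  destruct Hne as [H|H].
  - set (m := (p1 + p2) / 2). assert (Hm : p1 < m < p2) by (unfold m; lra). clearbody m.
    rewrite (rect_int_split_v f a m b c d).
    2, 3: apply ex_rect_int_holo; try lra;
      split; intros; split; apply Hol; try lra; intros E; injection E; lra.
    rewrite (rect_int_pole f a m c d p1 q1 A1), (rect_int_pole f m b c d p2 q2 A2); trivial; try lra.
    + ring.
    + intros. apply Hol; trivial; try lra. intros E; injection E; lra.
    + intros. apply Hol; trivial; try lra. intros E; injection E; lra.
  - set (m := (q1 + q2) / 2). assert (Hm : q1 < m < q2) by (unfold m; lra). clearbody m.
    rewrite (rect_int_split_h f a b c m d).
    2, 3: apply ex_rect_int_holo; try lra;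
      split; intros; split; apply Hol; try lra; intros E; injection E; lra.
    rewrite (rect_int_pole f a b c m p1 q1 A1), (rect_int_pole f a b m d p2 q2 A2); trivial; try lra.
    + ring.
    + intros. apply Hol; trivial; try lra. intros E; injection E; lra.
    + intros. apply Hol; trivial; try lra. intros E; injection E; lra.
Qed.

Theorem rect_int_two_poles (f : C -> C) (a b c d p1 q1 p2 q2 : R) (A1 A2 : C) :
  a < p1 < b -> c < q1 < d -> a < p2 < b -> c < q2 < d -> (p1, q1) <> (p2, q2) ->
  (forall x y, a <= x <= b -> c <= y <= d -> (x, y) <> (p1, q1) -> (x, y) <> (p2, q2) ->
    ex_Cderive f (x, y)) ->
  is_residue f (p1, q1) A1 -> is_residue f (p2, q2) A2 ->
  rect_int f a b c d = (2 * RtoC PI * Ci * (A1 + A2))%C.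
Proof.
  intros Hp1 Hq1 Hp2 Hq2 Hne Hol HA1 HA2.
  assert (D : (p1 < p2 \/ q1 < q2) \/ (p2 < p1 \/ q2 < q1)).
  { destruct (Req_dec p1 p2) as [->|]; [|lra]. destruct (Req_dec q1 q2) as [->|]; [|lra].
    contradiction. }
  destruct D as [D|D].
  - apply (rect_int_two_poles_ordered f a b c d p1 q1 p2 q2); trivial.
  - rewrite (Cplus_comm A1). apply (rect_int_two_poles_ordered f a b c d p2 q2 p1 q1); auto.
Qed.

(** Near a simple zero [h z] behaves like [D (z - w)], so the factor [z - w] cancels in the
    limit. *)
Lemma is_residue_quotient (g h : C -> C) (w D : C) :
  ex_Cderive g w -> is_Cderive h w D -> h w = 0%C -> D <> 0%C ->
  is_residue (fun z => g z / h z)%C w (g w / D)%C.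
Proof.
  intros Hg Hh H0 HD eps Heps.
  assert (HDm : 0 < Cmod D) by (apply Cmod_gt_0, HD).
  set (m := Cmod D) in *. set (G := Cmod (g w)).
  assert (HG : 0 <= G) by apply Cmod_ge_0.
  (* |D (z-w) g z - g w h z| <= |D||z-w||g z - g w| + |g w||h z - D(z-w)| and |h z| >= m/2 |z-w| *)
  set (e1 := eps * m / 4).
  set (e2 := Rmin (m / 2) (eps * m * m / (4 * (G + 1)))).
  assert (He1 : 0 < e1) by (unfold e1; nra).
  assert (He2 : 0 < e2).
  { apply Rmin_pos; [lra|]. apply Rdiv_lt_0_compat; [|lra]. repeat apply Rmult_lt_0_compat; lra. }
  destruct (Ccontinuous_of_ex_Cderive g w Hg e1 He1) as [d1 [Hd1 Hc]].
  destruct (proj1 (is_Cderive_eps h w D) Hh e2 He2) as [d2 [Hd2 Hl]].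
  exists (Rmin d1 d2). split; [apply Rmin_pos; trivial|]. intros z [Hz0 Hz].
  specialize (Hc z (Rlt_le_trans _ _ _ Hz (Rmin_l _ _))).
  specialize (Hl z (Rlt_le_trans _ _ _ Hz (Rmin_r _ _))).
  rewrite H0 in Hl. replace (h z - 0 - D * (z - w))%C with (h z - D * (z - w))%C in Hl by ring.
  set (k := Cmod (z - w)) in *.
  assert (L2 : e2 <= m / 2) by apply Rmin_l.
  assert (L3 : e2 * G <= eps * m * m / 4).
  { apply Rle_trans with (eps * m * m / (4 * (G + 1)) * (G + 1)).
    - apply Rmult_le_compat; try lra. apply Rmin_r.
    - right; field; lra. }
  assert (Hhz : m / 2 * k <= Cmod (h z)).
  { assert (T := Cmod_triangle_inv (D * (z - w)) (h z)).
    assert (T2 := Cmod_triangle_inv (D * (z - w)) (D * (z - w) - h z)).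
    replace (D * (z - w) - (D * (z - w) - h z))%C with (h z) in T2 by ring.
    rewrite Cmod_minus_sym with (x := h z) in Hl. rewrite Cmod_mult in T2. fold m k in T2. nra. }
  assert (Hk : 0 < m / 2 * k) by (apply Rmult_lt_0_compat; lra).
  assert (Hhz0 : h z <> 0%C) by (apply Cmod_gt_0; lra).
  replace ((z - w) * (g z / h z) - g w / D)%C with
    ((D * (z - w) * (g z - g w) - g w * (h z - D * (z - w))) / (D * h z))%C by (field; auto).
  rewrite Cmod_div by (apply Cmult_neq_0; trivial). rewrite Cmod_mult with (x := D). fold m.
  apply Rle_div_l; [apply Rmult_lt_0_compat; lra|].
  eapply Rle_trans; [apply Cmod_triangle_minus|]. rewrite !Cmod_mult. fold m k G.
  assert (m * k * Cmod (g z - g w) <= m * k * e1) by (apply Rmult_le_compat_l; nra).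
  assert (G * Cmod (h z - D * (z - w)) <= G * (e2 * k)) by (apply Rmult_le_compat_l; lra).
  assert (G * (e2 * k) <= eps * m * m / 4 * k) by nra.
  assert (eps * m * (m / 2 * k) <= eps * m * Cmod (h z)) by (apply Rmult_le_compat_l; nra).
  unfold e1 in *. nra.
Qed.

(** * Hankel integrals in logarithmic coordinates *)

Local Notation is_ray_int g a := (is_RInt_gen (V := C_R_CompleteNormedModule) g
  (at_point a) (Rbar_locally p_infty)).

(** The uniform structure on [C] is that of a product, with squares as balls; discs define the same
    neighbourhoods. *)
Lemma locally_C_R_eps (l : C) (P : C -> Prop) :
  locally (T := C_R_CompleteNormedModule) l P <->
  exists eps, 0 < eps /\ forall v, Cmod (v - l) < eps -> P v.
Proof.
  split.
  - intros H. apply (locally_norm_le_locally (V := C_R_CompleteNormedModule)) in H.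
    destruct H as [[eps Heps] H]. exists eps. split; trivial. intros v Hv. apply H.
    unfold ball_norm. rewrite norm_C_R. exact Hv.
  - intros [eps [Heps H]]. apply (locally_le_locally_norm (V := C_R_CompleteNormedModule)).
    exists (mkposreal eps Heps). intros v Hv. apply H.
    unfold ball_norm in Hv. rewrite norm_C_R in Hv. exact Hv.
Qed.

Lemma is_ray_int_eps (g : R -> C) (a : R) (l : C) :
  is_ray_int g a l <->
  forall eps, 0 < eps -> exists N, forall T, N < T ->
    exists v, is_CInt g a T v /\ Cmod (v - l) < eps.
Proof.
  split.
  - intros H eps Heps.
    assert (HP : locally (T := C_R_CompleteNormedModule) l (fun v => Cmod (v - l)%C < eps)).
    { apply locally_C_R_eps. exists eps. auto. }
    destruct (H _ HP) as [Q S HQ [N HS] HQS]. exists N. intros T HT.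
    exact (HQS a T HQ (HS T HT)).
  - intros H P HP. apply locally_C_R_eps in HP. destruct HP as [eps [Heps HP]].
    destruct (H eps Heps) as [N HN].
    exists (fun x => x = a) (fun T => N < T).
    + reflexivity.
    + exists N. auto.
    + intros x T -> HT. destruct (HN T HT) as [v [Hv1 Hv2]]. exists v. split; auto.
Qed.

Lemma is_ray_int_unique (g : R -> C) (a : R) (l : C) : is_ray_int g a l ->
  RInt_gen (V := C_R_CompleteNormedModule) g (at_point a) (Rbar_locally p_infty) = l.
Proof.
  apply (is_RInt_gen_unique (V := C_R_CompleteNormedModule)).
Qed.

Lemma is_ray_int_plus (f g : R -> C) (a : R) (lf lg : C) :
  is_ray_int f a lf -> is_ray_int g a lg -> is_ray_int (fun t => f t + g t)%C a (lf + lg)%C.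
Proof. apply (is_RInt_gen_plus (V := C_R_CompleteNormedModule)). Qed.

Lemma is_ray_int_Cmult (c : C) (g : R -> C) (a : R) (l : C) :
  is_ray_int g a l -> is_ray_int (fun t => c * g t)%C a (c * l)%C.
Proof.
  intros H. apply is_ray_int_eps. intros eps Heps.
  assert (Hc : 0 < Cmod c + 1) by (generalize (Cmod_ge_0 c); lra).
  destruct (proj1 (is_ray_int_eps g a l) H (eps / (Cmod c + 1))) as [N HN].
  { apply Rdiv_lt_0_compat; lra. }
  exists N. intros T HT. destruct (HN T HT) as [v [Hv1 Hv2]].
  exists (c * v)%C. split; [apply is_CInt_Cmult, Hv1|].
  replace (c * v - c * l)%C with (c * (v - l))%C by ring. rewrite Cmod_mult.
  apply Rlt_div_r in Hv2; [|lra].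
  apply Rle_lt_trans with (Cmod (v - l) * (Cmod c + 1)); [|lra].
  generalize (Cmod_ge_0 (v - l)). nra.
Qed.

Lemma is_ray_int_ext (f g : R -> C) (a : R) (l : C) :
  (forall t, a <= t -> f t = g t) -> is_ray_int f a l -> is_ray_int g a l.
Proof.
  intros E H. apply is_ray_int_eps. intros eps Heps.
  destruct (proj1 (is_ray_int_eps f a l) H eps Heps) as [N HN].
  exists (Rmax N a). intros T HT. generalize (Rmax_l N a) (Rmax_r N a); intros.
  destruct (HN T ltac:(lra)) as [v [Hv1 Hv2]]. exists v. split; trivial.
  apply (is_RInt_ext (V := C_R_CompleteNormedModule)) with f; trivial.
  intros t. rewrite Rmin_left by lra. intros Ht. apply E. lra.
Qed.

Lemma is_ray_int_extend (g : R -> C) (a b : R) (l v : C) :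
  is_CInt g a b v -> is_ray_int g b l -> is_ray_int g a (v + l)%C.
Proof.
  intros Hv Hl. apply is_ray_int_eps. intros eps Heps.
  destruct (proj1 (is_ray_int_eps g b l) Hl eps Heps) as [N HN].
  exists N. intros T HT. destruct (HN T HT) as [w [Hw1 Hw2]].
  exists (v + w)%C. split.
  - apply (is_RInt_Chasles (V := C_R_CompleteNormedModule) g a b T v w Hv Hw1).
  - replace (v + w - (v + l))%C with (w - l)%C by ring. exact Hw2.
Qed.

Lemma is_RInt_exp_neg (M a b : R) :
  is_RInt (fun t => M * exp (- t)) a b (M * (exp (- a) - exp (- b))).
Proof.
  replace (M * (exp (- a) - exp (- b))) with (minus (- M * exp (- b)) (- M * exp (- a)))
    by (unfold minus, plus, opp; simpl; ring).
  apply (is_RInt_derive (V := R_CompleteNormedModule) (fun t => - M * exp (- t))).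
  - intros t _. auto_derive; trivial. ring.
  - intros t _. apply continuity_pt_filterlim. apply derivable_continuous_pt.
    apply ex_derive_Reals_0. auto_derive. trivial.
Qed.

Lemma Cmod_CInt_exp_le (g : R -> C) (M a b : R) (v : C) : a <= b ->
  (forall t, a <= t <= b -> Cmod (g t) <= M * exp (- t)) -> is_CInt g a b v ->
  Cmod v <= M * (exp (- a) - exp (- b)).
Proof.
  intros Hab HM Hv. rewrite <- norm_C_R.
  apply (norm_RInt_le (V := C_R_CompleteNormedModule) g (fun t => M * exp (- t)) a b); trivial.
  - intros t Ht. rewrite norm_C_R. apply HM, Ht.
  - apply is_RInt_exp_neg.
Qed.

Lemma Cmod_ray_int_le (g : R -> C) (M a : R) (l : C) :
  0 <= M -> (forall t, a <= t -> Cmod (g t) <= M * exp (- t)) -> is_ray_int g a l ->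
  Cmod l <= M * exp (- a).
Proof.
  intros HM0 HM Hl. apply Rnot_lt_le. intros Hlt.
  destruct (proj1 (is_ray_int_eps g a l) Hl (Cmod l - M * exp (- a))) as [N HN]; [lra|].
  destruct (HN (Rmax (N + 1) a)) as [v [Hv1 Hv2]]; [generalize (Rmax_l (N + 1) a); lra|].
  assert (HT := Rmax_r (N + 1) a). set (T := Rmax (N + 1) a) in *.
  apply (Cmod_CInt_exp_le g M a T v HT) in Hv1; [|intros; apply HM; lra].
  generalize (Cmod_triangle_inv l v). rewrite Cmod_minus_sym. generalize (exp_pos (- T)). nra.
Qed.

Lemma exp_neg_small (M eps : R) : 0 < eps -> exists N, forall T, N < T -> M * exp (- T) < eps.
Proof.
  intros Heps. destruct (Rle_lt_dec M 0) as [HM|HM].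
  - exists 0. intros T _. generalize (exp_pos (- T)). nra.
  - exists (- ln (eps / M)). intros T HT.
    assert (H : exp (- T) < eps / M).
    { rewrite <- (exp_ln (eps / M)) by (apply Rdiv_lt_0_compat; lra). apply exp_increasing. lra. }
    apply Rlt_div_r in H; lra.
Qed.

(** The integral from [u] to [v] is at most [M e^(-u)], so the integrals up to [T] form a Cauchy
    family as [T] grows. *)
Lemma ex_ray_int (g : R -> C) (M a : R) :
  (forall t, a <= t -> Ccontinuous g t) ->
  (forall t, a <= t -> Cmod (g t) <= M * exp (- t)) -> exists l, is_ray_int g a l.
Proof.
  intros Hg HM.
  assert (HM0 : 0 <= M).
  { generalize (HM a (Rle_refl a)) (Cmod_ge_0 (g a)) (exp_pos (- a)). nra. }
  assert (EX : forall u v, a <= u <= v -> is_CInt g u v (CInt g u v)).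
  { intros u v Huv. apply CInt_correct, ex_CInt_cont; [lra|]. intros t Ht. apply Hg. lra. }
  assert (TB : forall u v, a <= u <= v -> Cmod (CInt g a v - CInt g a u) <= M * exp (- u)).
  { intros u v Huv.
    assert (E : (CInt g a v - CInt g a u = CInt g u v)%C).
    { assert (K : CInt g a v = (CInt g a u + CInt g u v)%C).
      { apply is_CInt_unique.
        exact (is_RInt_Chasles (V := C_R_CompleteNormedModule) g a u v _ _
          (EX a u ltac:(lra)) (EX u v Huv)). }
      rewrite K. ring. }
    rewrite E.
    apply Rle_trans with (M * (exp (- u) - exp (- v))).
    - apply (Cmod_CInt_exp_le g); try lra; [|apply EX, Huv]. intros t Ht. apply HM. lra.
    - generalize (exp_pos (- v)). nra. }
  destruct (proj1 (filterlim_locally_cauchy (U := C_R_CompleteNormedModule)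
    (F := Rbar_locally p_infty) (fun T => CInt g a T))) as [l Hl].
  - intros [eps Heps].
    destruct (proj1 (locally_C_R_eps 0 (fun v => ball (M := C_R_CompleteNormedModule) zero eps v))
      (locally_ball (T := C_R_CompleteNormedModule) zero (mkposreal eps Heps))) as [e [He Hball]].
    destruct (exp_neg_small M e He) as [N HN].
    exists (fun T => Rmax N a < T). split; [exists (Rmax N a); auto|].
    intros u v Hu Hv. generalize (Rmax_l N a) (Rmax_r N a); intros.
    assert (W : Cmod (CInt g a v - CInt g a u) < e).
    { destruct (Rle_lt_dec u v).
      - eapply Rle_lt_trans; [apply TB; lra|apply HN; lra].
      - rewrite Cmod_minus_sym. eapply Rle_lt_trans; [apply TB; lra|apply HN; lra]. }
    specialize (Hball (CInt g a v - CInt g a u)%C).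
    replace (CInt g a v - CInt g a u - 0)%C with (CInt g a v - CInt g a u)%C in Hball by ring.
    specialize (Hball W).
    destruct (CInt g a u) as [u1 u2], (CInt g a v) as [v1 v2]. destruct Hball as [B1 B2].
    split; [clear - B1; rename B1 into B|clear - B2; rename B2 into B];
      unfold ball, AbsRing_ball, abs, minus, plus, opp, zero in *; simpl in *;
      unfold ball, AbsRing_ball, abs, minus, plus, opp, zero in *; simpl in *.
    + replace (v1 + - u1) with (v1 + - u1 + - 0) by ring. exact B.
    + replace (v2 + - u2) with (v2 + - u2 + - 0) by ring. exact B.
  - exists l. apply is_ray_int_eps. intros eps Heps.
    assert (HP : locally (T := C_R_CompleteNormedModule) l (fun v => Cmod (v - l)%C < eps)).
    { apply locally_C_R_eps. exists eps. auto. }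
    destruct (Hl _ HP) as [N HN]. exists (Rmax N a). intros T HT.
    generalize (Rmax_l N a) (Rmax_r N a); intros.
    exists (CInt g a T). split; [apply EX; lra|]. apply HN. lra.
Qed.

(** The Hankel contour in the coordinate [w = ln u]: the boundary of the half-strip
    [Re w >= a, -psi <= Im w <= psi]. *)
Definition is_strip_int (f : C -> C) (a psi : R) (l : C) : Prop :=
  exists low mid up, is_ray_int (fun t => f (t, - psi)) a low /\
    is_CInt (fun t => f (a, t)) (- psi) psi mid /\
    is_ray_int (fun t => f (t, psi)) a up /\ l = (- low + Ci * mid + up)%C.

Lemma is_strip_int_unique (f : C -> C) (a psi : R) (l l' : C) :
  is_strip_int f a psi l -> is_strip_int f a psi l' -> l = l'.
Proof.
  intros (x & y & z & H1 & H2 & H3 & ->) (x' & y' & z' & H1' & H2' & H3' & ->).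
  rewrite <- (is_ray_int_unique _ _ _ H1), <- (is_ray_int_unique _ _ _ H3),
    <- (is_ray_int_unique _ _ _ H1'), <- (is_ray_int_unique _ _ _ H3'),
    <- (is_CInt_unique _ _ _ _ H2), <- (is_CInt_unique _ _ _ _ H2'). reflexivity.
Qed.

Lemma is_strip_int_plus (f g : C -> C) (a psi : R) (lf lg : C) :
  is_strip_int f a psi lf -> is_strip_int g a psi lg ->
  is_strip_int (fun z => f z + g z)%C a psi (lf + lg)%C.
Proof.
  intros (x & y & z & H1 & H2 & H3 & ->) (x' & y' & z' & H1' & H2' & H3' & ->).
  exists (x + x')%C, (y + y')%C, (z + z')%C. repeat split.
  - apply is_ray_int_plus; assumption.
  - apply is_CInt_plus; assumption.
  - apply is_ray_int_plus; assumption.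
  - ring.
Qed.

Lemma is_strip_int_Cmult (c : C) (f : C -> C) (a psi : R) (l : C) :
  is_strip_int f a psi l -> is_strip_int (fun z => c * f z)%C a psi (c * l)%C.
Proof.
  intros (x & y & z & H1 & H2 & H3 & ->).
  exists (c * x)%C, (c * y)%C, (c * z)%C. repeat split.
  - apply is_ray_int_Cmult, H1.
  - apply is_CInt_Cmult, H2.
  - apply is_ray_int_Cmult, H3.
  - ring.
Qed.

Lemma is_strip_int_ext (f g : C -> C) (a psi : R) (l : C) : 0 <= psi ->
  (forall x y, a <= x -> - psi <= y <= psi -> f (x, y) = g (x, y)) ->
  is_strip_int f a psi l -> is_strip_int g a psi l.
Proof.
  intros Hpsi E (x & y & z & H1 & H2 & H3 & ->).
  exists x, y, z. split; [|split; [|split; trivial]].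
  - revert H1. apply is_ray_int_ext. intros t Ht. apply E; lra.
  - revert H2. apply (is_RInt_ext (V := C_R_CompleteNormedModule)).
    intros t. rewrite Rmin_left, Rmax_right by lra. intros Ht. apply E; lra.
  - revert H3. apply is_ray_int_ext. intros t Ht. apply E; lra.
Qed.

(** The weight [e^(-t)] is integrable, yet weak enough for the double exponential decay of the
    integrands to beat it. A single [M] for all three sides lets the bound pass to products with
    bounded factors. *)
Definition strip_bounded (f : C -> C) (a psi M : R) : Prop :=
  (forall t, a <= t -> Cmod (f (t, - psi)) <= M * exp (- t) /\
                       Cmod (f (t, psi)) <= M * exp (- t)) /\
  (forall t, - psi <= t <= psi -> Cmod (f (a, t)) <= M).

Lemma Cmod_strip_int_le (f : C -> C) (a psi M : R) (l : C) : 0 <= psi -> 0 <= M ->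
  strip_bounded f a psi M -> is_strip_int f a psi l ->
  Cmod l <= M * (2 * exp (- a) + 2 * psi).
Proof.
  intros Hpsi HM [B1 B2] (x & y & z & H1 & H2 & H3 & ->).
  apply (Cmod_ray_int_le _ M) in H1; [|trivial|intros; apply B1; trivial].
  apply (Cmod_ray_int_le _ M) in H3; [|trivial|intros; apply B1; trivial].
  apply (Cmod_CInt_le _ _ _ M) in H2; [|lra|trivial].
  eapply Rle_trans; [apply Cmod_triangle|].
  eapply Rle_trans; [apply Rplus_le_compat_r, Cmod_triangle|].
  rewrite Cmod_opp, Cmod_mult, Cmod_Ci. lra.
Qed.

Lemma ex_strip_int (f : C -> C) (a psi M : R) : 0 <= psi ->
  strip_bounded f a psi M ->
  (forall x y, a <= x -> - psi <= y <= psi -> ex_Cderive f (x, y)) ->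
  exists l, is_strip_int f a psi l.
Proof.
  intros Hpsi [B1 B2] Hol.
  destruct (ex_ray_int (fun t => f (t, - psi)) M a) as [x Hx].
  { intros t Ht. apply Ccontinuous_horizontal, Hol; lra. }
  { intros t Ht. apply B1, Ht. }
  destruct (ex_ray_int (fun t => f (t, psi)) M a) as [z Hz].
  { intros t Ht. apply Ccontinuous_horizontal, Hol; lra. }
  { intros t Ht. apply B1, Ht. }
  assert (Hy : ex_CInt (fun t => f (a, t)) (- psi) psi).
  { apply ex_CInt_cont; [lra|]. intros t Ht. apply Ccontinuous_vertical, Hol; lra. }
  exists (- x + Ci * CInt (fun t => f (a, t)) (- psi) psi + z)%C.
  exists x, (CInt (fun t => f (a, t)) (- psi) psi), z.
  split; [exact Hx|split; [apply CInt_correct, Hy|split; [exact Hz|reflexivity]]].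
Qed.

(** The half-strip lies to the right of its oriented boundary while rectangles are traversed
    counterclockwise, hence the minus sign. *)
Lemma is_strip_int_move (f : C -> C) (a b psi : R) (l : C) :
  ex_rect_int f a b (- psi) psi -> is_strip_int f b psi l ->
  is_strip_int f a psi (l - rect_int f a b (- psi) psi)%C.
Proof.
  intros (E1 & E2 & E3 & E4) (x & y & z & H1 & H2 & H3 & ->).
  apply CInt_correct in E1. apply CInt_correct in E2. apply CInt_correct in E4.
  eexists; eexists; eexists. split; [|split; [|split]].
  - apply (is_ray_int_extend _ _ _ _ _ E1 H1).
  - exact E4.
  - apply (is_ray_int_extend _ _ _ _ _ E2 H3).
  - unfold rect_int. rewrite (is_CInt_unique _ _ _ _ H2). ring.
Qed.

(** * Geometric series under the Hankel integral *)

(** The index counts terms, so 0 gives the empty sum; [sum_n] includes its last index, which causes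
    a shift by one when the two meet. *)
Fixpoint partial_sum (a : nat -> C) (N : nat) : C :=
  match N with O => RtoC 0 | S k => (partial_sum a k + a k)%C end.

Lemma sum_n_Re_Im (a : nat -> C) (n : nat) :
  sum_n (fun k => Re (a k)) n = Re (partial_sum a (S n)) /\
  sum_n (fun k => Im (a k)) n = Im (partial_sum a (S n)).
Proof.
  induction n as [|n [IH1 IH2]].
  - rewrite !sum_O. unfold Re, Im; simpl. split; ring.
  - rewrite !sum_Sn, IH1, IH2. split; reflexivity.
Qed.

Lemma is_lim_seq_geometric_bound (u : nat -> R) (l K c : R) : 0 <= c < 1 ->
  (forall n, Rabs (u n - l) <= K * c ^ n) -> is_lim_seq u l.
Proof.
  intros Hc Hu. apply is_lim_seq_spec. intros [eps Heps]; simpl.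
  assert (HK : 0 <= K). { specialize (Hu O). generalize (Rabs_pos (u O - l)). simpl in Hu. lra. }
  destruct (pow_lt_1_zero c) with (y := eps / (K + 1)) as [N HN].
  { rewrite Rabs_pos_eq; lra. }
  { apply Rdiv_lt_0_compat; lra. }
  exists N. intros n Hn. specialize (HN n Hn). specialize (Hu n).
  assert (Hp : 0 <= c ^ n) by (apply pow_le; lra).
  rewrite Rabs_pos_eq in HN by trivial. apply Rlt_div_r in HN; [|lra]. nra.
Qed.

Lemma is_series_partial_sum (a : nat -> C) (s : C) (K c : R) : 0 <= c < 1 ->
  (forall N, Cmod (partial_sum a N - s) <= K * c ^ N) ->
  is_series (fun n => Re (a n)) (Re s) /\ is_series (fun n => Im (a n)) (Im s).
Proof.
  intros Hc HK. split.
  - apply (is_lim_seq_geometric_bound _ (Re s) (K * c) c Hc). intros n.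
    change (Rabs (sum_n (fun k => Re (a k)) n - Re s) <= K * c * c ^ n).
    rewrite (proj1 (sum_n_Re_Im a n)). rewrite Rmult_assoc.
    eapply Rle_trans; [|apply (HK (S n))].
    eapply Rle_trans; [|apply re_le_Cmod]. right. reflexivity.
  - apply (is_lim_seq_geometric_bound _ (Im s) (K * c) c Hc). intros n.
    change (Rabs (sum_n (fun k => Im (a k)) n - Im s) <= K * c * c ^ n).
    rewrite (proj2 (sum_n_Re_Im a n)). rewrite Rmult_assoc.
    eapply Rle_trans; [|apply (HK (S n))].
    eapply Rle_trans; [|apply im_le_Cmod]. right. reflexivity.
Qed.

Lemma CSeries_partial_sum (a : nat -> C) (s : C) (K c : R) : 0 <= c < 1 ->
  (forall N, Cmod (partial_sum a N - s) <= K * c ^ N) -> CSeries a = s.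
Proof.
  intros Hc HK. destruct (is_series_partial_sum a s K c Hc HK) as [H1 H2].
  unfold CSeries. rewrite (is_series_unique _ _ H1), (is_series_unique _ _ H2).
  destruct s; reflexivity.
Qed.

Lemma partial_sum_Cmult (k : C) (a : nat -> C) (N : nat) :
  partial_sum (fun n => k * a n)%C N = (k * partial_sum a N)%C.
Proof. induction N as [|N IH]; simpl; [ring|rewrite IH; ring]. Qed.

Lemma Cmod_one_minus_ge (q : C) (c : R) : Cmod q <= c -> 1 - c <= Cmod (1 - q).
Proof. intros H. generalize (Cmod_triangle_inv 1 q). rewrite Cmod_1. lra. Qed.

Lemma Cone_minus_neq_0 (q : C) (c : R) : c < 1 -> Cmod q <= c -> (1 - q <> 0)%C.
Proof.
  intros Hc H. apply Cmod_gt_0. generalize (Cmod_one_minus_ge q c H). lra.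
Qed.

Definition on_strip (P : C -> Prop) (a psi : R) : Prop :=
  (forall t, a <= t -> P (t, - psi) /\ P (t, psi)) /\
  (forall t, - psi <= t <= psi -> P (a, t)).

Lemma on_strip_of_half_strip (P : C -> Prop) (a psi : R) : 0 <= psi ->
  (forall x y, a <= x -> - psi <= y <= psi -> P (x, y)) -> on_strip P a psi.
Proof. intros Hpsi H. split; intros; [split|]; apply H; lra. Qed.

Lemma strip_bounded_mul (f k : C -> C) (a psi M B : R) : 0 <= B ->
  on_strip (fun z => Cmod (k z) <= B) a psi ->
  strip_bounded f a psi M -> strip_bounded (fun z => f z * k z)%C a psi (M * B).
Proof.
  intros HB [K1 K2] [B1 B2].
  assert (P : forall u v w, Cmod u <= v -> Cmod w <= B -> Cmod (u * w) <= v * B).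
  { intros. rewrite Cmod_mult. apply Rmult_le_compat; auto using Cmod_ge_0. }
  split.
  - intros t Ht. replace (M * B * exp (- t)) with (M * exp (- t) * B) by ring.
    split; apply P; apply B1 || apply K1; trivial.
  - intros t Ht. apply P; [apply B2, Ht|apply K2, Ht].
Qed.

Lemma Cmod_geometric_tail_le (q : C) (c : R) (N : nat) : 0 <= c < 1 -> Cmod q <= c ->
  Cmod (- Cpow q N / (1 - q)) <= c ^ N / (1 - c).
Proof.
  intros Hc Hq.
  rewrite Cmod_div by (apply (Cone_minus_neq_0 _ c); trivial; lra). rewrite Cmod_opp, Cmod_pow.
  apply Rmult_le_compat.
  - apply pow_le, Cmod_ge_0.
  - left; apply Rinv_0_lt_compat. generalize (Cmod_one_minus_ge _ _ Hq). lra.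
  - apply pow_incr. split; [apply Cmod_ge_0|exact Hq].
  - apply Rinv_le_contravar; [lra|]. apply Cmod_one_minus_ge, Hq.
Qed.

Lemma strip_bounded_geometric (g q : C -> C) (a psi M c : R) : 0 <= psi -> 0 <= c < 1 ->
  strip_bounded g a psi M ->
  (forall x y, a <= x -> - psi <= y <= psi -> Cmod (q (x, y)) <= c) ->
  strip_bounded (fun z => g z / (1 - q z))%C a psi (M / (1 - c)).
Proof.
  intros Hpsi Hc Hg Hq. apply strip_bounded_mul; trivial.
  - left; apply Rinv_0_lt_compat; lra.
  - apply on_strip_of_half_strip; trivial. intros x y Hx Hy.
    (* The tail after no term at all is [- 1 / (1 - q)], so this instance bounds the factor by
       [1 / (1 - c)]. *)
    generalize (Cmod_geometric_tail_le (q (x, y)) c 0 Hc (Hq x y Hx Hy)). simpl Cpow. simpl pow.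
    unfold Cdiv, Rdiv. rewrite Cmod_mult, Cmod_opp, Cmod_1. lra.
Qed.

Lemma ex_Cderive_geometric (g q : C -> C) (c : R) (z : C) : c < 1 -> Cmod (q z) <= c ->
  ex_Cderive g z -> ex_Cderive q z -> ex_Cderive (fun v => g v / (1 - q v))%C z.
Proof.
  intros Hc Hz Hg Hq. apply ex_Cderive_div; trivial.
  - apply ex_Cderive_minus; [apply ex_Cderive_const|exact Hq].
  - apply (Cone_minus_neq_0 _ c); trivial.
Qed.

(** The difference between the partial sum and [l] is itself a strip integral, that of [g] times the
    exact geometric remainder, so one bound on one integral justifies summing termwise. *)
Lemma partial_sum_strip_int_geometric (g q : C -> C) (h : nat -> C) (a psi M c : R) (l : C) :
  0 <= psi -> 0 <= M -> 0 <= c < 1 -> strip_bounded g a psi M ->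
  (forall x y, a <= x -> - psi <= y <= psi -> Cmod (q (x, y)) <= c) ->
  (forall n, is_strip_int (fun z => g z * Cpow (q z) n)%C a psi (h n)) ->
  is_strip_int (fun z => g z / (1 - q z))%C a psi l ->
  forall N, Cmod (partial_sum h N - l) <= M / (1 - c) * (2 * exp (- a) + 2 * psi) * c ^ N.
Proof.
  intros Hpsi HM Hc Hg Hq Hh Hl N.
  assert (HD : forall N, is_strip_int (fun z => g z * (- Cpow (q z) N / (1 - q z)))%C a psi
    (partial_sum h N - l)%C).
  { clear N. induction N as [|N IH].
    - apply (is_strip_int_Cmult (- (1))%C) in Hl. simpl.
      replace (0 - l)%C with (- (1) * l)%C by ring. revert Hl.
      apply is_strip_int_ext; trivial. intros x y Hx Hy.
      assert (Q := Cone_minus_neq_0 _ c (proj2 Hc) (Hq x y Hx Hy)). field. exact Q.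
    - assert (K := is_strip_int_plus _ _ _ _ _ _ IH (Hh N)). cbn [partial_sum].
      replace (partial_sum h N + h N - l)%C with (partial_sum h N - l + h N)%C by ring.
      revert K. apply is_strip_int_ext; trivial. intros x y Hx Hy. rewrite Cpow_S.
      assert (Q := Cone_minus_neq_0 _ c (proj2 Hc) (Hq x y Hx Hy)). field. exact Q. }
  replace (M / (1 - c) * (2 * exp (- a) + 2 * psi) * c ^ N) with
    (M * (c ^ N / (1 - c)) * (2 * exp (- a) + 2 * psi)) by (field; lra).
  assert (HcN : 0 <= c ^ N) by (apply pow_le; lra).
  assert (HcN2 : 0 <= c ^ N / (1 - c)) by (apply Rmult_le_pos; [lra|left; apply Rinv_0_lt_compat; lra]).
  apply Cmod_strip_int_le with (2 := Rmult_le_pos _ _ HM HcN2) (4 := HD N); trivial.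
  apply strip_bounded_mul; trivial. apply on_strip_of_half_strip; trivial.
  intros x y Hx Hy. apply Cmod_geometric_tail_le; auto.
Qed.

(** Hankel's integrand: with [u = cexp w] this is [e^u u^k dw], so [k = 1 - s] gives
    [e^u u^(-s) du]. *)
Definition hankel_fun (k w : C) : C := (cexp (cexp w) * cexp (k * w))%C.

Lemma ex_Cderive_hankel_fun (k w : C) : ex_Cderive (hankel_fun k) w.
Proof. apply ex_Cderive_mult; [apply ex_Cderive_cexp_cexp|apply ex_Cderive_cexp_lin]. Qed.

Lemma Cmod_hankel_fun (k : C) (x y : R) :
  Cmod (hankel_fun k (x, y)) = exp (exp x * cos y + (Re k * x - Im k * y)).
Proof.
  unfold hankel_fun. rewrite Cmod_mult, !Cmod_cexp, exp_plus. reflexivity.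
Qed.

Lemma hankel_fun_mul_cexp (k j w : C) : (hankel_fun k w * cexp (j * w) = hankel_fun (k + j) w)%C.
Proof.
  unfold hankel_fun. rewrite Cmult_plus_distr_r, cexp_plus. ring.
Qed.

Lemma cos_neg_of_gt_PI2 (psi : R) : PI / 2 < psi <= PI -> cos psi < 0.
Proof. intros H. apply cos_lt_0; generalize PI_RGT_0; lra. Qed.

Lemma exp_ge_sqr (x : R) : 0 <= x -> x * x / 4 <= exp x.
Proof.
  intros Hx. replace x with (x / 2 + x / 2) at 3 by field. rewrite exp_plus.
  assert (H : 1 + x / 2 <= exp (x / 2)) by apply exp_ineq1_le. nra.
Qed.

(** On the rays [cos y = cos psi] is negative, so the exponent of the modulus contains
    [- kap * exp t], which outweighs every linear term because [exp t >= t^2 / 4] for [t >= 0]. *)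
Lemma strip_bounded_hankel_fun (k : C) (a psi : R) : PI / 2 < psi <= PI ->
  exists M, 0 <= M /\ strip_bounded (hankel_fun k) a psi M.
Proof.
  intros Hpsi. assert (Hcos := cos_neg_of_gt_PI2 psi Hpsi). assert (HPI := PI_RGT_0).
  set (kap := - cos psi). assert (Hkap : 0 < kap) by (unfold kap; lra).
  (* The 1 pays for the required decay [e^(-t)]. [B] bounds [- kap * exp t + r * t] for [t >= a]:
     its first term comes from completing a square when [t >= 0], its second covers [a <= t < 0]. *)
  set (r := Re k + 1). set (C0 := Rabs (Im k) * psi).
  set (B := r * r / kap + Rabs r * Rabs a).
  (* The first summand serves the two rays, the second the vertical side. *)
  exists (exp (B + C0) + exp (exp a + Rabs (Re k * a) + C0)).
  assert (E1 := exp_pos (B + C0)). assert (E2 := exp_pos (exp a + Rabs (Re k * a) + C0)).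
  split; [lra|].
  assert (HC0 : forall y, - psi <= y <= psi -> - (Im k * y) <= C0).
  { intros y Hy. unfold C0. apply Rle_trans with (Rabs (Im k * y)).
    - rewrite <- Rabs_Ropp. apply Rle_abs.
    - rewrite Rabs_mult. apply Rmult_le_compat_l; [apply Rabs_pos|]. apply Rabs_le_between, Hy. }
  assert (HB : forall t, a <= t -> - kap * exp t + r * t <= B).
  { intros t Ht. unfold B. destruct (Rle_lt_dec 0 t) as [H0|H0].
    - assert (H1 := exp_ge_sqr t H0).
      assert (H2 : r * t - kap * (t * t / 4) <= r * r / kap).
      { apply Rle_div_r; [lra|]. generalize (Rle_0_sqr (kap * t / 2 - r)). unfold Rsqr. nra. }
      assert (0 <= Rabs r * Rabs a) by (apply Rmult_le_pos; apply Rabs_pos). nra.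
    - assert (H1 := exp_pos t).
      assert (H2 : r * t <= Rabs r * Rabs a).
      { apply Rle_trans with (Rabs (r * t)); [apply Rle_abs|]. rewrite Rabs_mult.
        apply Rmult_le_compat_l; [apply Rabs_pos|].
        rewrite (Rabs_left t), (Rabs_left1 a); lra. }
      assert (0 <= r * r / kap).
      { apply Rmult_le_pos; [apply Rle_0_sqr|left; apply Rinv_0_lt_compat, Hkap]. }
      nra. }
  assert (RB : forall t y, a <= t -> cos y = - kap -> - psi <= y <= psi ->
    Cmod (hankel_fun k (t, y)) <= (exp (B + C0) + exp (exp a + Rabs (Re k * a) + C0)) * exp (- t)).
  { intros t y Ht Hy Hy2. rewrite Cmod_hankel_fun, Hy.
    apply Rle_trans with (exp (B + C0) * exp (- t)).
    - rewrite <- exp_plus. specialize (HB t Ht). specialize (HC0 y Hy2).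
      assert (L : exp t * - kap + (Re k * t - Im k * y) <= B + C0 + - t) by (unfold r in *; lra).
      apply exp_le_compat, L.
    - generalize (exp_pos (- t)). nra. }
  split.
  - intros t Ht. split; apply RB; trivial; try (rewrite ?cos_neg; unfold kap; ring); lra.
  - intros t Ht. rewrite Cmod_hankel_fun.
    apply Rle_trans with (exp (exp a + Rabs (Re k * a) + C0)); [|lra].
    assert (L : exp a * cos t + (Re k * a - Im k * t) <= exp a + Rabs (Re k * a) + C0).
    { specialize (HC0 t Ht). generalize (Rle_abs (Re k * a)) (COS_bound t) (exp_pos a). nra. }
    apply exp_le_compat, L.
Qed.

(** * Primitives along the contour *)

Lemma is_derive_C_R_eps (f : R -> C) (x : R) (d : C) :
  is_derive (K := R_AbsRing) (V := C_R_CompleteNormedModule) f x d <->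
  forall eps, 0 < eps -> exists del, 0 < del /\ forall t,
    Rabs (t - x) < del -> Cmod (f t - f x - RtoC (t - x) * d) <= eps * Rabs (t - x).
Proof.
  split.
  - intros [_ H] eps Heps.
    destruct (H x (fun P HP => HP) (mkposreal eps Heps)) as [del Hdel].
    exists del. split; [apply cond_pos|]. intros t Ht. specialize (Hdel t Ht).
    rewrite norm_C_R in Hdel.
    rewrite <- scal_R_Cmult. exact Hdel.
  - intros H. split.
    + apply (is_linear_scal_l (V := C_R_CompleteNormedModule)).
    + intros y Hy. rewrite <- (is_filter_lim_locally_unique (V := R_NormedModule) _ _ Hy). clear y Hy.
      intros [eps Heps]. destruct (H eps Heps) as [del [Hd Hdel]].
      exists (mkposreal del Hd). intros t Ht. specialize (Hdel t Ht).
      rewrite norm_C_R. rewrite <- scal_R_Cmult in Hdel. exact Hdel.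
Qed.

Lemma is_derive_along (F f : C -> C) (z v : C) (p : R -> C) (x : R) :
  (forall t, p t = z + RtoC (t - x) * v)%C -> is_Cderive F z (f z) ->
  is_derive (K := R_AbsRing) (V := C_R_CompleteNormedModule) (fun t => F (p t)) x (v * f z)%C.
Proof.
  intros Hp HF. apply is_derive_C_R_eps. intros eps Heps.
  assert (Hv : 0 < Cmod v + 1) by (generalize (Cmod_ge_0 v); lra).
  destruct (proj1 (is_Cderive_eps _ _ _) HF (eps / (Cmod v + 1))) as [del [Hdel H]].
  { apply Rdiv_lt_0_compat; lra. }
  exists (del / (Cmod v + 1)). split; [apply Rdiv_lt_0_compat; lra|]. intros t Ht.
  assert (Ex : p x = z). { rewrite Hp. replace (x - x) with 0 by ring. ring. }
  assert (Et : (p t - z = RtoC (t - x) * v)%C). { rewrite Hp. ring. }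
  apply Rlt_div_r in Ht; [|lra].
  assert (Hm : Cmod (p t - z) <= Rabs (t - x) * (Cmod v + 1)).
  { rewrite Et, Cmod_mult, Cmod_R. apply Rmult_le_compat_l; [apply Rabs_pos|lra]. }
  specialize (H (p t) ltac:(lra)). rewrite Ex.
  replace (RtoC (t - x) * (v * f z))%C with (f z * (p t - z))%C by (rewrite Et; ring).
  eapply Rle_trans; [exact H|].
  apply Rle_trans with (eps / (Cmod v + 1) * (Rabs (t - x) * (Cmod v + 1))).
  - apply Rmult_le_compat_l; [|exact Hm]. left; apply Rdiv_lt_0_compat; lra.
  - right; field; lra.
Qed.

Lemma is_CInt_derive (F f : R -> C) (a b : R) : a <= b ->
  (forall t, a <= t <= b -> is_derive (K := R_AbsRing) (V := C_R_CompleteNormedModule) F t (f t)) ->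
  (forall t, a <= t <= b -> Ccontinuous f t) ->
  is_CInt f a b (F b - F a)%C.
Proof.
  intros Hab HF Hf.
  apply (is_RInt_derive (V := C_R_CompleteNormedModule) F f);
    rewrite Rmin_left, Rmax_right by lra; assumption.
Qed.

(** The increments of [F] along the three sides telescope, and the decay makes [F] vanish at both
    infinite ends. *)
Lemma is_strip_int_Cderive (F f : C -> C) (a psi M : R) : 0 <= psi ->
  (forall x y, a <= x -> - psi <= y <= psi -> is_Cderive F (x, y) (f (x, y))) ->
  (forall x y, a <= x -> - psi <= y <= psi -> ex_Cderive f (x, y)) ->
  strip_bounded F a psi M -> is_strip_int f a psi 0%C.
Proof.
  intros Hpsi HF Hf [B _].
  assert (HR : forall y, - psi <= y <= psi ->
    (forall t, a <= t -> Cmod (F (t, y)) <= M * exp (- t)) ->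
    is_ray_int (fun t => f (t, y)) a (- F (a, y))%C).
  { intros y Hy HB. apply is_ray_int_eps. intros eps Heps.
    destruct (exp_neg_small M eps Heps) as [N HN].
    exists (Rmax N a). intros T HT. generalize (Rmax_l N a) (Rmax_r N a); intros.
    exists (F (T, y) - F (a, y))%C. split.
    - apply (is_CInt_derive (fun t => F (t, y)) (fun t => f (t, y))); [lra| |].
      + intros t Ht. rewrite <- (Cmult_1_l (f (t, y))).
        apply (is_derive_along F f (t, y) 1%C).
        * intros s. unfold RtoC, Cplus, Cmult; simpl. f_equal; ring.
        * apply HF; lra.
      + intros t Ht. apply Ccontinuous_horizontal, Hf; lra.
    - replace (F (T, y) - F (a, y) - - F (a, y))%C with (F (T, y)) by ring.
      eapply Rle_lt_trans; [apply HB; lra|]. apply HN; lra. }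
  assert (HA : is_CInt (fun t => (Ci * f (a, t))%C) (- psi) psi (F (a, psi) - F (a, (- psi)%R))%C).
  { apply (is_CInt_derive (fun t => F (a, t))); [lra| |].
    - intros t Ht. apply (is_derive_along F f (a, t) Ci).
      + intros s. unfold RtoC, Ci, Cplus, Cmult; simpl. f_equal; ring.
      + apply HF; lra.
    - intros t Ht. apply (Ccontinuous_vertical (fun z => Ci * f z)%C).
      apply ex_Cderive_mult; [apply ex_Cderive_const|apply Hf; lra]. }
  (* The primitive along a vertical side yields the integral of [Ci * f]; multiplying by [- Ci]
     recovers that of [f]. *)
  apply (is_CInt_Cmult (- Ci)%C) in HA.
  apply (is_CInt_ext _ (fun t => f (a, t))) in HA.
  2: { intros t. unfold Ci, Copp, Cmult; destruct (f (a, t)); simpl. f_equal; ring. }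
  exists (- F (a, (- psi)%R))%C, (- Ci * (F (a, psi) - F (a, (- psi)%R)))%C, (- F (a, psi))%C.
  split; [|split; [exact HA|split]].
  - apply HR; [lra|]. intros t Ht. apply B, Ht.
  - apply HR; [lra|]. intros t Ht. apply B, Ht.
  - assert (Ci2 : (Ci * Ci = - (1))%C) by (unfold Ci, Cmult, Copp, RtoC; simpl; f_equal; ring).
    transitivity (F (a, (- psi)%R) - (Ci * Ci) * (F (a, psi) - F (a, (- psi)%R)) - F (a, psi))%C; [|ring].
    rewrite Ci2. ring.
Qed.

(** * Hankel's integral for the reciprocal Gamma function *)

Lemma C2PI_neq_0 : (2 * RtoC PI * Ci)%C <> 0%C.
Proof.
  repeat apply Cmult_neq_0.
  - intros E. apply RtoC_inj in E. lra.
  - intros E. apply RtoC_inj in E. generalize PI_RGT_0. lra.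
  - apply Ci_nz.
Qed.

Lemma Cmult_div_cancel (k z : C) : k <> 0%C -> (k * (z / k) = z)%C.
Proof. intros Hk. field. exact Hk. Qed.

(** The integrand is entire, so by Goursat's theorem the vertical side can be moved freely. *)
Lemma ex_strip_int_hankel_fun (k : C) (psi : R) : PI / 2 < psi <= PI ->
  exists l, forall a, is_strip_int (hankel_fun k) a psi l.
Proof.
  intros Hpsi. assert (HPI := PI_RGT_0).
  assert (EX : forall a, exists l, is_strip_int (hankel_fun k) a psi l).
  { intros a. destruct (strip_bounded_hankel_fun k a psi Hpsi) as [M [_ HM]].
    apply (ex_strip_int _ a psi M); trivial; [lra|]. intros; apply ex_Cderive_hankel_fun. }
  assert (MV : forall a b l, a <= b -> is_strip_int (hankel_fun k) b psi l ->
    is_strip_int (hankel_fun k) a psi l).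
  { intros a b l Hab Hl. replace l with (l - rect_int (hankel_fun k) a b (- psi) psi)%C.
    - apply is_strip_int_move; trivial. apply ex_rect_int_holo; try lra.
      split; intros; split; apply ex_Cderive_hankel_fun.
    - rewrite rect_int_holo; try lra; [ring|]. intros; apply ex_Cderive_hankel_fun. }
  destruct (EX 0) as [l Hl]. exists l. intros a.
  destruct (Rle_lt_dec a 0) as [Ha|Ha]; [apply (MV a 0); trivial|].
  (* Integrals can only be moved to the left here. For [a > 0] the value found at [a] is moved to 0,
     where uniqueness identifies it with [l]. *)
  destruct (EX a) as [l' Hl'].
  rewrite (is_strip_int_unique _ _ _ _ _ Hl (MV 0 a l' (Rlt_le _ _ Ha) Hl')). exact Hl'.
Qed.

(** The value [H(s)] does not depend on [a]. *)
Definition hankel_recip (psi : R) (s : C) : C :=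
  epsilon (inhabits (RtoC 0)) (fun h => forall a,
    is_strip_int (hankel_fun (1 - s)) a psi (2 * RtoC PI * Ci * h)%C).

Lemma hankel_recip_spec (psi : R) (s : C) (a : R) : PI / 2 < psi <= PI ->
  is_strip_int (hankel_fun (1 - s)) a psi (2 * RtoC PI * Ci * hankel_recip psi s)%C.
Proof.
  intros Hpsi. revert a. unfold hankel_recip. apply epsilon_spec.
  destruct (ex_strip_int_hankel_fun (1 - s) psi Hpsi) as [l Hl].
  exists (l / (2 * RtoC PI * Ci))%C. intros a.
  rewrite (Cmult_div_cancel _ l C2PI_neq_0). apply Hl.
Qed.

(** Integration by parts: in the coordinate [w] the derivative of [e^u u^(-s)] is the integrand for
    [s] minus [s] times the integrand for [s + 1], and a derivative integrates to 0. *)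
Lemma hankel_recip_succ (psi : R) (s : C) : PI / 2 < psi <= PI ->
  hankel_recip psi s = (s * hankel_recip psi (s + 1))%C.
Proof.
  intros Hpsi. assert (HPI := PI_RGT_0).
  set (F := hankel_fun (- s)). set (f := fun w => (hankel_fun (1 - s) w + - s * hankel_fun (- s) w)%C).
  destruct (strip_bounded_hankel_fun (- s) 0 psi Hpsi) as [M [_ HM]].
  assert (Z : is_strip_int f 0 psi 0%C).
  { apply (is_strip_int_Cderive F f 0 psi M); trivial; [lra| |].
    - intros x y _ _. generalize (x, y). clear x y. intros w.
      assert (D1 := is_derive_comp (K := C_AbsRing) (V := AbsRing_NormedModule C_AbsRing)
        cexp cexp w _ _ (is_Cderive_cexp _) (is_Cderive_cexp w)).
      assert (D := is_derive_mult (K := C_AbsRing) _ _ w _ _ D1 (is_Cderive_cexp_lin (- s) w) Cmult_comm).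
      unfold F, hankel_fun. replace (f w) with
        (plus (mult (scal (cexp w) (cexp (cexp w))) (cexp (- s * w)))
          (mult (cexp (cexp w)) (- s * cexp (- s * w)))%C : C).
      { exact D. }
      unfold f, hankel_fun. replace ((1 - s) * w)%C with (w + - s * w)%C by ring. rewrite cexp_plus.
      change (cexp w * cexp (cexp w) * cexp (- s * w) + cexp (cexp w) * (- s * cexp (- s * w)) =
        cexp (cexp w) * (cexp w * cexp (- s * w)) + - s * (cexp (cexp w) * cexp (- s * w)))%C.
      ring.
    - intros. unfold f.
      destruct (ex_Cderive_minus (hankel_fun (1 - s)) (fun w => s * hankel_fun (- s) w)%C (x, y)) as [d Hd].
      { apply ex_Cderive_hankel_fun. }
      { apply ex_Cderive_mult; [apply ex_Cderive_const|apply ex_Cderive_hankel_fun]. }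
      exists d. revert Hd. apply (is_derive_ext (K := C_AbsRing) (V := AbsRing_NormedModule C_AbsRing)).
      intros t. change ((hankel_fun (1 - s) t - s * hankel_fun (- s) t)%C =
        (hankel_fun (1 - s) t + - s * hankel_fun (- s) t)%C). ring. }
  assert (E1 := hankel_recip_spec psi s 0 Hpsi).
  assert (E2 := is_strip_int_Cmult (- s)%C _ _ _ _ (hankel_recip_spec psi (s + 1) 0 Hpsi)).
  replace (1 - (s + 1))%C with (- s)%C in E2 by ring.
  assert (E := is_strip_int_unique _ _ _ _ _ Z (is_strip_int_plus _ _ _ _ _ _ E1 E2)).
  apply Ceq_minus.
  rewrite <- (Cmult_div_cancel _ (hankel_recip psi s - s * hankel_recip psi (s + 1)) C2PI_neq_0).
  replace (2 * RtoC PI * Ci * ((hankel_recip psi s - s * hankel_recip psi (s + 1)) / (2 * RtoC PI * Ci)))%C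
    with ((2 * RtoC PI * Ci * hankel_recip psi s + - s * (2 * RtoC PI * Ci * hankel_recip psi (s + 1)))
     / (2 * RtoC PI * Ci))%C by (unfold Cdiv; ring).
  rewrite <- E. unfold Cdiv. ring.
Qed.

Lemma cexp_inj_strip (z w : C) : cexp z = cexp w -> Rabs (Im z - Im w) < 2 * PI -> z = w.
Proof.
  intros E H.
  assert (D : cexp (z - w) = 1%C).
  { rewrite cexp_minus, E. apply Cinv_r, cexp_neq_0. }
  assert (Hre : Re (z - w) = 0).
  { assert (Hm := Cmod_cexp (z - w)). rewrite D, Cmod_1 in Hm.
    apply exp_inv. rewrite exp_0. auto. }
  assert (Hc : cos (Im (z - w)) = 1).
  { apply (f_equal Re) in D. unfold cexp in D. rewrite Hre, exp_0 in D.
    change (1 * cos (Im (z - w)) = 1) in D. lra. }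
  assert (Him : Im (z - w) = 0).
  { change (Im (z - w)) with (Im z - Im w) in *. set (t := Im z - Im w) in *. clearbody t.
    assert (HPI := PI_RGT_0).
    (* Halving the angle brings it into [(-PI, PI)], where 0 is the only zero of the sine. *)
    assert (S : sin (t / 2) = 0).
    { replace t with (2 * (t / 2)) in Hc by field. rewrite cos_2a_sin in Hc. nra. }
    apply Rabs_lt_between in H.
    destruct (Rtotal_order t 0) as [L|[L|L]]; trivial; exfalso.
    - assert (0 < sin (- (t / 2))) by (apply sin_gt_0; lra). rewrite sin_neg in *. lra.
    - assert (0 < sin (t / 2)) by (apply sin_gt_0; lra). lra. }
  apply Ceq_minus. destruct (z - w)%C as [x y] eqn:Ezw. unfold Re, Im in Hre, Him; simpl in Hre, Him.
  rewrite Hre, Him. reflexivity.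
Qed.

Lemma cexp_ln (t : R) : 0 < t -> cexp (ln t, 0) = RtoC t.
Proof.
  intros Ht. unfold cexp, Re, Im; simpl. rewrite exp_ln, cos_0, sin_0 by trivial.
  unfold RtoC. f_equal; ring.
Qed.

Lemma Cmod_cexp_real_mul (r x y : R) : Cmod (cexp (RtoC r * (x, y))) = exp (r * x).
Proof.
  rewrite Cmod_cexp. f_equal. unfold Re, RtoC, Cmult; simpl. ring.
Qed.

Lemma Cpow_cexp (z : C) (n : nat) : Cpow (cexp z) n = cexp (RtoC (INR n) * z).
Proof.
  induction n as [|n IH].
  - simpl. rewrite Cmult_0_l. symmetry. apply cexp_0.
  - rewrite Cpow_S, IH, S_INR, RtoC_plus, Cmult_plus_distr_r, Cmult_1_l, cexp_plus. ring.
Qed.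

(** * The generating function [L] of the values [H(s + n + 1)] *)

Definition recip_coef (psi : R) (s : C) (n : nat) : C := hankel_recip psi (s + RtoC (INR n)).

Lemma recip_coef_succ (psi : R) (s : C) (n : nat) : PI / 2 < psi <= PI ->
  recip_coef psi s n = ((s + RtoC (INR n)) * recip_coef psi s (S n))%C.
Proof.
  intros Hpsi. unfold recip_coef. rewrite (hankel_recip_succ psi _ Hpsi) at 1.
  rewrite S_INR, RtoC_plus. do 2 f_equal. ring.
Qed.

(** Expands [e^u u^(-s) / (u - t)], [u = e^w], in powers of [t / u]; [|u| >= e^b] on the contour. *)
Lemma recip_series (psi : R) (s : C) (b : R) : PI / 2 < psi <= PI ->
  exists M, 0 <= M /\ forall t, 0 < t < exp b ->
    exists l, is_strip_int (fun w => hankel_fun (1 - s) w / (cexp w - RtoC t))%C b psi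
        (2 * RtoC PI * Ci * l)%C /\
      forall N, Cmod (partial_sum (fun n => recip_coef psi s (S n) * RtoC (t ^ n))%C N - l)
        <= M / (1 - t * exp (- b)) * (t * exp (- b)) ^ N.
Proof.
  intros Hpsi. assert (HPI := PI_RGT_0).
  destruct (strip_bounded_hankel_fun (- s) b psi Hpsi) as [M0 [HM0 HM]].
  (* The integrand bound times the weighted length of the contour, divided by [|2 pi i|]. It is
     fixed before [t], which makes the estimate uniform in [t]. *)
  exists (M0 * (2 * exp (- b) + 2 * psi) / (2 * PI)). split.
  { generalize (exp_pos (- b)). intros. apply Rmult_le_pos; [nra|].
    left; apply Rinv_0_lt_compat; lra. }
  intros t Ht. set (c := t * exp (- b)).
  assert (Hb := exp_pos (- b)).
  assert (Hc : 0 <= c < 1).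
  { unfold c. split; [nra|]. apply Rlt_le_trans with (exp b * exp (- b)).
    - apply Rmult_lt_compat_r; lra.
    - rewrite <- exp_plus, Rplus_opp_r, exp_0. lra. }
  set (q := fun w => (RtoC t * cexp (- (1) * w))%C).
  assert (Hq : forall x y, b <= x -> - psi <= y <= psi -> Cmod (q (x, y)) <= c).
  { intros x y Hx Hy. unfold q, c. rewrite Cmod_mult, Cmod_R, Rabs_pos_eq by lra.
    rewrite <- RtoC_opp, Cmod_cexp_real_mul. apply Rmult_le_compat_l; [lra|].
    apply exp_le_compat. lra. }
  (* Dividing numerator and denominator by [u] lowers the exponent [1 - s] to [- s] and turns
     [u - t] into [1 - t / u]. *)
  assert (Eq : forall w, cexp w <> RtoC t ->
    (hankel_fun (- s) w / (1 - q w) = hankel_fun (1 - s) w / (cexp w - RtoC t))%C).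
  { intros w Hw. unfold q. replace (1 - s)%C with (- s + 1)%C by ring.
    rewrite <- hankel_fun_mul_cexp. replace (- (1) * w)%C with (- w)%C by ring.
    rewrite cexp_opp, Cmult_1_l. field. split; [|apply cexp_neq_0].
    apply Cminus_eq_contra, Hw. }
  assert (Hw : forall x y, b <= x -> cexp (x, y) <> RtoC t).
  { intros x y Hx E. apply (f_equal Cmod) in E. rewrite Cmod_cexp, Cmod_R, Rabs_pos_eq in E by lra.
    unfold Re in E; simpl in E. assert (exp b <= exp x) by (apply exp_le_compat; lra). lra. }
  destruct (ex_strip_int (fun w => hankel_fun (- s) w / (1 - q w))%C b psi (M0 / (1 - c)))
    as [l Hl]; [lra| | |].
  { apply strip_bounded_geometric; trivial; lra. }
  { intros x y Hx Hy. apply (ex_Cderive_geometric _ q c); [lra|apply Hq; trivial| |].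
    - apply ex_Cderive_hankel_fun.
    - apply ex_Cderive_mult; [apply ex_Cderive_const|apply ex_Cderive_cexp_lin]. }
  exists (l / (2 * RtoC PI * Ci))%C.
  assert (El : (2 * RtoC PI * Ci * (l / (2 * RtoC PI * Ci)))%C = l).
  { apply Cmult_div_cancel, C2PI_neq_0. }
  split.
  - rewrite El. revert Hl. apply is_strip_int_ext; [lra|]. intros x y Hx Hy. apply Eq, Hw, Hx.
  - intros N.
    assert (G := partial_sum_strip_int_geometric (hankel_fun (- s)) q
      (fun n => 2 * RtoC PI * Ci * (recip_coef psi s (S n) * RtoC (t ^ n)))%C b psi M0 c l
      ltac:(lra) HM0 Hc HM Hq).
    specialize (fun H => G H Hl N).
    rewrite (partial_sum_Cmult (2 * RtoC PI * Ci)%C) in G. rewrite <- El in G.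
    set (lq := (l / (2 * RtoC PI * Ci))%C) in *.
    set (S0 := partial_sum _ N) in *.
    replace (2 * RtoC PI * Ci * S0 - 2 * RtoC PI * Ci * lq)%C with (2 * RtoC PI * Ci * (S0 - lq))%C in G by ring.
    rewrite !Cmod_mult, !Cmod_R, Cmod_Ci, (Rabs_pos_eq 2), (Rabs_pos_eq PI) in G by lra.
    apply Rmult_le_reg_l with (2 * PI); [lra|].
    replace (2 * PI * (M0 * (2 * exp (- b) + 2 * psi) / (2 * PI) / (1 - c) * c ^ N))
      with (M0 / (1 - c) * (2 * exp (- b) + 2 * psi) * c ^ N) by (field; lra).
    rewrite <- (Rmult_1_r (2 * PI)) at 1. apply G.
    intros n.
    assert (K := is_strip_int_Cmult (RtoC (t ^ n)) _ _ _ _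
      (hankel_recip_spec psi (s + RtoC (INR (S n))) b Hpsi)).
    replace (2 * RtoC PI * Ci * (recip_coef psi s (S n) * RtoC (t ^ n)))%C
      with (RtoC (t ^ n) * (2 * RtoC PI * Ci * hankel_recip psi (s + RtoC (INR (S n)))))%C
      by (unfold recip_coef; ring).
    revert K. apply is_strip_int_ext; [lra|]. intros x y _ _. generalize (x, y). intros w.
    unfold q. rewrite Cpow_mult_l, <- RtoC_pow, Cpow_cexp.
    replace (1 - (s + RtoC (INR (S n))))%C with (- s + - RtoC (INR n))%C
      by (rewrite S_INR, RtoC_plus; ring).
    rewrite <- hankel_fun_mul_cexp. replace (RtoC (INR n) * (- (1) * w))%C with (- RtoC (INR n) * w)%C by ring.
    ring.
Qed.

(** Each term at [t = r] is the difference of two consecutive partial sums, both close to the limit.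
    The choice [e^b = 2 r] makes the ratio [1 / 2]; as [r] is arbitrary, [L] is entire. *)
Lemma recip_coef_bound (psi : R) (s : C) (r : R) : PI / 2 < psi <= PI -> 0 < r ->
  exists K, forall n, Cmod (recip_coef psi s (S n)) * r ^ n <= K.
Proof.
  intros Hpsi Hr. assert (HPI := PI_RGT_0).
  destruct (recip_series psi s (ln (2 * r)) Hpsi) as [M [HM H]].
  destruct (H r) as [l [_ HN]]. { rewrite exp_ln; lra. }
  rewrite exp_Ropp, exp_ln in HN by lra.
  replace (r * / (2 * r)) with (/ 2) in HN by (field; lra).
  exists (2 * (M / (1 - / 2))). intros n.
  assert (H1 := HN (S n)). assert (H2 := HN n). cbn [partial_sum] in H1.
  set (P := partial_sum _ n) in *. set (z := (recip_coef psi s (S n) * RtoC (r ^ n))%C) in *.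
  replace (Cmod (recip_coef psi s (S n)) * r ^ n) with (Cmod z).
  2: { unfold z. rewrite Cmod_mult, Cmod_R, Rabs_pos_eq; trivial. apply pow_le; lra. }
  replace z with (P + z - l - (P - l))%C by ring.
  eapply Rle_trans; [apply Cmod_triangle_minus|].
  assert (Q : forall k, 0 <= (/ 2) ^ k <= 1).
  { intros k. split; [apply pow_le; lra|]. rewrite <- (pow1 k). apply pow_incr. lra. }
  assert (0 <= M / (1 - / 2)) by (apply Rmult_le_pos; [lra|left; apply Rinv_0_lt_compat; lra]).
  generalize (Q n) (Q (S n)). nra.
Qed.

Lemma CV_radius_entire (a : nat -> R) (x : R) :
  (forall r, 0 < r -> exists K, forall n, Rabs (a n) * r ^ n <= K) ->
  Rbar_lt (Rabs x) (CV_radius a).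
Proof.
  intros H. destruct (CV_radius_bounded a) as [ub _].
  assert (Hx := Rabs_pos x). destruct (H (Rabs x + 1)) as [K HK]; [lra|].
  assert (L : Rbar_le (Rabs x + 1) (CV_radius a)).
  { apply ub. exists K. intros n. rewrite Rabs_mult, <- RPow_abs, (Rabs_pos_eq (Rabs x + 1)) by lra.
    apply HK. }
  eapply Rbar_lt_le_trans; [|exact L]. simpl. lra.
Qed.

Definition recip_coef_Re (psi : R) (s : C) (n : nat) : R := Re (recip_coef psi s n).
Definition recip_coef_Im (psi : R) (s : C) (n : nat) : R := Im (recip_coef psi s n).

(** The function [L], as a pair of real power series so that it can be differentiated termwise.
    [PS_decr_1] drops [H(s)], so that the constant term is [H(s + 1)]. *)
Definition recip_fun (psi : R) (s : C) (t : R) : C :=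
  (PSeries (PS_decr_1 (recip_coef_Re psi s)) t, PSeries (PS_decr_1 (recip_coef_Im psi s)) t).

Lemma recip_coef_CV (psi : R) (s : C) (t : R) : PI / 2 < psi <= PI ->
  Rbar_lt (Rabs t) (CV_radius (PS_decr_1 (recip_coef_Re psi s))) /\
  Rbar_lt (Rabs t) (CV_radius (PS_decr_1 (recip_coef_Im psi s))).
Proof.
  intros Hpsi. split; apply CV_radius_entire; intros r Hr;
    destruct (recip_coef_bound psi s r Hpsi Hr) as [K HK]; exists K; intros n;
    (eapply Rle_trans; [|apply (HK n)]); apply Rmult_le_compat_r; try (apply pow_le; lra).
  - apply re_le_Cmod.
  - apply im_le_Cmod.
Qed.

(** Identifies the strip integrals of [recip_series], taken at various [b], with one function of
    [t]. *)
Lemma recip_fun_unique (psi : R) (s : C) (t K c : R) (l : C) : 0 <= c < 1 ->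
  (forall N, Cmod (partial_sum (fun n => recip_coef psi s (S n) * RtoC (t ^ n))%C N - l)
    <= K * c ^ N) -> recip_fun psi s t = l.
Proof.
  intros Hc HN. destruct (is_series_partial_sum _ _ _ _ Hc HN) as [H1 H2].
  apply is_series_unique in H1. apply is_series_unique in H2.
  unfold recip_fun, PSeries. destruct l as [l1 l2].
  unfold Re, Im in H1, H2; simpl in H1, H2. rewrite <- H1, <- H2.
  f_equal; apply Series_ext; intros n; unfold PS_decr_1, recip_coef_Re, recip_coef_Im, Re, Im; ring.
Qed.

(** Coefficientwise, [recip_coef_succ] says [s L + t L' = H(s) + t L] for
    [L = recip_fun psi s]. *)
Lemma recip_fun_ode (psi : R) (s : C) (t : R) : PI / 2 < psi <= PI ->
  exists d1 d2 : R,
    is_derive (fun u => Re (recip_fun psi s u)) t d1 /\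
    is_derive (fun u => Im (recip_fun psi s u)) t d2 /\
    t * d1 = Re (hankel_recip psi s) + t * Re (recip_fun psi s t)
      - Re s * Re (recip_fun psi s t) + Im s * Im (recip_fun psi s t) /\
    t * d2 = Im (hankel_recip psi s) + t * Im (recip_fun psi s t)
      - Re s * Im (recip_fun psi s t) - Im s * Re (recip_fun psi s t).
Proof.
  intros Hpsi. destruct (recip_coef_CV psi s t Hpsi) as [CV1 CV2].
  assert (R1 : forall u, Re (recip_fun psi s u) = PSeries (PS_decr_1 (recip_coef_Re psi s)) u)
    by reflexivity.
  assert (R2 : forall u, Im (recip_fun psi s u) = PSeries (PS_decr_1 (recip_coef_Im psi s)) u)
    by reflexivity.
  set (A := PS_decr_1 (recip_coef_Re psi s)) in *. set (B := PS_decr_1 (recip_coef_Im psi s)) in *.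
  exists (PSeries (PS_derive A) t), (PSeries (PS_derive B) t).
  split; [exact (is_derive_PSeries A t CV1)|]. split; [exact (is_derive_PSeries B t CV2)|].
  rewrite R1, R2.
  assert (XA : ex_pseries A t) by (apply CV_radius_inside, CV1).
  assert (XB : ex_pseries B t) by (apply CV_radius_inside, CV2).
  assert (XA' : ex_pseries (PS_derive A) t) by (apply CV_radius_inside; rewrite CV_radius_derive; exact CV1).
  assert (XB' : ex_pseries (PS_derive B) t) by (apply CV_radius_inside; rewrite CV_radius_derive; exact CV2).
  assert (E0 : recip_coef psi s 0 = hankel_recip psi s).
  { unfold recip_coef. simpl. f_equal. ring. }
  assert (IA : ex_pseries (PS_incr_1 (PS_derive A)) t) by (apply ex_pseries_incr_1, XA').
  assert (IB : ex_pseries (PS_incr_1 (PS_derive B)) t) by (apply ex_pseries_incr_1, XB').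
  (* The recurrence for [H] in real and imaginary parts, with [n] times the coefficient read as a
     coefficient of [t A'(t)], respectively [t B'(t)]. *)
  assert (Cs : forall n, recip_coef_Re psi s n = Re s * A n - Im s * B n + PS_incr_1 (PS_derive A) n /\
    recip_coef_Im psi s n = Re s * B n + Im s * A n + PS_incr_1 (PS_derive B) n).
  { intros n. unfold recip_coef_Re, recip_coef_Im. rewrite (recip_coef_succ psi s n Hpsi).
    assert (PA : PS_incr_1 (PS_derive A) n = INR n * A n).
    { destruct n; [unfold PS_incr_1; simpl; unfold zero; simpl; ring|].
      unfold PS_incr_1, PS_derive. reflexivity. }
    assert (PB : PS_incr_1 (PS_derive B) n = INR n * B n).
    { destruct n; [unfold PS_incr_1; simpl; unfold zero; simpl; ring|].
      unfold PS_incr_1, PS_derive. reflexivity. }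
    rewrite PA, PB. unfold A, B, PS_decr_1, recip_coef_Re, recip_coef_Im.
    destruct (recip_coef psi s (S n)) as [x y], s as [s1 s2].
    unfold Re, Im, RtoC, Cmult, Cplus; simpl fst; simpl snd. split; ring. }
  assert (SA : PSeries (recip_coef_Re psi s) t =
    Re s * PSeries A t - Im s * PSeries B t + t * PSeries (PS_derive A) t).
  { rewrite <- PSeries_incr_1, <- PSeries_scal, <- PSeries_scal, <- PSeries_minus, <- PSeries_plus.
    - apply PSeries_ext. intros n. apply Cs.
    - apply ex_pseries_minus; apply ex_pseries_scal; trivial; apply Rmult_comm.
    - exact IA.
    - apply ex_pseries_scal; trivial; apply Rmult_comm.
    - apply ex_pseries_scal; trivial; apply Rmult_comm. }
  assert (SB : PSeries (recip_coef_Im psi s) t =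
    Re s * PSeries B t + Im s * PSeries A t + t * PSeries (PS_derive B) t).
  { rewrite <- PSeries_incr_1, <- PSeries_scal, <- PSeries_scal, <- PSeries_plus, <- PSeries_plus.
    - apply PSeries_ext. intros n. apply Cs.
    - apply ex_pseries_plus; apply ex_pseries_scal; trivial; apply Rmult_comm.
    - exact IB.
    - apply ex_pseries_scal; trivial; apply Rmult_comm.
    - apply ex_pseries_scal; trivial; apply Rmult_comm. }
  assert (X1 : ex_pseries (recip_coef_Re psi s) t).
  { apply ex_pseries_ext with (PS_plus (PS_minus (PS_scal (Re s) A) (PS_scal (Im s) B)) (PS_incr_1 (PS_derive A))).
    - intros n. symmetry. apply Cs.
    - apply ex_pseries_plus; trivial. apply ex_pseries_minus; apply ex_pseries_scal; trivial; apply Rmult_comm. }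
  assert (X2 : ex_pseries (recip_coef_Im psi s) t).
  { apply ex_pseries_ext with (PS_plus (PS_plus (PS_scal (Re s) B) (PS_scal (Im s) A)) (PS_incr_1 (PS_derive B))).
    - intros n. symmetry. apply Cs.
    - apply ex_pseries_plus; trivial. apply ex_pseries_plus; apply ex_pseries_scal; trivial; apply Rmult_comm. }
  (* Splitting off the constant term [H(s)] writes the full series as [H(s) + t L]. *)
  rewrite (PSeries_decr_1 _ _ X1) in SA. rewrite (PSeries_decr_1 _ _ X2) in SB.
  fold A in SA. fold B in SB. unfold recip_coef_Re in SA at 1. unfold recip_coef_Im in SB at 1.
  rewrite E0 in SA, SB. split; lra.
Qed.

(** * Euler's integral as the increment of a primitive *)

Definition gamma_integrand (s : C) (t : R) : C := (RtoC (exp (- t)) * cpow (RtoC t) (s - 1))%C.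

Lemma cpow_RtoC (t : R) (s : C) : 0 < t -> cpow (RtoC t) s = cexp (s * RtoC (ln t)).
Proof.
  intros Ht. unfold cpow, polar_pow, carg. rewrite Cmod_R, Rabs_pos_eq by lra.
  destruct (Rle_dec 0 (Im (RtoC t))) as [|H]; [|exfalso; apply H; unfold Im; simpl; lra].
  replace (Re (RtoC t) / t) with 1 by (unfold Re; simpl; field; lra).
  rewrite acos_1. reflexivity.
Qed.

(** [t^s e^(-t) L(t)], a primitive of [H(s) t^(s-1) e^(-t)]. *)
Definition gamma_primitive (psi : R) (s : C) (t : R) : C :=
  (cexp (s * RtoC (ln t) - RtoC t) * recip_fun psi s t)%C.

Lemma is_derive_pair (f1 f2 : R -> R) (x d1 d2 : R) :
  is_derive f1 x d1 -> is_derive f2 x d2 ->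
  is_derive (K := R_AbsRing) (V := C_R_CompleteNormedModule) (fun t => (f1 t, f2 t)) x (d1, d2).
Proof.
  intros H1 H2. apply is_derive_C_R_eps. intros eps Heps.
  destruct H1 as [_ H1]. destruct H2 as [_ H2].
  assert (He : 0 < eps / 2) by lra.
  destruct (H1 x (fun P HP => HP) (mkposreal _ He)) as [e1 K1].
  destruct (H2 x (fun P HP => HP) (mkposreal _ He)) as [e2 K2].
  exists (Rmin e1 e2). split; [apply Rmin_pos; apply cond_pos|]. intros t Ht.
  specialize (K1 t (Rlt_le_trans _ _ _ Ht (Rmin_l _ _))).
  specialize (K2 t (Rlt_le_trans _ _ _ Ht (Rmin_r _ _))).
  change (Rabs (f1 t - f1 x - (t - x) * d1) <= eps / 2 * Rabs (t - x)) in K1.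
  change (Rabs (f2 t - f2 x - (t - x) * d2) <= eps / 2 * Rabs (t - x)) in K2.
  eapply Rle_trans; [apply Cmod_le_Rabs|]. unfold Re, Im; simpl.
  replace (f1 t + - f1 x + - ((t - x) * d1 - 0 * d2)) with (f1 t - f1 x - (t - x) * d1) by ring.
  replace (f2 t + - f2 x + - ((t - x) * d2 + 0 * d1)) with (f2 t - f2 x - (t - x) * d2) by ring.
  lra.
Qed.

Lemma is_derive_gamma_primitive (psi : R) (s : C) (t : R) : PI / 2 < psi <= PI -> 0 < t ->
  is_derive (K := R_AbsRing) (V := C_R_CompleteNormedModule) (gamma_primitive psi s) t
    (hankel_recip psi s * gamma_integrand s t)%C.
Proof.
  intros Hpsi Ht.
  destruct (recip_fun_ode psi s t Hpsi) as (d1 & d2 & D1 & D2 & E1 & E2).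
  unfold gamma_integrand. rewrite cpow_RtoC by trivial.
  set (L1 := fun u => Re (recip_fun psi s u)) in *. set (L2 := fun u => Im (recip_fun psi s u)) in *.
  change (is_derive L1 t d1) in D1. change (is_derive L2 t d2) in D2.
  change (Re (recip_fun psi s t)) with (L1 t) in *. change (Im (recip_fun psi s t)) with (L2 t) in *.
  destruct (hankel_recip psi s) as [h1 h2] eqn:Eh. destruct s as [sg ta].
  unfold Re, Im in E1, E2; simpl fst in *; simpl snd in *.
  apply (is_derive_ext (V := C_R_CompleteNormedModule)) with (f := fun u =>
    (exp (sg * ln u - u) * (cos (ta * ln u) * L1 u - sin (ta * ln u) * L2 u),
     exp (sg * ln u - u) * (cos (ta * ln u) * L2 u + sin (ta * ln u) * L1 u))).
  { intros u. unfold gamma_primitive, L1, L2. destruct (recip_fun psi (sg, ta) u) as [l1 l2].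
    unfold cexp, RtoC, Cmult, Cminus, Cplus, Copp, Re, Im; simpl.
    replace (sg * ln u - ta * 0 + - u) with (sg * ln u - u) by ring.
    replace (sg * 0 + ta * ln u + - 0) with (ta * ln u) by ring.
    f_equal; ring. }
  clearbody L1 L2. set (c := cos (ta * ln t)). set (sn := sin (ta * ln t)). set (e := exp (sg * ln t - t)).
  assert (X1 : ex_derive L1 t) by (exists d1; exact D1).
  assert (X2 : ex_derive L2 t) by (exists d2; exact D2).
  replace ((h1, h2) * (RtoC (exp (- t)) * cexp (((sg, ta) - 1) * RtoC (ln t))))%C with
    (e / t * (h1 * c - h2 * sn), e / t * (h1 * sn + h2 * c)).
  2: { unfold cexp, RtoC, Cmult, Cminus, Cplus, Copp, Re, Im; simpl.
       replace ((sg + - (1)) * ln t - (ta + - 0) * 0) with (sg * ln t - ln t) by ring.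
       replace ((sg + - (1)) * 0 + (ta + - 0) * ln t) with (ta * ln t) by ring.
       assert (Ee : e / t = exp (- t) * exp (sg * ln t - ln t)).
       { unfold e, Rdiv. rewrite <- (exp_ln t Ht) at 3. rewrite <- exp_Ropp, <- !exp_plus. f_equal; ring. }
       rewrite Ee. unfold c, sn. f_equal; ring. }
  assert (Y1 : is_derive (fun u => exp (sg * ln u - u) * (cos (ta * ln u) * L1 u - sin (ta * ln u) * L2 u)) t
    (e / t * (h1 * c - h2 * sn))).
  { auto_derive; [repeat split; trivial|].
    replace (Derive (fun x => L1 x) t) with d1 by (symmetry; apply is_derive_unique, D1).
    replace (Derive (fun x => L2 x) t) with d2 by (symmetry; apply is_derive_unique, D2).
    change (sg * ln t + - t) with (sg * ln t - t). fold c sn e.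
    (* Once the derivatives are eliminated through the differential equation, all terms in [L1] and
       [L2] cancel and only those with [H(s)] survive. *)
    replace d1 with ((h1 + t * L1 t - sg * L1 t + ta * L2 t) / t) by (rewrite <- E1; field; lra).
    replace d2 with ((h2 + t * L2 t - sg * L2 t - ta * L1 t) / t) by (rewrite <- E2; field; lra).
    field. lra. }
  assert (Y2 : is_derive (fun u => exp (sg * ln u - u) * (cos (ta * ln u) * L2 u + sin (ta * ln u) * L1 u)) t
    (e / t * (h1 * sn + h2 * c))).
  { auto_derive; [repeat split; trivial|].
    replace (Derive (fun x => L1 x) t) with d1 by (symmetry; apply is_derive_unique, D1).
    replace (Derive (fun x => L2 x) t) with d2 by (symmetry; apply is_derive_unique, D2).
    change (sg * ln t + - t) with (sg * ln t - t). fold c sn e.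
    replace d1 with ((h1 + t * L1 t - sg * L1 t + ta * L2 t) / t) by (rewrite <- E1; field; lra).
    replace d2 with ((h2 + t * L2 t - sg * L2 t - ta * L1 t) / t) by (rewrite <- E2; field; lra).
    field. lra. }
  exact (is_derive_pair _ _ _ _ _ Y1 Y2).
Qed.

Lemma Cmod_gamma_factor (s : C) (t : R) :
  Cmod (cexp (s * RtoC (ln t) - RtoC t)) = exp (Re s * ln t - t).
Proof.
  rewrite Cmod_cexp. f_equal. destruct s. unfold Re, RtoC, Cmult, Cminus, Cplus, Copp; simpl. ring.
Qed.

Lemma gamma_primitive_at_0 (psi : R) (s : C) (eps : R) : PI / 2 < psi <= PI -> 0 < Re s -> 0 < eps ->
  exists eta, 0 < eta /\ forall t, 0 < t < eta -> Cmod (gamma_primitive psi s t) < eps.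
Proof.
  (* With [b = 1] and [t < 1] the ratio [t / e] is at most [1 / 2], so [L] is bounded by [2 * M]
     near 0 and [t^(Re s)] decides the limit. *)
  intros Hpsi Hs Heps. destruct (recip_series psi s 1 Hpsi) as [M [HM H]].
  assert (He1 : exp (- (1)) <= / 2).
  { rewrite exp_Ropp. apply Rinv_le_contravar; [lra|]. generalize (exp_ineq1_le 1). lra. }
  exists (Rmin 1 (exp (ln (eps / (2 * M + 1)) / Re s))).
  split; [apply Rmin_pos; [lra|apply exp_pos]|]. intros t [Ht0 Ht].
  assert (Ht1 := Rlt_le_trans _ _ _ Ht (Rmin_l _ _)).
  assert (Ht2 := Rlt_le_trans _ _ _ Ht (Rmin_r _ _)).
  destruct (H t) as [l [_ Hl]]. { generalize (exp_ineq1_le 1). lra. }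
  set (c := t * exp (- (1))) in *.
  assert (Hc : 0 <= c <= / 2). { unfold c. generalize (exp_pos (- (1))). nra. }
  rewrite <- (recip_fun_unique psi s t _ c l ltac:(lra) Hl) in Hl.
  (* For the empty partial sum the error estimate is a bound on [L(t)] itself. *)
  specialize (Hl O). cbn [partial_sum pow] in Hl.
  replace (0 - recip_fun psi s t)%C with (- recip_fun psi s t)%C in Hl by ring. rewrite Cmod_opp in Hl.
  assert (HL : Cmod (recip_fun psi s t) <= 2 * M).
  { eapply Rle_trans; [exact Hl|]. rewrite Rmult_1_r. apply Rle_div_l; nra. }
  unfold gamma_primitive. rewrite Cmod_mult, Cmod_gamma_factor.
  assert (HE : exp (Re s * ln t - t) < eps / (2 * M + 1)).
  { rewrite <- (exp_ln (eps / (2 * M + 1))) by (apply Rdiv_lt_0_compat; lra).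
    apply exp_increasing. apply ln_increasing in Ht2; [|trivial]. rewrite ln_exp in Ht2.
    apply Rlt_div_r in Ht2; [|trivial]. lra. }
  apply Rlt_div_r in HE; [|lra]. generalize (exp_pos (Re s * ln t - t)) (Cmod_ge_0 (recip_fun psi s t)). nra.
Qed.

Lemma gamma_factor_at_infty (sg eps : R) : 0 < sg -> 0 < eps ->
  exists N, forall t, N < t -> 0 < t -> exp (sg * ln t - t) < eps.
Proof.
  intros Hsg Heps. destruct (exp_neg_small (exp (sg * ln (2 * sg))) eps Heps) as [N HN].
  exists (2 * N). intros t HtN Ht.
  eapply Rle_lt_trans; [|apply (HN (t / 2)); lra].
  rewrite <- exp_plus. apply exp_le_compat.
  (* Scaled by [sg] this reads [sg * ln t <= t / 2 + sg * ln (2 * sg)], which leaves half of the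
     exponential decay. *)
  assert (L : ln (t / (2 * sg)) <= t / (2 * sg)).
  { assert (Hp : 0 < t / (2 * sg)) by (apply Rdiv_lt_0_compat; lra).
    generalize (exp_ineq1_le (ln (t / (2 * sg)))). rewrite exp_ln by trivial. lra. }
  rewrite ln_div in L by lra.
  apply (Rmult_le_compat_l sg) in L; [|lra].
  replace (sg * (t / (2 * sg))) with (t / 2) in L by (field; lra). lra.
Qed.

(** The expansion of [L(t)] holds to the right of the pole [w = ln t]. Moving the side to [Re w = 0]
    crosses that pole with residue [e^t t^(-s)], which the factor [t^s e^(-t)] turns into 1. What
    remains is bounded independently of [t], so the same factor sends it to 0. *)
Lemma gamma_primitive_at_infty (psi : R) (s : C) (eps : R) : PI / 2 < psi <= PI -> 0 < Re s -> 0 < eps ->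
  exists N, forall t, N < t -> Cmod (gamma_primitive psi s t - 1) < eps.
Proof.
  intros Hpsi Hs Heps. assert (HPI := PI_RGT_0).
  destruct (strip_bounded_hankel_fun (1 - s) 0 psi Hpsi) as [M [HM HB]].
  set (K := M * (2 * exp (- 0) + 2 * psi) / (2 * PI)).
  assert (HK : 0 <= K).
  { unfold K. rewrite Ropp_0, exp_0. apply Rmult_le_pos; [nra|left; apply Rinv_0_lt_compat; lra]. }
  destruct (gamma_factor_at_infty (Re s) (eps / (K + 1)) Hs) as [N HN].
  { apply Rdiv_lt_0_compat; lra. }
  (* For [t > 2] the pole lies strictly inside the half-strip, and [|u - t| >= 1] on the moved
     contour, because [Re u <= 1] there. *)
  exists (Rmax 2 N). intros t Ht. generalize (Rmax_l 2 N) (Rmax_r 2 N); intros.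
  set (b := ln t + 1).
  assert (Htb : t < exp b). { rewrite <- (exp_ln t) at 1 by lra. apply exp_increasing. unfold b; lra. }
  assert (Hlnt : 0 < ln t) by (rewrite <- ln_1; apply ln_increasing; lra).
  destruct (recip_series psi s b Hpsi) as [M' [_ H']].
  destruct (H' t) as [l [Hl HNl]]; [lra|].
  assert (Hcb : 0 <= t * exp (- b) < 1).
  { generalize (exp_pos (- b)); intros. split; [nra|].
    replace 1 with (exp b * exp (- b)) by (rewrite <- exp_plus, Rplus_opp_r; apply exp_0). nra. }
  assert (EL := recip_fun_unique _ _ _ _ _ _ Hcb HNl). clear HNl.
  set (f := fun w => (hankel_fun (1 - s) w / (cexp w - RtoC t))%C) in *.
  assert (HT : RtoC t <> 0%C) by (intros E; apply RtoC_inj in E; lra).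
  assert (Hw0 : cexp (ln t, 0) = RtoC t) by (apply cexp_ln; lra).
  assert (Hf : forall x y, - psi <= y <= psi -> (x, y) <> (ln t, 0) -> ex_Cderive f (x, y)).
  { intros x y Hy Hne. apply ex_Cderive_div.
    - apply ex_Cderive_hankel_fun.
    - apply ex_Cderive_minus; [eexists; apply is_Cderive_cexp|apply ex_Cderive_const].
    - apply Cminus_eq_contra. intros E. apply Hne. apply cexp_inj_strip.
      + rewrite Hw0. exact E.
      + unfold Im; simpl. apply Rabs_lt_between. lra. }
  assert (Hres : is_residue f (ln t, 0) (hankel_fun (1 - s) (ln t, 0) / RtoC t)%C).
  { apply is_residue_quotient; trivial.
    - apply ex_Cderive_hankel_fun.
    - apply is_Cderive_minus_const. rewrite <- Hw0. apply is_Cderive_cexp.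
    - rewrite Hw0. ring. }
  assert (HQ := rect_int_pole f 0 b (- psi) psi (ln t) 0 _ ltac:(unfold b; lra) ltac:(lra)
    (fun x y _ Hy => Hf x y Hy) Hres).
  assert (EX : ex_rect_int f 0 b (- psi) psi).
  { apply ex_rect_int_holo; try lra; [unfold b; lra|]. unfold b.
    split; intros u Hu; split; apply Hf; try lra; intros E; injection E; lra. }
  assert (Hl0 := is_strip_int_move f 0 b psi _ EX Hl). rewrite HQ in Hl0.
  set (A := (hankel_fun (1 - s) (ln t, 0) / RtoC t)%C) in *.
  replace (2 * RtoC PI * Ci * l - 2 * RtoC PI * Ci * A)%C with (2 * RtoC PI * Ci * (l - A))%C in Hl0 by ring.
  assert (HBf : strip_bounded f 0 psi (M * 1)).
  { unfold f, Cdiv. apply strip_bounded_mul; [lra| |exact HB].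
    assert (P : forall x y, exp x * cos y <= 1 -> Cmod (/ (cexp (x, y) - RtoC t)) <= 1).
    { intros x y Hxy.
      assert (W : 1 <= Cmod (cexp (x, y) - RtoC t)).
      { eapply Rle_trans; [|apply re_le_Cmod].
        change (1 <= Rabs (exp x * cos y + - t)). rewrite Rabs_left; lra. }
      rewrite Cmod_inv by (apply Cmod_gt_0; lra). rewrite <- Rinv_1. apply Rinv_le_contravar; lra. }
    assert (Hcos := cos_neg_of_gt_PI2 psi Hpsi).
    split.
    - intros u Hu. split; apply P; rewrite ?cos_neg; generalize (exp_pos u); nra.
    - intros u Hu. apply P. rewrite exp_0. generalize (COS_bound u). lra. }
  assert (Bl : Cmod (l - A) <= K).
  { assert (B := Cmod_strip_int_le f 0 psi (M * 1) _ ltac:(lra) ltac:(lra) HBf Hl0).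
    rewrite !Cmod_mult, !Cmod_R, Cmod_Ci, (Rabs_pos_eq 2), (Rabs_pos_eq PI) in B by lra.
    unfold K. apply Rle_div_r; [lra|]. lra. }
  assert (EA : (cexp (s * RtoC (ln t) - RtoC t) * A = 1)%C).
  { unfold A, hankel_fun. rewrite Hw0.
    replace (ln t, 0) with (RtoC (ln t)) by reflexivity.
    replace ((1 - s) * RtoC (ln t))%C with (RtoC (ln t) - s * RtoC (ln t))%C by ring.
    rewrite !cexp_minus. replace (cexp (RtoC (ln t))) with (RtoC t).
    field. repeat split; trivial; apply cexp_neq_0. }
  unfold gamma_primitive. rewrite EL.
  replace (cexp (s * RtoC (ln t) - RtoC t) * l - 1)%C with
    (cexp (s * RtoC (ln t) - RtoC t) * (l - A))%C by (rewrite <- EA; ring).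
  rewrite Cmod_mult, Cmod_gamma_factor.
  specialize (HN t ltac:(lra) ltac:(lra)). apply Rlt_div_r in HN; [|lra].
  generalize (exp_pos (Re s * ln t - t)) (Cmod_ge_0 (l - A)). nra.
Qed.

Lemma Ccontinuous_gamma_integrand (s : C) (t : R) : 0 < t -> Ccontinuous (gamma_integrand s) t.
Proof.
  intros Ht. destruct s as [sg ta].
  assert (K : Ccontinuous (fun u => (exp ((sg - 1) * ln u - u) * cos (ta * ln u),
                                    exp ((sg - 1) * ln u - u) * sin (ta * ln u))) t).
  { apply (ex_derive_continuous (V := C_R_CompleteNormedModule)). eexists.
    apply is_derive_pair; apply Derive_correct; auto_derive; repeat split; trivial. }
  revert K. apply (continuous_ext_loc (T := R_UniformSpace) (U := C_R_CompleteNormedModule)).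
  assert (Hloc : locally t (fun u => 0 < u)).
  { exists (mkposreal t Ht). intros u Hu. change (Rabs (u - t) < t) in Hu.
    apply Rabs_lt_between in Hu. lra. }
  apply filter_imp with (2 := Hloc). intros u Hu.
  unfold gamma_integrand. rewrite cpow_RtoC by trivial.
  unfold cexp, RtoC, Cmult, Cminus, Cplus, Copp, Re, Im; simpl.
  replace ((sg + - (1)) * ln u - (ta + - 0) * 0) with ((sg - 1) * ln u) by ring.
  replace ((sg + - (1)) * 0 + (ta + - 0) * ln u) with (ta * ln u) by ring.
  unfold Rminus. rewrite exp_plus. f_equal; ring.
Qed.

Lemma hankel_recip_mul_Gamma_integral (psi : R) (s : C) : PI / 2 < psi <= PI -> 0 < Re s ->
  (hankel_recip psi s * Gamma_integral s)%C = 1%C.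
Proof.
  intros Hpsi Hs. set (h := hankel_recip psi s). set (P := gamma_primitive psi s).
  assert (I : forall t1 t2, 0 < t1 -> t1 <= t2 ->
    is_CInt (fun t => h * gamma_integrand s t)%C t1 t2 (P t2 - P t1)%C).
  { intros t1 t2 H1 H2. apply is_CInt_derive; trivial.
    - intros t Ht. apply is_derive_gamma_primitive; trivial. lra.
    - intros t Ht. apply Ccontinuous_eps. intros eps Heps.
      assert (Hh : 0 < Cmod h + 1) by (generalize (Cmod_ge_0 h); lra).
      destruct (proj1 (Ccontinuous_eps _ _) (Ccontinuous_gamma_integrand s t ltac:(lra))
        (eps / (Cmod h + 1))) as [del [Hdel Hc]]. { apply Rdiv_lt_0_compat; lra. }
      exists del. split; trivial. intros u Hu. specialize (Hc u Hu). apply Rlt_div_r in Hc; [|trivial].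
      replace (h * gamma_integrand s u - h * gamma_integrand s t)%C
        with (h * (gamma_integrand s u - gamma_integrand s t))%C by ring.
      rewrite Cmod_mult. generalize (Cmod_ge_0 (gamma_integrand s u - gamma_integrand s t)). nra. }
  (* If [H(s)] were 0, the primitive would be constant, although it tends to 0 at the origin and to
     1 at infinity. Dividing by [h] then gives the convergence of Euler's integral itself. *)
  assert (h0 : h <> 0%C).
  { intros E.
    destruct (gamma_primitive_at_0 psi s (/ 2) Hpsi Hs) as [eta [Heta K0]]; [lra|].
    destruct (gamma_primitive_at_infty psi s (/ 2) Hpsi Hs) as [N K1]; [lra|].
    set (t1 := eta / 2). set (t2 := Rmax (N + 1) t1).
    assert (Ht2 : N + 1 <= t2) by apply Rmax_l. assert (Ht12 : t1 <= t2) by apply Rmax_r.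
    specialize (K0 t1 ltac:(unfold t1; lra)). specialize (K1 t2 ltac:(lra)).
    assert (Z : is_CInt (fun t => h * gamma_integrand s t)%C t1 t2 (RtoC 0)).
    { apply (is_CInt_ext (fun _ => RtoC 0)). { intros t. rewrite E. ring. }
      assert (C := is_RInt_const (V := C_R_CompleteNormedModule) t1 t2 (RtoC 0)).
      rewrite (scal_zero_r (V := C_R_CompleteNormedModule)) in C. exact C. }
    apply is_CInt_unique in Z. rewrite (is_CInt_unique _ _ _ _ (I t1 t2 ltac:(unfold t1; lra) Ht12)) in Z.
    apply (f_equal Cmod) in Z. rewrite Cmod_0 in Z.
    fold P in K0, K1.
    assert (T := Cmod_triangle (P t2 - P t1) (P t1)).
    assert (T' := Cmod_triangle_inv 1 (P t2)). rewrite Cmod_1, Cmod_minus_sym in T'.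
    replace (P t2 - P t1 + P t1)%C with (P t2) in T by ring. lra. }
  assert (hm : 0 < Cmod h) by (apply Cmod_gt_0, h0).
  assert (G : Gamma_integral s = (/ h)%C).
  { unfold Gamma_integral. apply (is_RInt_gen_unique (V := C_R_CompleteNormedModule)).
    intros Q HQ. apply locally_C_R_eps in HQ. destruct HQ as [eps [Heps HQ]].
    assert (He : 0 < eps * Cmod h / 2) by nra.
    destruct (gamma_primitive_at_0 psi s _ Hpsi Hs He) as [eta [Heta K0]].
    destruct (gamma_primitive_at_infty psi s _ Hpsi Hs He) as [N K1].
    exists (fun t => 0 < t < Rmin eta 1) (fun t => Rmax N 1 < t).
    - exists (mkposreal _ (Rmin_pos _ _ Heta Rlt_0_1)). intros t Ht Ht0. split; trivial.
      change (Rabs (t - 0) < Rmin eta 1) in Ht. rewrite Rminus_0_r, Rabs_pos_eq in Ht; lra.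
    - exists (Rmax N 1). auto.
    - intros t1 t2 [H1 H1'] H2. simpl fst. simpl snd.
      assert (A1 := Rlt_le_trans _ _ _ H1' (Rmin_l _ _)). assert (A2 := Rlt_le_trans _ _ _ H1' (Rmin_r _ _)).
      assert (A3 := Rle_lt_trans _ _ _ (Rmax_l _ _) H2). assert (A4 := Rle_lt_trans _ _ _ (Rmax_r _ _) H2).
      exists (/ h * (P t2 - P t1))%C. split.
      + generalize (is_CInt_Cmult (/ h)%C _ _ _ _ (I t1 t2 H1 ltac:(lra))).
        apply is_CInt_ext. intros t. unfold gamma_integrand. field. exact h0.
      + apply HQ. specialize (K0 t1 ltac:(lra)). specialize (K1 t2 A3). fold P in K0, K1.
        replace (/ h * (P t2 - P t1) - / h)%C with (/ h * ((P t2 - 1) - P t1))%C by ring.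
        rewrite Cmod_mult, Cmod_inv by trivial.
        apply Rmult_lt_reg_l with (Cmod h); [trivial|].
        rewrite <- Rmult_assoc, Rinv_r, Rmult_1_l by lra.
        eapply Rle_lt_trans; [apply Cmod_triangle_minus|]. lra. }
  rewrite G. apply Cinv_r, h0.
Qed.

Lemma hankel_recip_rising (psi : R) (s : C) (N : nat) : PI / 2 < psi <= PI ->
  hankel_recip psi s = (rising s N * hankel_recip psi (s + RtoC (INR N)))%C.
Proof.
  intros Hpsi. induction N as [|N IH].
  - simpl. replace (s + 0)%C with s by ring. ring.
  - rewrite IH, (hankel_recip_succ psi (s + RtoC (INR N)) Hpsi), S_INR, RtoC_plus. simpl.
    rewrite Cplus_assoc. ring.
Qed.

(** Both sides split off the same rising product, which moves the claim to an argument with positive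
    real part. *)
Theorem inv_Gamma_hankel_recip (psi : R) (s : C) : PI / 2 < psi <= PI ->
  inv_Gamma s = hankel_recip psi s.
Proof.
  intros Hpsi. unfold inv_Gamma. set (N := Gamma_shift s).
  rewrite (hankel_recip_rising psi s N Hpsi).
  assert (Hre : 0 < Re (s + RtoC (INR N))).
  { replace (Re (s + RtoC (INR N))) with (Re s + INR N) by (destruct s; reflexivity).
    unfold N, Gamma_shift. destruct (archimed (- Re s)) as [A _].
    (* [Z.to_nat] sends a negative integer to 0, but in that case [Re s] is already positive. *)
    destruct (Z_lt_le_dec (up (- Re s)) 0) as [H|H].
    - apply IZR_lt in H. generalize (pos_INR (Z.to_nat (up (- Re s)))). lra.
    - rewrite INR_IZR_INZ, Z2Nat.id by trivial. lra. }
  assert (E := hankel_recip_mul_Gamma_integral psi _ Hpsi Hre).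
  set (G := Gamma_integral (s + RtoC (INR N))) in *.
  assert (HG : G <> 0%C).
  { intros HG. rewrite HG, Cmult_0_r in E. apply C1_nz. symmetry. exact E. }
  unfold Cdiv. rewrite <- (Cmult_1_l (/ G)), <- E. field. exact HG.
Qed.

Corollary hankel_formula (psi a : R) (s : C) : PI / 2 < psi <= PI ->
  is_strip_int (hankel_fun (1 - s)) a psi (2 * RtoC PI * Ci * inv_Gamma s)%C.
Proof. intros Hpsi. rewrite (inv_Gamma_hankel_recip psi s Hpsi). apply hankel_recip_spec, Hpsi. Qed.

(** * The double series *)

Lemma cexp_log (z : C) : z <> 0%C -> cexp (ln (Cmod z), carg z) = z.
Proof.
  intros Hz. assert (Hm : 0 < Cmod z) by (apply Cmod_gt_0, Hz).
  unfold cexp. change (Re (ln (Cmod z), carg z)) with (ln (Cmod z)).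
  change (Im (ln (Cmod z), carg z)) with (carg z). rewrite exp_ln by trivial.
  set (m := Cmod z) in *. set (c := Re z / m).
  assert (Hsq : m * m = Re z * Re z + Im z * Im z).
  { generalize (Cmod2_alt z). fold m. simpl. lra. }
  assert (Hc : -1 <= c <= 1).
  { apply Rabs_le_between. unfold c. rewrite Rabs_div, (Rabs_pos_eq m) by lra.
    apply Rle_div_l; [lra|]. rewrite Rmult_1_l. apply re_le_Cmod. }
  assert (Hs : sqrt (1 - Rsqr c) = Rabs (Im z) / m).
  { replace (1 - Rsqr c) with (Rsqr (Im z / m)).
    - rewrite sqrt_Rsqr_abs, Rabs_div, (Rabs_pos_eq m) by lra. reflexivity.
    - unfold c, Rsqr. apply Rmult_eq_reg_r with (m * m); [|nra]. field_simplify; [|lra|lra]. nra. }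
  assert (Ecos : cos (carg z) = c).
  { unfold carg. fold m. fold c. destruct Rle_dec; rewrite ?cos_neg; apply cos_acos; lra. }
  assert (Esin : sin (carg z) = Im z / m).
  { unfold carg. fold m. fold c. destruct Rle_dec as [H|H]; rewrite ?sin_neg, sin_acos, Hs by lra.
    - rewrite Rabs_pos_eq; trivial.
    - rewrite Rabs_left by lra. field. lra. }
  rewrite Ecos, Esin. unfold c. destruct z as [u v]. unfold Re, Im; simpl. f_equal; field; lra.
Qed.

(** With the default [/ 0 = 0] this also holds at zeros, so the kernel can be rewritten at every
    point, poles included, as [is_residue_ext] demands. *)
Lemma Cinv_mult (u v : C) : (/ (u * v) = / u * / v)%C.
Proof.
  assert (Z : (/ 0)%C = 0%C) by (unfold Cinv, RtoC; simpl; f_equal; unfold Rdiv; ring).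
  destruct (Ceq_dec u 0) as [->|Hu]; [rewrite Cmult_0_l, Z; ring|].
  destruct (Ceq_dec v 0) as [->|Hv]; [rewrite Cmult_0_r, Z; ring|].
  field. auto.
Qed.

Lemma Cmult_reg_l (k u v : C) : k <> 0%C -> (k * u)%C = (k * v)%C -> u = v.
Proof.
  intros Hk E. replace u with (k * u / k)%C by (field; exact Hk). rewrite E. field. exact Hk.
Qed.

Lemma CSeries_ext (u v : nat -> C) : (forall n, u n = v n) -> CSeries u = CSeries v.
Proof.
  intros H. unfold CSeries. f_equal; apply Series_ext; intros n; rewrite H; reflexivity.
Qed.

(** The scalar [k] makes this applicable to the inner sum of a double series, where it is
    [x^n / (2 pi i)]. *)
Lemma CSeries_strip_int_geometric (g q : C -> C) (h : nat -> C) (a psi M c : R) (k l : C) :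
  0 <= psi -> 0 <= M -> 0 <= c < 1 -> strip_bounded g a psi M ->
  (forall x y, a <= x -> - psi <= y <= psi -> Cmod (q (x, y)) <= c) ->
  (forall n, is_strip_int (fun z => g z * Cpow (q z) n)%C a psi (h n)) ->
  is_strip_int (fun z => g z / (1 - q z))%C a psi l ->
  CSeries (fun n => k * h n)%C = (k * l)%C.
Proof.
  intros Hpsi HM Hc Hg Hq Hh Hl.
  apply (CSeries_partial_sum _ _ (Cmod k * (M / (1 - c) * (2 * exp (- a) + 2 * psi))) c Hc).
  intros N. rewrite partial_sum_Cmult.
  replace (k * partial_sum h N - k * l)%C with (k * (partial_sum h N - l))%C by ring.
  rewrite Cmod_mult, Rmult_assoc. apply Rmult_le_compat_l; [apply Cmod_ge_0|].
  apply (partial_sum_strip_int_geometric g q); trivial.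
Qed.

Lemma ex_strip_int_geometric (g q : C -> C) (a psi M c : R) :
  0 <= psi -> 0 <= c < 1 -> strip_bounded g a psi M ->
  (forall x y, a <= x -> - psi <= y <= psi ->
    Cmod (q (x, y)) <= c /\ ex_Cderive g (x, y) /\ ex_Cderive q (x, y)) ->
  exists l, is_strip_int (fun z => g z / (1 - q z))%C a psi l.
Proof.
  intros Hpsi Hc Hg Hq.
  apply (ex_strip_int _ a psi (M / (1 - c))); trivial.
  - apply strip_bounded_geometric; trivial. intros; apply Hq; trivial.
  - intros x y Hx Hy. destruct (Hq x y Hx Hy) as (H1 & H2 & H3).
    apply (ex_Cderive_geometric _ _ c); trivial. lra.
Qed.

(** The kernel in the coordinate [w = ln u], [zeta = u^(alpha beta)]. *)
Definition log_kernel (alpha beta : R) (x y mu w : C) : C :=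
  (hankel_fun (1 + RtoC alpha + RtoC beta - mu) w
     / ((cexp (RtoC beta * w) - y) * (cexp (RtoC alpha * w) - x)))%C.

Lemma one_minus_cexp_quotient (z j w : C) :
  (cexp (j * w) * (1 - z * cexp (- j * w)) = cexp (j * w) - z)%C.
Proof.
  replace (- j * w)%C with (- (j * w))%C by ring. rewrite cexp_opp. field. apply cexp_neq_0.
Qed.

(** Two geometric summations: for each [n] the inner series in [y / u^beta], then the outer one in
    [x / u^alpha] with the inner sum as its base. Both ratios stay below 1 for [Re w >= b]. *)
Lemma mittag_leffler2_strip_int (alpha beta : R) (x y mu : C) (b psi : R) :
  0 < alpha -> 0 < beta -> PI / 2 < psi <= PI ->
  Cmod x < exp (alpha * b) -> Cmod y < exp (beta * b) ->
  is_strip_int (log_kernel alpha beta x y mu) b psi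
    (2 * RtoC PI * Ci * mittag_leffler2 (RtoC alpha) (RtoC beta) x y mu)%C.
Proof.
  intros Ha Hb Hpsi Hx Hy. assert (HPI := PI_RGT_0). assert (Hpsi0 : 0 <= psi) by lra.
  set (q := fun (j : R) (z w : C) => (z * cexp (- RtoC j * w))%C).
  assert (Hq : forall j z, 0 < j -> Cmod z < exp (j * b) ->
    0 <= Cmod z * exp (- j * b) < 1 /\
    forall t u, b <= t -> Cmod (q j z (t, u)) <= Cmod z * exp (- j * b)).
  { intros j z Hj Hz. split.
    - generalize (exp_pos (- j * b)) (Cmod_ge_0 z); intros. split; [nra|].
      replace 1 with (exp (j * b) * exp (- j * b)).
      + apply Rmult_lt_compat_r; trivial.
      + rewrite <- exp_plus. replace (j * b + - j * b) with 0 by ring. apply exp_0.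
    - intros t u Ht. unfold q. rewrite Cmod_mult, <- RtoC_opp, Cmod_cexp_real_mul.
      apply Rmult_le_compat_l; [apply Cmod_ge_0|]. apply exp_le_compat. nra. }
  assert (Dq : forall j z w, ex_Cderive (q j z) w).
  { intros. apply ex_Cderive_mult; [apply ex_Cderive_const|apply ex_Cderive_cexp_lin]. }
  destruct (Hq alpha x Ha Hx) as [Hcx Hqx]. destruct (Hq beta y Hb Hy) as [Hcy Hqy]. clear Hq.
  set (cx := Cmod x * exp (- alpha * b)) in *. set (cy := Cmod y * exp (- beta * b)) in *.
  assert (Qpow : forall j z w n, Cpow (q j z w) n = (Cpow z n * cexp (- (RtoC (INR n) * RtoC j) * w))%C).
  { intros j z w n. unfold q. rewrite Cpow_mult_l, Cpow_cexp. do 2 f_equal. ring. }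
  set (inner := fun k w => (hankel_fun k w / (1 - q beta y w))%C).
  assert (Hin : forall n, exists l,
    is_strip_int (inner (1 - (RtoC (INR n) * RtoC alpha + mu))%C) b psi l /\
    forall k, CSeries (fun m => k * (2 * RtoC PI * Ci * (Cpow y m *
      inv_Gamma (RtoC (INR n) * RtoC alpha + RtoC (INR m) * RtoC beta + mu))))%C = (k * l)%C).
  { intros n. set (s := (RtoC (INR n) * RtoC alpha + mu)%C).
    destruct (strip_bounded_hankel_fun (1 - s) b psi Hpsi) as [M [HM HB]].
    destruct (ex_strip_int_geometric (hankel_fun (1 - s)) (q beta y) b psi M cy) as [l Hl]; trivial.
    { intros t u Ht _. split; [apply Hqy, Ht|split; [apply ex_Cderive_hankel_fun|apply Dq]]. }
    exists l. split; [exact Hl|]. intros k.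
    apply (CSeries_strip_int_geometric (hankel_fun (1 - s)) (q beta y) _ b psi M cy); trivial.
    { intros t u Ht _. apply Hqy, Ht. }
    intros m.
    assert (K := is_strip_int_Cmult (Cpow y m) _ _ _ _ (hankel_formula psi b
      (RtoC (INR n) * RtoC alpha + RtoC (INR m) * RtoC beta + mu) Hpsi)).
    replace (2 * RtoC PI * Ci * (Cpow y m *
      inv_Gamma (RtoC (INR n) * RtoC alpha + RtoC (INR m) * RtoC beta + mu)))%C
      with (Cpow y m * (2 * RtoC PI * Ci *
      inv_Gamma (RtoC (INR n) * RtoC alpha + RtoC (INR m) * RtoC beta + mu)))%C by ring.
    revert K. apply is_strip_int_ext; trivial. intros t u _ _. generalize (t, u). intros w.
    rewrite Qpow.
    replace (1 - (RtoC (INR n) * RtoC alpha + RtoC (INR m) * RtoC beta + mu))%C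
      with (1 - s + - (RtoC (INR m) * RtoC beta))%C by (unfold s; ring).
    rewrite <- hankel_fun_mul_cexp. ring. }
  (* The inner sums must form a sequence before they can be the terms of the outer series. *)
  destruct (choice _ Hin) as [l Hl]. clear Hin.
  destruct (strip_bounded_hankel_fun (1 - mu) b psi Hpsi) as [M [HM HB]].
  assert (HB' : strip_bounded (inner (1 - mu)%C) b psi (M / (1 - cy))).
  { apply strip_bounded_geometric; trivial. intros t u Ht _. apply Hqy, Ht. }
  assert (HM' : 0 <= M / (1 - cy)).
  { apply Rmult_le_pos; [trivial|]. left; apply Rinv_0_lt_compat; lra. }
  destruct (ex_strip_int_geometric (inner (1 - mu)%C) (q alpha x) b psi (M / (1 - cy)) cx)
    as [L HL]; trivial.
  { intros t u Ht _. split; [apply Hqx, Ht|split; [|apply Dq]].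
    apply (ex_Cderive_geometric _ _ cy); [lra|apply Hqy, Ht|apply ex_Cderive_hankel_fun|apply Dq]. }
  assert (E : (2 * RtoC PI * Ci * mittag_leffler2 (RtoC alpha) (RtoC beta) x y mu)%C = L).
  { rewrite <- (Cmult_div_cancel _ L C2PI_neq_0). f_equal.
    unfold Cdiv. rewrite (Cmult_comm L).
    rewrite <- (CSeries_strip_int_geometric (inner (1 - mu)%C) (q alpha x)
      (fun n => Cpow x n * l n)%C b psi (M / (1 - cy)) cx _ L); trivial.
    - unfold mittag_leffler2. apply CSeries_ext. intros n.
      rewrite Cmult_assoc, <- (proj2 (Hl n)). apply CSeries_ext. intros m.
      generalize C2PI_neq_0. generalize (2 * RtoC PI * Ci)%C. intros p Hp. field. exact Hp.
    - intros t u Ht _. apply Hqx, Ht.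
    - intros n. generalize (is_strip_int_Cmult (Cpow x n) _ _ _ _ (proj1 (Hl n))).
      apply is_strip_int_ext; trivial. intros t u _ _. generalize (t, u). intros w.
      rewrite Qpow. unfold inner.
      (* The index [n] enters the inner integrand only through the factor [e^(- n alpha w)], which
         supplies the power of the outer ratio. *)
      replace (1 - (RtoC (INR n) * RtoC alpha + mu))%C
        with (1 - mu + - (RtoC (INR n) * RtoC alpha))%C by ring.
      rewrite <- hankel_fun_mul_cexp. unfold Cdiv. ring. }
  rewrite E. revert HL. apply is_strip_int_ext; trivial.
  intros t u Ht _. assert (N1 := Cone_minus_neq_0 _ cx (proj2 Hcx) (Hqx t u Ht)).
  assert (N2 := Cone_minus_neq_0 _ cy (proj2 Hcy) (Hqy t u Ht)).
  revert N1 N2. generalize (t, u). intros w N1 N2.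
  unfold log_kernel, inner.
  rewrite <- (one_minus_cexp_quotient y), <- (one_minus_cexp_quotient x).
  fold (q alpha x w). fold (q beta y w).
  (* The extra [alpha + beta] in the exponent comes from clearing [u^(-alpha)] and [u^(-beta)] in
     the two denominators. *)
  replace (1 + RtoC alpha + RtoC beta - mu)%C with (1 - mu + RtoC alpha + RtoC beta)%C by ring.
  rewrite <- !hankel_fun_mul_cexp. field. repeat split; trivial; apply cexp_neq_0.
Qed.

(** [Log z / k] with the principal logarithm, the candidate zero of [e^(k w) - z] in the strip. *)
Definition log_pole (k : R) (z : C) : R * R := (ln (Cmod z) / k, carg z / k).

Lemma cexp_log_pole (k : R) (z s : C) : 0 < k ->
  cexp (s * log_pole k z) = cpow z (s / RtoC k).
Proof.
  intros Hk. unfold cpow, polar_pow, log_pole. f_equal.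
  assert (Hk0 : RtoC k <> 0%C) by (intros E; apply RtoC_inj in E; lra).
  replace (ln (Cmod z) / k, carg z / k) with ((ln (Cmod z), carg z) / RtoC k)%C.
  - field. exact Hk0.
  - unfold Cdiv, Cinv, Cmult, RtoC; simpl. f_equal; field; lra.
Qed.

Lemma cexp_log_pole_self (k : R) (z : C) : 0 < k -> z <> 0%C -> cexp (RtoC k * log_pole k z) = z.
Proof.
  intros Hk Hz. rewrite cexp_log_pole by trivial.
  replace (RtoC k / RtoC k)%C with (RtoC 1).
  - unfold cpow, polar_pow. rewrite Cmult_1_l. apply cexp_log, Hz.
  - field. intros E; apply RtoC_inj in E; lra.
Qed.

(** Two solutions of [e^(k w) = z] differ by a multiple of [2 pi i / k]. Here [|k u| <= PI] and
    [|carg z| < PI], which excludes all multiples except 0. *)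
Lemma log_pole_unique (k psi : R) (z : C) (t u : R) : 0 < k -> z <> 0%C -> k * psi <= PI ->
  Rabs (carg z) < k * psi -> - psi <= u <= psi ->
  cexp (RtoC k * (t, u)) = z -> (t, u) = log_pole k z.
Proof.
  intros Hk Hz Hpsi Harg Hu E. rewrite <- (cexp_log_pole_self k z Hk Hz) in E.
  apply cexp_inj_strip in E.
  - assert (Hk0 : RtoC k <> 0%C) by (intros E0; apply RtoC_inj in E0; lra).
    exact (Cmult_reg_l (RtoC k) (t, u) (log_pole k z) Hk0 E).
  - unfold log_pole, Im, RtoC, Cmult; simpl.
    replace (k * u + 0 * t - (k * (carg z / k) + 0 * (ln (Cmod z) / k))) with (k * u - carg z)
      by (field; lra).
    apply Rabs_lt_between in Harg. apply Rabs_lt_between. nra.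
Qed.

Lemma is_residue_log_kernel (k : R) (x : C) (g : C -> C) : 0 < k -> x <> 0%C ->
  ex_Cderive g (log_pole k x) ->
  is_residue (fun w => g w / (cexp (RtoC k * w) - x))%C (log_pole k x)
    (g (log_pole k x) / (RtoC k * x))%C.
Proof.
  intros Hk Hx Hg. apply is_residue_quotient; trivial.
  - apply is_Cderive_minus_const. rewrite <- (cexp_log_pole_self k x Hk Hx) at 2.
    apply is_Cderive_cexp_lin.
  - rewrite cexp_log_pole_self by trivial. ring.
  - apply Cmult_neq_0; trivial. intros E; apply RtoC_inj in E; lra.
Qed.

(** * Back to the original contour *)

Lemma is_CInt_comp_ln (G : R -> C) (p eps T : R) : 0 < p -> 0 < eps -> eps <= T ->
  (forall t, ln eps / p <= t -> Ccontinuous G t) ->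
  is_CInt (fun r => RtoC (/ (p * r)) * G (ln r / p)%R)%C eps T
    (CInt G (ln eps / p) (ln T / p)).
Proof.
  intros Hp He HT HG.
  apply (is_RInt_ext (V := C_R_CompleteNormedModule)) with
    (f := fun r => scal (V := C_R_CompleteNormedModule) (/ (p * r)) (G (ln r / p))).
  { intros r _. apply (scal_R_Cmult (/ (p * r)) (G (ln r / p))). }
  apply (is_RInt_comp (V := C_R_CompleteNormedModule) G (fun r => ln r / p) (fun r => / (p * r)));
    rewrite Rmin_left, Rmax_right by lra; intros r Hr.
  - apply HG. apply Rmult_le_compat_r; [left; apply Rinv_0_lt_compat, Hp|]. apply ln_le; lra.
  - split.
    + auto_derive; [lra|]. field. lra.
    + apply continuity_pt_filterlim. apply derivable_continuous_pt.
      apply ex_derive_Reals_0. auto_derive. nra.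
Qed.

Lemma is_ray_int_comp_ln (G : R -> C) (p eps : R) (l : C) : 0 < p -> 0 < eps ->
  (forall t, ln eps / p <= t -> Ccontinuous G t) ->
  is_ray_int G (ln eps / p) l ->
  is_ray_int (fun r => RtoC (/ (p * r)) * G (ln r / p)%R)%C eps l.
Proof.
  intros Hp He HG H. apply is_ray_int_eps. intros e He'.
  destruct (proj1 (is_ray_int_eps _ _ _) H e He') as [N HN].
  exists (Rmax eps (exp (p * N))). intros T HT.
  assert (H1 := Rle_lt_trans _ _ _ (Rmax_l _ _) HT).
  assert (H2 := Rle_lt_trans _ _ _ (Rmax_r _ _) HT).
  destruct (HN (ln T / p)) as [v [Hv1 Hv2]].
  { apply Rlt_div_r; [exact Hp|]. apply ln_increasing in H2; [|apply exp_pos].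
    rewrite ln_exp in H2. lra. }
  exists v. split; trivial. rewrite <- (is_CInt_unique _ _ _ _ Hv1).
  apply is_CInt_comp_ln; trivial. lra.
Qed.

(** The substitution [zeta = e^(p w)] has [dzeta = p zeta dw], so [F] stands for [f] times [zeta];
    the hypothesis relating them says this after division by [r]. *)
Lemma hankel_integral_log (f : R -> R -> C) (F : C -> C) (p eps theta : R) (l : C) :
  0 < p -> 0 < eps -> 0 <= theta ->
  (forall r phi, 0 < r -> - theta <= phi <= theta ->
    (f r phi * cexp (0, phi))%C = (RtoC (/ r) * F ((ln r / p)%R, (phi / p)%R))%C) ->
  (forall x y, ln eps / p <= x -> (y = theta / p \/ y = - (theta / p)) -> ex_Cderive F (x, y)) ->
  is_strip_int F (ln eps / p) (theta / p) l ->
  hankel_integral eps theta f = (RtoC p * l)%C.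
Proof.
  intros Hp He Hth Hf HF (low & mid & up & H1 & H2 & H3 & ->).
  assert (Hpi : 0 < / p) by (apply Rinv_0_lt_compat, Hp).
  assert (RAY : forall phi L, - theta <= phi <= theta -> (phi / p = theta / p \/ phi / p = - (theta / p)) ->
    is_ray_int (fun t => F (t, phi / p)) (ln eps / p) L ->
    is_ray_int (fun r => f r phi * cexp (0, phi))%C eps (RtoC p * L)%C).
  { intros phi L Hphi Hphi2 HL.
    apply is_ray_int_comp_ln in HL; trivial.
    - apply (is_ray_int_Cmult (RtoC p)) in HL. revert HL. apply is_ray_int_ext. intros r Hr.
      rewrite Hf by (trivial; lra). rewrite Cmult_assoc, <- RtoC_mult. do 2 f_equal. field. lra.
    - intros t Ht. apply Ccontinuous_horizontal, HF; trivial. }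
  replace (- (theta / p)) with (- theta / p) in H1, H2 by (field; lra).
  assert (R1 := RAY (- theta) low ltac:(lra) ltac:(right; field; lra) H1).
  assert (R3 := RAY theta up ltac:(lra) ltac:(left; reflexivity) H3).
  assert (R2 : is_CInt (fun phi => f eps phi * (Ci * RtoC eps * cexp (0, phi)))%C (- theta) theta
    (RtoC p * (Ci * mid))%C).
  { replace (- theta / p) with (/ p * - theta + 0) in H2 by (field; lra).
    replace (theta / p) with (/ p * theta + 0) in H2 by (field; lra).
    apply (is_RInt_comp_lin (V := C_R_CompleteNormedModule)) in H2.
    apply (is_CInt_Cmult Ci) in H2. apply (is_CInt_Cmult (RtoC p)) in H2.
    revert H2. apply (is_RInt_ext (V := C_R_CompleteNormedModule)).
    intros phi. rewrite Rmin_left, Rmax_right by lra. intros Hphi.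
    rewrite (scal_R_Cmult (/ p) _).
    replace (f eps phi * (Ci * RtoC eps * cexp (0, phi)))%C
      with (Ci * RtoC eps * (f eps phi * cexp (0, phi)))%C by ring.
    rewrite Hf by lra. rewrite !RtoC_inv by lra.
    replace (/ p * phi + 0) with (phi / p) by (field; lra).
    match goal with |- ?u = ?v => change (@eq C u v) end.
    field. split; intros E; apply RtoC_inj in E; lra. }
  unfold hankel_integral.
  rewrite (is_ray_int_unique _ _ _ R1), (is_ray_int_unique _ _ _ R3), (is_CInt_unique _ _ _ _ R2).
  ring.
Qed.

Lemma polar_pow_scaled (p r phi : R) (k : C) : 0 < p ->
  polar_pow r phi (k / RtoC p) = cexp (k * ((ln r / p)%R, (phi / p)%R)).
Proof.
  intros Hp. unfold polar_pow. f_equal.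
  assert (Hp0 : RtoC p <> 0%C) by (intros E; apply RtoC_inj in E; lra).
  replace (ln r / p, phi / p) with ((ln r, phi) / RtoC p)%C.
  - field. exact Hp0.
  - unfold Cdiv, Cinv, Cmult, RtoC; simpl. f_equal; field; lra.
Qed.

Lemma mittag_leffler2_kernel_log (alpha beta : R) (x y mu : C) (r phi : R) :
  0 < alpha -> 0 < beta -> 0 < r ->
  (mittag_leffler2_kernel alpha beta x y mu r phi * cexp (0, phi))%C =
  (RtoC (/ r) * log_kernel alpha beta x y mu ((ln r / (alpha * beta))%R, (phi / (alpha * beta))%R))%C.
Proof.
  intros Ha Hb Hr. set (p := alpha * beta). assert (Hp : 0 < p) by (unfold p; nra).
  unfold mittag_leffler2_kernel, log_kernel, hankel_fun. fold p.
  set (k := (1 + RtoC alpha + RtoC beta - mu)%C). set (w := (ln r / p, phi / p)).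
  assert (Hp0 : RtoC p <> 0%C) by (intros E; apply RtoC_inj in E; lra).
  assert (Hr0 : RtoC r <> 0%C) by (intros E; apply RtoC_inj in E; lra).
  replace (RtoC (1 / p)) with (1 / RtoC p)%C by (rewrite RtoC_div by lra; reflexivity).
  replace (RtoC (1 / alpha)) with (RtoC beta / RtoC p)%C.
  2: { unfold p. rewrite <- RtoC_div by (fold p; lra). f_equal. field. lra. }
  replace (RtoC (1 / beta)) with (RtoC alpha / RtoC p)%C.
  2: { unfold p. rewrite <- RtoC_div by (fold p; lra). f_equal. field. lra. }
  rewrite !polar_pow_scaled by trivial. fold w. rewrite Cmult_1_l.
  (* The [- 1] in the exponent of [zeta] cancels against the factor [e^(i phi)] of the line element
     and leaves [1 / r]. *)
  assert (E : (polar_pow r phi (k / RtoC p - 1) * cexp (0, phi) = RtoC (/ r) * cexp (k * w))%C).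
  { unfold w. rewrite <- polar_pow_scaled by trivial. unfold polar_pow.
    replace ((k / RtoC p - 1) * (ln r, phi))%C with (k / RtoC p * (ln r, phi) - (ln r, phi))%C by ring.
    rewrite cexp_minus.
    replace (ln r, phi) with (RtoC (ln r) + (0, phi))%C at 2
      by (unfold RtoC, Cplus; simpl; f_equal; ring).
    rewrite cexp_plus. unfold RtoC at 2. rewrite cexp_ln by trivial.
    rewrite RtoC_inv by lra. field. split; [exact Hr0|apply cexp_neq_0]. }
  transitivity (cexp (cexp w) * (polar_pow r phi (k / RtoC p - 1) * cexp (0, phi))
    / ((cexp (RtoC beta * w) - y) * (cexp (RtoC alpha * w) - x)))%C.
  - unfold Cdiv. ring.
  - rewrite E. unfold Cdiv. ring.
Qed.

(** Taking logarithms and dividing by [k] turns the region for [z] into the open half-strip, the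
    same one for [x] with [(k, j) = (alpha, beta)] and for [y] with the roles exchanged. *)
Lemma ln_pole_bounds (k j eps theta : R) (z : C) : 0 < k -> 0 < j -> 0 < eps ->
  Omega_plus (Rpower eps (1 / j)) (theta / j) z ->
  z <> 0%C /\ ln eps / (k * j) < ln (Cmod z) / k /\ Rabs (carg z) < k * (theta / (k * j)) /\
  - (theta / (k * j)) < carg z / k < theta / (k * j).
Proof.
  intros Hk Hj He [H1 H2].
  assert (Hz : 0 < Cmod z) by (eapply Rle_lt_trans; [|exact H1]; left; apply exp_pos).
  split; [apply Cmod_gt_0, Hz|].
  replace (k * (theta / (k * j))) with (theta / j) by (field; lra).
  split; [|split; [exact H2|]].
  - replace (ln eps / (k * j)) with (1 / j * ln eps / k) by (field; lra).
    apply Rmult_lt_compat_r; [apply Rinv_0_lt_compat, Hk|].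
    apply ln_increasing in H1; [|apply exp_pos]. unfold Rpower in H1. rewrite ln_exp in H1. exact H1.
  - apply Rabs_lt_between in H2. replace (theta / (k * j)) with (theta / j / k) by (field; lra).
    replace (- (theta / j / k)) with (- (theta / j) / k) by (field; lra).
    split; apply Rmult_lt_compat_r; try lra; apply Rinv_0_lt_compat, Hk.
Qed.

(** The derivative of [e^(k w) - x] at its zero is [k x]; this [x] cancels the part [e^(k w) = x] of
    the numerator, so the surviving exponent is [h / k]. *)
Lemma residue_term (k : R) (x h j d : C) : 0 < k -> x <> 0%C -> (cexp (j * log_pole k x) - d <> 0)%C ->
  (hankel_fun (h + RtoC k) (log_pole k x) / (cexp (j * log_pole k x) - d) / (RtoC k * x) =
  RtoC (1 / k) * (cexp (cpow x (RtoC (1 / k))) * cpow x (h / RtoC k) / (cpow x (j / RtoC k) - d)))%C.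
Proof.
  intros Hk Hx Hd. assert (Hk0 : RtoC k <> 0%C) by (intros E; apply RtoC_inj in E; lra).
  rewrite <- hankel_fun_mul_cexp, (cexp_log_pole_self k x Hk Hx). unfold hankel_fun.
  rewrite <- (cexp_log_pole k x j Hk), <- (cexp_log_pole k x h Hk).
  replace (cexp (log_pole k x)) with (cpow x (RtoC (1 / k))).
  - rewrite RtoC_div by lra. field. repeat split; trivial.
  - rewrite RtoC_div by lra. rewrite <- cexp_log_pole by trivial. f_equal. apply Cmult_1_l.
Qed.

Theorem lemma2p3 (alpha beta : R) (mu : C) (eps theta : R) (x y : C)
  (halpha : (0 < alpha < 2)%R) (hbeta : (0 < beta < 2)%R)
  (halphabeta : (alpha * beta < 2)%R)
  (heps : (0 < eps)%R)
  (htheta : (PI * alpha * beta / 2 < theta <= Rmin PI (PI * alpha * beta))%R)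
  (* the contours bounding the two regions are defined for openings up to PI *)
  (htheta_alpha : (theta / beta <= PI)%R)
  (htheta_beta : (theta / alpha <= PI)%R)
  (hx : Omega_plus (Rpower eps (1 / beta)) (theta / beta) x)
  (hy : Omega_plus (Rpower eps (1 / alpha)) (theta / alpha) y)
  (* the two fractions of the right-hand side are defined *)
  (hxy : cpow x (RtoC (beta / alpha)) <> y)
  (hyx : cpow y (RtoC (alpha / beta)) <> x) :
  mittag_leffler2 (RtoC alpha) (RtoC beta) x y mu =
  (RtoC (1 / alpha)
     * (cexp (cpow x (RtoC (1 / alpha)))
          * cpow x ((1 + RtoC beta - mu) / RtoC alpha)
        / (cpow x (RtoC (beta / alpha)) - y))
   + RtoC (1 / beta)
     * (cexp (cpow y (RtoC (1 / beta)))
          * cpow y ((1 + RtoC alpha - mu) / RtoC beta)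
        / (cpow y (RtoC (alpha / beta)) - x))
   + 1 / (2 * RtoC PI * Ci) * RtoC (1 / (alpha * beta))
     * hankel_integral eps theta (mittag_leffler2_kernel alpha beta x y mu))%C.
Proof.
  assert (Ha : 0 < alpha) by lra. assert (Hb : 0 < beta) by lra. assert (HPI := PI_RGT_0).
  set (p := alpha * beta) in *. assert (Hp : 0 < p) by (unfold p; nra).
  set (psi := theta / p). set (a := ln eps / p).
  assert (Hth : PI * p / 2 < theta <= PI * p).
  { unfold p. destruct htheta as [T1 T2]. assert (T3 := Rmin_r PI (PI * alpha * beta)). lra. }
  (* Divided by [alpha * beta], the range of [theta] becomes the range in which the contour
     integrals converge. *)
  assert (Hpsi : PI / 2 < psi <= PI).
  { assert (Ep : psi * p = theta) by (unfold psi; field; lra).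
    split; [apply Rmult_lt_reg_r with p|apply Rmult_le_reg_r with p]; lra. }
  destruct (ln_pole_bounds alpha beta eps theta x Ha Hb heps hx) as (Hx0 & Xre & Xarg & Xim).
  destruct (ln_pole_bounds beta alpha eps theta y Hb Ha heps hy) as (Hy0 & Yre & Yarg & Yim).
  rewrite (Rmult_comm beta alpha) in Yre, Yarg, Yim. fold p psi in Xre, Xarg, Xim, Yre, Yarg, Yim.
  fold a in Xre, Yre.
  (* This and the next bound ensure that each factor of the denominator has a single zero in the
     strip. *)
  assert (Hapsi : alpha * psi <= PI).
  { unfold psi, p. replace (alpha * (theta / (alpha * beta))) with (theta / beta) by (field; lra). trivial. }
  assert (Hbpsi : beta * psi <= PI).
  { unfold psi, p. replace (beta * (theta / (alpha * beta))) with (theta / alpha) by (field; lra). trivial. }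
  (* A vertical side to the right of both poles, where both geometric series converge. *)
  set (b := Rmax (ln (Cmod x) / alpha) (ln (Cmod y) / beta) + 1).
  assert (Hbx : ln (Cmod x) / alpha < b).
  { unfold b. generalize (Rmax_l (ln (Cmod x) / alpha) (ln (Cmod y) / beta)). lra. }
  assert (Hby : ln (Cmod y) / beta < b).
  { unfold b. generalize (Rmax_r (ln (Cmod x) / alpha) (ln (Cmod y) / beta)). lra. }
  clearbody b.
  assert (Kx : 0 < Cmod x) by (apply Cmod_gt_0, Hx0).
  assert (Ky : 0 < Cmod y) by (apply Cmod_gt_0, Hy0).
  set (F := log_kernel alpha beta x y mu).
  set (E := mittag_leffler2 (RtoC alpha) (RtoC beta) x y mu).
  assert (HE : is_strip_int F b psi (2 * RtoC PI * Ci * E)%C).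
  { apply mittag_leffler2_strip_int; trivial.
    - rewrite <- (exp_ln (Cmod x)) by trivial. apply exp_increasing.
      apply Rlt_div_l in Hbx; lra.
    - rewrite <- (exp_ln (Cmod y)) by trivial. apply exp_increasing.
      apply Rlt_div_l in Hby; lra. }
  set (k := (1 + RtoC alpha + RtoC beta - mu)%C).
  assert (HF : forall t u, - psi <= u <= psi -> (t, u) <> log_pole alpha x ->
    (t, u) <> log_pole beta y -> ex_Cderive F (t, u)).
  { intros t u Hu Nx Ny. apply ex_Cderive_div.
    - apply ex_Cderive_hankel_fun.
    - apply ex_Cderive_mult; (apply ex_Cderive_minus; [apply ex_Cderive_cexp_lin|apply ex_Cderive_const]).
    - apply Cmult_neq_0; apply Cminus_eq_contra; intros E0.
      + apply Ny. apply (log_pole_unique beta psi); trivial.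
      + apply Nx. apply (log_pole_unique alpha psi); trivial. }
  assert (Ba : cpow x (RtoC beta / RtoC alpha) = cpow x (RtoC (beta / alpha)))
    by (rewrite RtoC_div by lra; reflexivity).
  assert (Ab : cpow y (RtoC alpha / RtoC beta) = cpow y (RtoC (alpha / beta)))
    by (rewrite RtoC_div by lra; reflexivity).
  assert (Dx : (cexp (RtoC beta * log_pole alpha x) - y <> 0)%C).
  { rewrite cexp_log_pole, Ba by trivial. apply Cminus_eq_contra, hxy. }
  assert (Dy : (cexp (RtoC alpha * log_pole beta y) - x <> 0)%C).
  { rewrite cexp_log_pole, Ab by trivial. apply Cminus_eq_contra, hyx. }
  assert (Rx : is_residue F (log_pole alpha x)
    (hankel_fun k (log_pole alpha x) / (cexp (RtoC beta * log_pole alpha x) - y) / (RtoC alpha * x))%C).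
  { apply (is_residue_ext (fun w => hankel_fun k w / (cexp (RtoC beta * w) - y)
      / (cexp (RtoC alpha * w) - x))%C).
    - intros w. unfold F, log_kernel. fold k. unfold Cdiv. rewrite Cinv_mult. ring.
    - apply (is_residue_log_kernel alpha x (fun w => hankel_fun k w / (cexp (RtoC beta * w) - y))%C); trivial.
      apply ex_Cderive_div; trivial; [apply ex_Cderive_hankel_fun|].
      apply ex_Cderive_minus; [apply ex_Cderive_cexp_lin|apply ex_Cderive_const]. }
  assert (Ry : is_residue F (log_pole beta y)
    (hankel_fun k (log_pole beta y) / (cexp (RtoC alpha * log_pole beta y) - x) / (RtoC beta * y))%C).
  { apply (is_residue_ext (fun w => hankel_fun k w / (cexp (RtoC alpha * w) - x)
      / (cexp (RtoC beta * w) - y))%C).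
    - intros w. unfold F, log_kernel. fold k. unfold Cdiv. rewrite Cinv_mult. ring.
    - apply (is_residue_log_kernel beta y (fun w => hankel_fun k w / (cexp (RtoC alpha * w) - x))%C); trivial.
      apply ex_Cderive_div; trivial; [apply ex_Cderive_hankel_fun|].
      apply ex_Cderive_minus; [apply ex_Cderive_cexp_lin|apply ex_Cderive_const]. }
  (* At a common zero the two simple poles would merge; [hxy] excludes this, since [e^(beta w)]
     would equal [y] at the pole of [x]. *)
  assert (Hne : log_pole alpha x <> log_pole beta y).
  { intros E0. apply Dx. rewrite E0, cexp_log_pole_self by trivial. ring. }
  assert (EX : ex_rect_int F a b (- psi) psi).
  { apply ex_rect_int_holo; try lra.
    split; intros t Ht; split; apply HF; try lra; intros E0; injection E0; lra. }
  assert (HQ := rect_int_two_poles F a b (- psi) psi (ln (Cmod x) / alpha) (carg x / alpha)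
    (ln (Cmod y) / beta) (carg y / beta) _ _
    ltac:(lra) ltac:(lra) ltac:(lra) ltac:(lra) Hne (fun t u _ Hu => HF t u Hu) Rx Ry).
  assert (Hl := is_strip_int_move F a b psi _ EX HE). rewrite HQ in Hl.
  (* The exponent is regrouped as [h + alpha] in the residue for [x] and as [h + beta] in the one
     for [y], the shape that [residue_term] uses. *)
  replace k with (1 + RtoC beta - mu + RtoC alpha)%C in Hl at 1 by (unfold k; ring).
  replace k with (1 + RtoC alpha - mu + RtoC beta)%C in Hl by (unfold k; ring).
  rewrite (residue_term alpha x), (residue_term beta y), Ba, Ab in Hl by trivial.
  unfold a, psi in Hl.
  rewrite (hankel_integral_log (mittag_leffler2_kernel alpha beta x y mu) F p eps theta _ Hp heps
    ltac:(nra) (fun r phi Hr _ => mittag_leffler2_kernel_log alpha beta x y mu r phi Ha Hb Hr)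
    ltac:(fold psi a; intros t u Ht Hu; apply HF;
      [destruct Hu; lra| |]; intros E0; injection E0; destruct Hu; lra) Hl).
  (* With [A] and [B] the two explicit terms, the contour integral is
     [p * (2 pi i E - 2 pi i (A + B))]; solving for [E] is all that is left. *)
  set (A := (RtoC (1 / alpha) * _)%C). set (B := (RtoC (1 / beta) * _)%C).
  rewrite RtoC_div by lra.
  assert (Hp0 : RtoC p <> 0%C) by (intros E0; apply RtoC_inj in E0; lra).
  generalize C2PI_neq_0. generalize (2 * RtoC PI * Ci)%C. intros c Hc. field. split; trivial.
Qed.
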